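(* Let $R$ be a commutative ring with a derivation $D$, and let $R^D=\{r\in R: D(r)=0\}$ be its ring of constants. The map $BM(R^D) \to BM^{\text{diff}}(R)$ induced by $A_0 \mapsto R \otimes_{R^D} A_0$ (for $A_0$ an Azumaya $R^D$-algebra, where $R\otimes_{R^D}A_0$ has the derivation $D\otimes 1$) is an isomorphism from $BM(R^D)$ to the group of units of the monoid $BM^{\text{diff}}(R)$.
   Context: A differential $R$-algebra is an $R$-algebra $A$ with a derivation $D_A$ extending the derivation $D$ of $R$. A differential Azumaya $R$-algebra is a differential $R$-algebra which is Azumaya as an $R$-algebra. A homomorphism of differential algebras is an $R$-algebra homomorphism commuting with the derivations. The tensor product $A\otimes_R B$ of differential algebras has derivation $D_A\otimes 1+1\otimes D_B$. Monoids are commutative. If $N\subseteq M$ is a submonoid, $M/N$ is the monoid of equivalence classes of $M$ under: $m_1\sim m_2$ iff there are $n_1,n_2\in N$ with $m_1n_1=m_2n_2$. The group of units of a monoid is the set of its invertible elements. For a commutative ring $S$, $MA(S)$ is the monoid (under $\otimes_S$) of isomorphism classes of Azumaya $S$-algebras, $MM(S)$ its submonoid of classes of matrix algebras $M_n(S)$, $n\ge1$, and $BM(S)=MA(S)/MM(S)$. $MA^{\text{diff}}(R)$ is the monoid (under $\otimes_R$) of differential isomorphism classes of differential Azumaya $R$-algebras, $MM_0^{\text{diff}}(R)$ its submonoid of classes of matrix algebras $M_n(R)$, $n\ge 1$, with entrywise derivation, and $BM^{\text{diff}}(R)=MA^{\text{diff}}(R)/MM_0^{\text{diff}}(R)$.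 *)

(* Defs.v *)
From HB Require Import structures.
From mathcomp Require Import all_boot all_algebra.
From mathcomp Require Import boolp.

Set Implicit Arguments.
Unset Strict Implicit.
Unset Printing Implicit Defensive.

Import GRing.Theory.
Local Open Scope ring_scope.
Local Open Scope quotient_scope.

(* Unital associative algebras over a commutative ring. The library's algType
   requires 1 != 0; here the zero ring is allowed, both as a base ring and as
   an algebra. *)
Record pzAlg (S : comPzRingType) := PzAlg {
  palg_ring : pzRingType;
  palg_scale : S -> palg_ring -> palg_ring;
  palg_scaleA : forall a b x,
    palg_scale a (palg_scale b x) = palg_scale (a * b) x;
  palg_scale1 : left_id 1 palg_scale;
  palg_scaleDr : right_distributive palg_scale +%R;
  palg_scaleDl : forall x, {morph palg_scale^~ x : a b / a + b};
  palg_scaleAl : forall k x y, palg_scale k (x * y) = palg_scale k x * y;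
  palg_scaleAr : forall k x y, palg_scale k (x * y) = x * palg_scale k y
}.

Definition palg_sort (S : comPzRingType) (A : pzAlg S) : Type := palg_ring A.
Coercion palg_sort : pzAlg >-> Sortclass.

HB.instance Definition _ (S : comPzRingType) (A : pzAlg S) :=
  GRing.PzRing.copy (palg_sort A) (palg_ring A).
HB.instance Definition _ (S : comPzRingType) (A : pzAlg S) :=
  GRing.Zmodule_isLmodule.Build S (palg_sort A)
    (@palg_scaleA S A) (@palg_scale1 S A) (@palg_scaleDr S A) (@palg_scaleDl S A).

Coercion Defs_palg_sort__canonical__GRing_PzRing : pzAlg >-> GRing.PzRing.type.
Coercion Defs_palg_sort__canonical__GRing_Lmodule : pzAlg >-> GRing.Lmodule.type.

Lemma palgAl (S : comPzRingType) (A : pzAlg S) (k : S) (x y : A) :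
  k *: (x * y) = (k *: x) * y.
Proof. exact: palg_scaleAl. Qed.

Lemma palgAr (S : comPzRingType) (A : pzAlg S) (k : S) (x y : A) :
  k *: (x * y) = x * (k *: y).
Proof. exact: palg_scaleAr. Qed.

Definition base_alg (S : comPzRingType) : pzAlg S :=
  @PzAlg S S *%R (@mulrA S) (@mul1r S) (@mulrDr S)
    (fun x a b => mulrDl a b x) (@mulrA S) (@mulrCA S).

Definition mx_alg (S : comPzRingType) (n : nat) : pzAlg S :=
  @PzAlg S 'M[S]_n *:%R (@scalerA S 'M[S]_n) (@scale1r S 'M[S]_n)
    (@scalerDr S 'M[S]_n) (fun x a b => scalerDl x a b)
    (fun k (A B : 'M[S]_n) => scalemxAl k A B)
    (fun k (A B : 'M[S]_n) => scalemxAr k A B).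

Section Tensor.
Variables (S : comPzRingType) (M N : lmodType S).

Definition balanced (V : zmodType) (f : M -> N -> V) : Prop :=
  [/\ forall x x' y, f (x + x') y = f x y + f x' y,
      forall x y y', f x (y + y') = f x y + f x y'
    & forall k x y, f (k *: x) y = f x (k *: y)].

Definition pair_sum (V : zmodType) (f : M -> N -> V) (s : seq (M * N)) : V :=
  \sum_(p <- s) f p.1 p.2.

(* A formal sum of pairs represents the sum of the corresponding pure tensors;
   two formal sums are identified when no balanced biadditive map separates
   them, which makes [tensor] the universal target of such maps. *)
Definition tensor_rel (s s' : seq (M * N)) : bool :=
  `[< forall (V : zmodType) (f : M -> N -> V),
        balanced f -> pair_sum f s = pair_sum f s' >].

Fact tensor_rel_refl : reflexive tensor_rel.
Proof. by move=> s; apply/asboolP. Qed.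

Fact tensor_rel_sym : symmetric tensor_rel.
Proof.
by move=> s s'; apply/asboolP/asboolP => h V f bf; rewrite (h V f bf).
Qed.

Fact tensor_rel_trans : transitive tensor_rel.
Proof.
move=> s2 s1 s3 /asboolP h /asboolP h'; apply/asboolP => V f bf.
by rewrite (h V f bf) (h' V f bf).
Qed.

Canonical tensor_equiv :=
  EquivRel tensor_rel tensor_rel_refl tensor_rel_sym tensor_rel_trans.

Definition tensor := {eq_quot tensor_equiv}.

HB.instance Definition _ := Choice.on tensor.
HB.instance Definition _ := EqQuotient.on tensor.

Definition tpure (x : M) (y : N) : tensor := \pi_tensor [:: (x, y)].

Definition tlift (V : zmodType) (f : M -> N -> V) (t : tensor) : V :=
  pair_sum f (repr t).

Lemma tlift_pi (V : zmodType) (f : M -> N -> V) s :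
  balanced f -> tlift f (\pi_tensor s) = pair_sum f s.
Proof.
move=> bf; rewrite /tlift; have /eqquotP/asboolP : \pi_tensor (repr (\pi_tensor s)) = \pi_tensor s.
  by rewrite reprK.
exact.
Qed.

Definition tadd (t u : tensor) : tensor := \pi_tensor (repr t ++ repr u).
Definition topp (t : tensor) : tensor :=
  \pi_tensor [seq (- p.1, p.2) | p <- repr t].
Definition tscale (k : S) (t : tensor) : tensor :=
  \pi_tensor [seq (k *: p.1, p.2) | p <- repr t].

Lemma tensor_sep (t u : tensor) :
  (forall (V : zmodType) (f : M -> N -> V), balanced f -> tlift f t = tlift f u) ->
  t = u.
Proof.
move=> h; rewrite -[t]reprK -[u]reprK; apply/eqquotP/asboolP => V f bf.
exact: h.
Qed.

Section Lift.
Variables (V : zmodType) (f : M -> N -> V).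
Hypothesis bf : balanced f.

Lemma balN x y : f (- x) y = - f x y.
Proof.
case: bf => fDl _ _; apply: (addIr (f x y)); rewrite -fDl !addNr.
by apply: (addIr (f 0 y)); rewrite -fDl addr0 add0r.
Qed.

Lemma balZ (k : S) : balanced (fun x y => f (k *: x) y).
Proof.
case: bf => fDl fDr fZ; split=> [x x' y|x y y'|l x y].
- by rewrite scalerDr fDl.
- by rewrite fDr.
- by rewrite scalerA mulrC -scalerA fZ.
Qed.

Lemma tlift_tadd t u : tlift f (tadd t u) = tlift f t + tlift f u.
Proof. by rewrite tlift_pi // /pair_sum big_cat. Qed.

Lemma tlift_topp t : tlift f (topp t) = - tlift f t.
Proof.
rewrite tlift_pi // /tlift /pair_sum big_map -sumrN.
by apply: eq_bigr => p _; rewrite balN.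
Qed.

Lemma tlift_tscale k t : tlift f (tscale k t) = tlift (fun x y => f (k *: x) y) t.
Proof. by rewrite tlift_pi // /tlift /pair_sum big_map. Qed.

End Lift.

Fact taddA : associative tadd.
Proof. by move=> t u v; apply: tensor_sep => V f bf; rewrite !tlift_tadd ?addrA. Qed.
Fact taddC : commutative tadd.
Proof. by move=> t u; apply: tensor_sep => V f bf; rewrite !tlift_tadd // addrC. Qed.
Fact tadd0 : left_id (\pi_tensor [::]) tadd.
Proof.
move=> t; apply: tensor_sep => V f bf.
by rewrite tlift_tadd // tlift_pi // /pair_sum big_nil add0r.
Qed.
Fact taddN : left_inverse (\pi_tensor [::]) topp tadd.
Proof.
move=> t; apply: tensor_sep => V f bf.
by rewrite tlift_tadd // tlift_topp // tlift_pi // /pair_sum big_nil addNr.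
Qed.

HB.instance Definition _ := GRing.isZmodule.Build tensor taddA taddC tadd0 taddN.

Lemma tliftE (V : zmodType) (f : M -> N -> V) x y :
  balanced f -> tlift f (tpure x y) = f x y.
Proof. by move=> bf; rewrite tlift_pi // /pair_sum big_seq1. Qed.

Lemma tliftD (V : zmodType) (f : M -> N -> V) t u :
  balanced f -> tlift f (t + u) = tlift f t + tlift f u.
Proof. by move=> bf; rewrite tlift_tadd. Qed.

Lemma tlift0 (V : zmodType) (f : M -> N -> V) : balanced f -> tlift f 0 = 0.
Proof. by move=> bf; rewrite tlift_pi // /pair_sum big_nil. Qed.

Lemma tpure_balanced : balanced tpure.
Proof.
split=> [x x' y|x y y'|k x y]; apply: tensor_sep => V f bf; case: (bf) => fDl fDr fZ.
- by rewrite tliftD // !tliftE.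
- by rewrite tliftD // !tliftE.
- by rewrite !tliftE.
Qed.

Lemma tpureDl x x' y : tpure (x + x') y = tpure x y + tpure x' y.
Proof. by case: tpure_balanced. Qed.
Lemma tpureDr x y y' : tpure x (y + y') = tpure x y + tpure x y'.
Proof. by case: tpure_balanced. Qed.
Lemma tpureZ k x y : tpure (k *: x) y = tpure x (k *: y).
Proof. by case: tpure_balanced. Qed.

Fact tscaleA a b t : tscale a (tscale b t) = tscale (a * b) t.
Proof.
apply: tensor_sep => V f bf.
rewrite !tlift_tscale //; last exact: balZ.
by apply: eq_bigr => p _; rewrite scalerA.
Qed.
Fact tscale1 : left_id 1 tscale.
Proof.
move=> t; apply: tensor_sep => V f bf; rewrite tlift_tscale //.
by apply: eq_bigr => p _; rewrite scale1r.
Qed.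
Fact tscaleDr : right_distributive tscale +%R.
Proof.
move=> k t u; apply: tensor_sep => V f bf.
by rewrite tliftD // !tlift_tscale // tliftD //; apply: balZ.
Qed.
Fact tscaleDl t : {morph tscale^~ t : a b / a + b}.
Proof.
move=> a b; apply: tensor_sep => V f bf.
rewrite tliftD // !tlift_tscale // /tlift /pair_sum -big_split /=.
by apply: eq_bigr => p _; case: bf => fDl _ _; rewrite scalerDl fDl.
Qed.

HB.instance Definition _ :=
  GRing.Zmodule_isLmodule.Build S tensor tscaleA tscale1 tscaleDr tscaleDl.

Lemma scale_tpure (k : S) x y : k *: tpure x y = tpure (k *: x) y.
Proof.
by apply: tensor_sep => V f bf; rewrite tlift_tscale // !tliftE //; apply: balZ.
Qed.

Lemma tensor_sum (t : tensor) : t = \sum_(p <- repr t) tpure p.1 p.2.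
Proof.
have tD (V : zmodType) (f : M -> N -> V) (s : seq (M * N)) : balanced f ->
    tlift f (\sum_(p <- s) tpure p.1 p.2) = pair_sum f s.
  move=> bf; elim: s => [|p s IHs]; rewrite /pair_sum ?big_nil ?tlift0 //.
  by rewrite !big_cons tliftD // IHs tliftE.
by apply: tensor_sep => V f bf; rewrite tD.
Qed.

Lemma tensor_ind (P : tensor -> Prop) :
  P 0 -> (forall t u, P t -> P u -> P (t + u)) -> (forall x y, P (tpure x y)) ->
  forall t, P t.
Proof. by move=> P0 PD Pp t; rewrite (tensor_sum t); apply: big_ind. Qed.

End Tensor.

Notation "x *t y" := (tpure x y) (at level 40, left associativity) : ring_scope.

Section LiftTheory.
Variables (S : comPzRingType) (M N : lmodType S) (V : zmodType).
Implicit Types f g : M -> N -> V.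

Lemma eq_tlift f g : f =2 g -> tlift f =1 tlift g.
Proof. by move=> fg t; apply: eq_bigr => p _; rewrite fg. Qed.

Lemma tlift_add f g t : tlift (fun x y => f x y + g x y) t = tlift f t + tlift g t.
Proof. exact: big_split. Qed.

Lemma additive_tensor_ext (F G : tensor M N -> V) :
  {morph F : x y / x + y} -> {morph G : x y / x + y} ->
  (forall x y, F (x *t y) = G (x *t y)) -> F =1 G.
Proof.
have add0 (H : tensor M N -> V) : {morph H : x y / x + y} -> H 0 = 0.
  by move=> HD; apply: (addIr (H 0)); rewrite -HD addr0 add0r.
move=> FD GD FG; apply: tensor_ind => [|t u Ft Fu|//]; first by rewrite !add0.
by rewrite FD GD Ft Fu.
Qed.

End LiftTheory.

Section TensorAlgebra.
Variables (S : comPzRingType) (A B : pzAlg S).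

Definition tmul (t u : tensor A B) : tensor A B :=
  tlift (fun (a : A) (b : B) => tlift (fun (a' : A) (b' : B) => (a * a') *t (b * b')) u) t.

Let bal_in (a : A) (b : B) : balanced (fun (a' : A) (b' : B) => (a * a') *t (b * b')).
Proof.
split=> [x x' y|x y y'|k x y]; rewrite ?mulrDr ?tpureDl ?tpureDr //.
by rewrite -palgAr -palgAr tpureZ.
Qed.

Let bal_out u :
  balanced (fun (a : A) (b : B) => tlift (fun (a' : A) (b' : B) => (a * a') *t (b * b')) u).
Proof.
split=> [x x' y|x y y'|k x y]; rewrite -?tlift_add; apply: eq_tlift => a' b'.
- by rewrite mulrDl tpureDl.
- by rewrite mulrDl tpureDr.
- by rewrite -!palgAl tpureZ.
Qed.

Lemma tmulE (a a' : A) (b b' : B) : tmul (a *t b) (a' *t b') = (a * a') *t (b * b').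
Proof. by rewrite /tmul !tliftE. Qed.

Lemma tmulDl : left_distributive tmul +%R.
Proof. by move=> t u v; rewrite /tmul tliftD. Qed.

Lemma tmulDr : right_distributive tmul +%R.
Proof.
move=> t u v; rewrite /tmul -tlift_add; apply: eq_tlift => a b.
by rewrite tliftD.
Qed.

Let tmulr0 t : tmul t 0 = 0.
Proof. by apply: (addIr (tmul t 0)); rewrite -tmulDr addr0 add0r. Qed.
Let tmul0r t : tmul 0 t = 0.
Proof. by apply: (addIr (tmul 0 t)); rewrite -tmulDl addr0 add0r. Qed.

Lemma tmulA : associative tmul.
Proof.
move=> t u v.
elim/tensor_ind: t => [|t t' IHt IHt'|a b]; rewrite ?tmul0r ?tmulDl ?IHt ?IHt' //.
elim/tensor_ind: u => [|u u' IHu IHu'|a' b'];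
  rewrite ?tmulr0 ?tmul0r ?tmulDl ?tmulDr ?tmulDl ?IHu ?IHu' //.
elim/tensor_ind: v => [|v v' IHv IHv'|a2 b2]; rewrite ?tmulr0 ?tmulDr ?IHv ?IHv' //.
by rewrite !tmulE !mulrA.
Qed.

Lemma tmul1 : left_id ((1 : A) *t (1 : B)) tmul.
Proof.
elim/tensor_ind => [|t t' IHt IHt'|a b]; rewrite ?tmulr0 ?tmulDr ?IHt ?IHt' //.
by rewrite tmulE !mul1r.
Qed.

Lemma tmulr1 : right_id ((1 : A) *t (1 : B)) tmul.
Proof.
elim/tensor_ind => [|t t' IHt IHt'|a b]; rewrite ?tmul0r ?tmulDl ?IHt ?IHt' //.
by rewrite tmulE !mulr1.
Qed.

HB.instance Definition _ := GRing.Zmodule_isPzRing.Build (tensor A B)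
  tmulA tmul1 tmulr1 tmulDl tmulDr.

Lemma mul_tpure (a a' : A) (b b' : B) :
  (a *t b) * (a' *t b') = (a * a') *t (b * b') :> tensor A B.
Proof. exact: tmulE. Qed.

Lemma tpure11 : (1 : A) *t (1 : B) = 1 :> tensor A B.
Proof. by []. Qed.

Lemma tensor_scaleAl k (t u : tensor A B) : k *: (t * u) = (k *: t) * u.
Proof.
elim/tensor_ind: t => [|t t' IHt IHt'|a b];
  rewrite ?mul0r ?scaler0 ?mul0r ?mulrDl ?scalerDr ?mulrDl ?IHt ?IHt' //.
elim/tensor_ind: u => [|u u' IHu IHu'|a' b'];
  rewrite ?mulr0 ?scaler0 ?mulrDr ?scalerDr ?IHu ?IHu' //.
by rewrite scale_tpure !mul_tpure scale_tpure palgAl.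
Qed.

Lemma tensor_scaleAr k (t u : tensor A B) : k *: (t * u) = t * (k *: u).
Proof.
elim/tensor_ind: t => [|t t' IHt IHt'|a b];
  rewrite ?mul0r ?scaler0 ?mul0r ?mulrDl ?scalerDr ?mulrDl ?IHt ?IHt' //.
elim/tensor_ind: u => [|u u' IHu IHu'|a' b'];
  rewrite ?scaler0 ?mulr0 ?scaler0 ?mulrDr ?scalerDr ?mulrDr ?IHu ?IHu' //.
by rewrite scale_tpure !mul_tpure scale_tpure palgAr.
Qed.

Definition tensor_alg : pzAlg S :=
  @PzAlg S (tensor A B) *:%R (@scalerA S (tensor A B)) (@scale1r S (tensor A B))
    (@scalerDr S (tensor A B)) (fun x a b => scalerDl x a b)
    tensor_scaleAl tensor_scaleAr.

End TensorAlgebra.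

Definition finitely_generated (S : comPzRingType) (M : lmodType S) : Prop :=
  exists (I : finType) (g : I -> M),
    forall x, exists c : I -> S, x = \sum_i c i *: g i.

Definition projective (S : comPzRingType) (P : lmodType S) : Prop :=
  forall (M N : lmodType S) (p : {linear M -> N}) (f : {linear P -> N}),
    (forall y, exists x, p x = y) ->
    exists g : {linear P -> M}, forall x, p (g x) = f x.

Definition faithful (S : comPzRingType) (M : lmodType S) : Prop :=
  forall k : S, (forall x : M, k *: x = 0) -> k = 0.

(* The canonical map from A (x) A^op to End_S(A), sending a (x) b to the
   endomorphism x |-> a x b; A^op and A have the same underlying module. *)
Definition sandwich (S : comPzRingType) (A : pzAlg S) (t : tensor A A) (x : A) : A :=
  tlift (fun a b : A => a * x * b) t.

(* A is a faithful finitely generated projective S-module and the canonical map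
   from A (x) A^op to End_S(A) is bijective. *)
Definition is_azumaya (S : comPzRingType) (A : pzAlg S) : Prop :=
  [/\ finitely_generated A, projective A, faithful A
    & forall phi : {linear A -> A},
        exists! t : tensor A A, forall x, sandwich t x = phi x].

Section SandwichTheory.
Variables (S : comPzRingType) (A : pzAlg S).
Implicit Types (t u : tensor A A) (a b x y : A).

Lemma sandwich_balanced x : balanced (fun a b : A => a * x * b).
Proof.
split=> [a a' b|a b b'|k a b]; rewrite ?mulrDl ?mulrDr //.
by rewrite -!palgAl -palgAr.
Qed.

Lemma sandwichE a b x : sandwich (a *t b) x = a * x * b.
Proof. by rewrite /sandwich tliftE //; apply: sandwich_balanced. Qed.

Lemma sandwichDl t u x : sandwich (t + u) x = sandwich t x + sandwich u x.
Proof. by rewrite /sandwich tliftD //; apply: sandwich_balanced. Qed.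

Lemma sandwich0l x : sandwich 0 x = 0.
Proof. by rewrite /sandwich tlift0 //; apply: sandwich_balanced. Qed.

Lemma sandwich_suml (I : finType) (F : I -> tensor A A) x :
  sandwich (\sum_i F i) x = \sum_i sandwich (F i) x.
Proof.
exact: (big_morph (fun t => sandwich t x) (fun t u => sandwichDl t u x)
  (sandwich0l x)).
Qed.

Lemma sandwichDr t x y : sandwich t (x + y) = sandwich t x + sandwich t y.
Proof.
rewrite /sandwich -tlift_add; apply: eq_tlift => a b.
by rewrite mulrDr mulrDl.
Qed.

Lemma sandwich_mull a t x : sandwich (a *t (1 : A) * t) x = a * sandwich t x.
Proof.
elim/tensor_ind: t => [|t u IHt IHu|b c]; rewrite ?mulr0 ?sandwich0l ?mulr0 //.
  by rewrite mulrDr !sandwichDl IHt IHu mulrDr.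
by rewrite mul_tpure !sandwichE mul1r !mulrA.
Qed.

End SandwichTheory.

Section Criterion.
Variable S : comPzRingType.

Definition lin_pack (M N : lmodType S) (f : M -> N) (h : linear f) : {linear M -> N} :=
  HB.pack f (GRing.isLinear.Build S M N *:%R f h).

(* For an algebra with a dual basis (a, f), bijectivity of [sandwich] amounts
   to the existence of preimages of the f i, subject to one identity; this form
   is easily transported along tensor products and base changes. *)
Definition azumaya_data (A : pzAlg S) : Prop :=
  exists (I : finType) (a : I -> A) (f : I -> A -> S)
         (u : I -> tensor A A) (c : I -> I -> S),
  [/\ forall i k x y, f i (k *: x + y) = k * f i x + f i y,
      forall x, x = \sum_i f i x *: a i,
      \sum_i \sum_j c i j * f j (a i) = 1,
      forall i x, sandwich (u i) x = f i x *: (1 : A)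
    & forall b, \sum_i (a i * b) *t (1 : A) * u i = (1 : A) *t b].

Lemma azumaya_data_suff A : azumaya_data A -> is_azumaya A.
Proof.
case=> I [a [f [u [c [flin dual trace ui uid]]]]]; split.
- by exists I, a => x; exists (f^~ x).
- move=> M N p g psurj.
  have [m mE] := choice (fun i => psurj (g (a i))).
  have hlin : linear (fun x => \sum_i f i x *: m i).
    move=> k x y; rewrite scaler_sumr -big_split; apply: eq_bigr => i _ /=.
    by rewrite flin scalerDl scalerA.
  exists (lin_pack hlin) => x /=; rewrite linear_sum {2}(dual x) linear_sum.
  by apply: eq_bigr => i _; rewrite !linearZ mE.
- move=> k kA0; rewrite -[k]mulr1 -trace mulr_sumr big1 // => i _.
  rewrite mulr_sumr big1 // => j _.
  have f0 : f j 0 = 0.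
    have := flin j 1 0 0; rewrite scaler0 addr0 mul1r => /(congr1 (+%R^~ (- f j 0))).
    by rewrite addrK subrr.
  by have := flin j k (a i) 0; rewrite kA0 !addr0 f0 addr0 mulrCA => <-; rewrite mulr0.
- move=> phi.
  have inv t : \sum_i (sandwich t (a i)) *t (1 : A) * u i = t.
    elim/tensor_ind: t => [|t t' IHt IHt'|x y].
    + rewrite big1 // => i _; rewrite sandwich0l.
      by rewrite -(scale0r (1 : A)) -scale_tpure scale0r mul0r.
    + rewrite -{2}IHt -{2}IHt' -big_split; apply: eq_bigr => i _ /=.
      by rewrite sandwichDl tpureDl mulrDl.
    + have xE i : sandwich (x *t y) (a i) *t (1 : A) * u i =
          x *t (1 : A) * ((a i * y) *t (1 : A) * u i).
        by rewrite sandwichE mulrA mul_tpure mulr1 mulrA.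
      under eq_bigr => i _ do rewrite xE.
      by rewrite -mulr_sumr uid mul_tpure mulr1 mul1r.
  exists (\sum_i phi (a i) *t (1 : A) * u i); split.
    move=> x; rewrite sandwich_suml {2}(dual x) linear_sum; apply: eq_bigr => i _.
    by rewrite sandwich_mull ui linearZ /= -palgAr mulr1.
  by move=> t tphi; rewrite -(inv t); apply: eq_bigr => i _; rewrite tphi.
Qed.

Lemma trace_ideal1 (A : pzAlg S) (I : finType) (a : I -> A) (f : I -> A -> S) :
    (forall x, x = \sum_i f i x *: a i) -> faithful A ->
  exists c : I -> I -> S, \sum_i \sum_j c i j * f j (a i) = 1.
Proof.
move=> dual fA.
pose P (x : S) := exists c : I -> I -> S, x = \sum_i \sum_j c i j * f j (a i).
have PD x y : P x -> P y -> P (x + y).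
  move=> [c ->] [d ->]; exists (fun i j => c i j + d i j).
  rewrite -big_split; apply: eq_bigr => i _; rewrite -big_split.
  by apply: eq_bigr => j _; rewrite mulrDl.
have PM k x : P x -> P (k * x).
  move=> [c ->]; exists (fun i j => k * c i j); rewrite mulr_sumr.
  by apply: eq_bigr => i _; rewrite mulr_sumr; apply: eq_bigr => j _; rewrite mulrA.
have P0 : P 0.
  by exists (fun _ _ => 0); rewrite big1 // => i _; rewrite big1 // => j _; rewrite mul0r.
have Pf i0 j0 : P (f j0 (a i0)).
  exists (fun i j => ((i == i0) && (j == j0))%:R).
  rewrite (bigD1 i0) //= (bigD1 j0) //= !eqxx mul1r !big1 ?addr0 //.
    by move=> i /negbTE ni; rewrite big1 // => j _; rewrite ni mul0r.
  by move=> j /negbTE ->; rewrite mul0r.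
pose n := #|I|.
pose X : 'M[S]_n := \matrix_(i, j) f (enum_val j) (a (enum_val i)).
have Xa (i : 'I_n) : \sum_(j < n) (1%:M - X) i j *: a (enum_val j) = 0.
  under eq_bigr => j _ do rewrite !mxE scalerBl.
  rewrite sumrB (bigD1 i) //= eqxx scale1r big1 ?addr0.
    apply/eqP; rewrite subr_eq0 {1}(dual (a (enum_val i))); apply/eqP.
    by rewrite (reindex (@enum_val I I)) //; apply: onW_bij; apply: enum_val_bij.
  by move=> j; rewrite eq_sym => /negbTE ->; rewrite scale0r.
have det0 : \det (1%:M - X) = 0.
  apply: fA => x; rewrite (dual x) scaler_sumr big1 // => i _.
  rewrite scalerA mulrC -scalerA.
  suff -> : \det (1%:M - X) *: a i = 0 by rewrite scaler0.
  rewrite -(enum_rankK i); set k := enum_rank i.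
  have -> : \det (1%:M - X) *: a (enum_val k) =
      \sum_(j < n) (\adj (1%:M - X) *m (1%:M - X)) k j *: a (enum_val j).
    rewrite mul_adj_mx (bigD1 k) //= mxE eqxx mulr1n big1 ?addr0 // => j.
    by rewrite eq_sym mxE => /negbTE ->; rewrite mulr0n scale0r.
  under eq_bigr => j _ do rewrite mxE scaler_suml.
  rewrite exchange_big big1 // => j _ /=.
  under eq_bigr => l _ do rewrite -scalerA.
  by rewrite -scaler_sumr Xa scaler0.
pose Q x y := P (x - y).
have QM x x' y y' : Q x x' -> Q y y' -> Q (x * y) (x' * y').
  move=> Qx Qy; rewrite /Q.
  have -> : x * y - x' * y' = y * (x - x') + x' * (y - y').
    by rewrite !mulrBr [y * x]mulrC [y * x']mulrC addrA subrK.
  by apply: PD; apply: PM.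
have QD x x' y y' : Q x x' -> Q y y' -> Q (x + y) (x' + y').
  by move=> Qx Qy; rewrite /Q opprD addrACA; apply: PD.
have Qxx x : Q x x by rewrite /Q subrr.
have : Q (\det (1%:M : 'M[S]_n)) (\det (1%:M - X)).
  apply: (big_ind2 Q); [exact: Qxx | exact: QD | move=> s _; apply: (QM) => //].
  apply: (big_ind2 Q); [exact: Qxx | exact: QM | move=> i _]; rewrite /Q !mxE opprB addrC subrK.
  exact: Pf.
by rewrite det1 det0 /Q subr0 => -[c cE]; exists c.
Qed.

Lemma azumaya_data_nec A : is_azumaya A -> azumaya_data A.
Proof.
case=> -[I [g gE]] projA fA bij.
have plin : linear (fun v : 'rV[S]_#|I| => \sum_i v 0 (enum_rank i) *: g i).
  move=> k v w; rewrite scaler_sumr -big_split; apply: eq_bigr => i _ /=.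
  by rewrite !mxE scalerDl scalerA.
have idlin : linear (fun x : A => x) by [].
have [|s sE] := projA _ _ (lin_pack plin) (lin_pack idlin).
  move=> x; have [c ->] := gE x; exists (\row_i c (enum_val i)) => /=.
  by apply: eq_bigr => i _; rewrite mxE enum_rankK.
pose f i x := s x 0 (enum_rank i).
have flin i k x y : f i (k *: x + y) = k * f i x + f i y.
  by rewrite /f linearP !mxE.
have dual x : x = \sum_i f i x *: g i by rewrite -[LHS](sE x).
have [c cE] := trace_ideal1 dual fA.
have philin i : linear (fun x : A => f i x *: (1 : A)).
  by move=> k x y; rewrite flin scalerDl scalerA.
have [u uE] := choice (fun i => bij (lin_pack (philin i))).
have {uE}/= uE i : forall x, sandwich (u i) x = f i x *: (1 : A) by have [] := uE i.
exists I, g, f, u, c; split => // b.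
have rlin : linear (fun x : A => x * b).
  by move=> k x y; rewrite mulrDl -palgAl.
have [t [_ tU]] := bij (lin_pack rlin).
rewrite -(tU (_ *t _)); last by move=> x; rewrite sandwichE mul1r.
apply/esym/tU => x; rewrite sandwich_suml [in RHS](dual x) /= mulr_suml.
by apply: eq_bigr => i _; rewrite sandwich_mull uE -palgAr mulr1 -palgAl.
Qed.

Lemma azumayaP A : is_azumaya A <-> azumaya_data A.
Proof. by split; [apply: azumaya_data_nec | apply: azumaya_data_suff]. Qed.

End Criterion.

Section AzumayaBase.
Variable S : comPzRingType.

Lemma base_azumaya : is_azumaya (base_alg S).
Proof.
apply/azumayaP; exists unit, (fun _ => 1), (fun _ x => x),
  (fun _ => (1 : base_alg S) *t (1 : base_alg S)), (fun _ _ => 1).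
have su (V : zmodType) (F : unit -> V) : \sum_i F i = F tt.
  by rewrite (bigD1 tt) //= big1 ?addr0 // => -[].
split=> [_ k x y||| _ x|b].
- by [].
- by move=> x; rewrite su; apply/esym; exact: (mulr1 (x : S)).
- by rewrite !su mulr1.
- rewrite sandwichE mul1r mulr1; apply/esym; exact: (mulr1 (x : S)).
- rewrite su tpure11 mulr1 mul1r.
  have bE : b = (b : S) *: (1 : base_alg S) by apply/esym; exact: (mulr1 (b : S)).
  by rewrite {1}bE tpureZ -bE.
Qed.

Lemma mx_azumaya n : (0 < n)%N -> is_azumaya (mx_alg S n).
Proof.
case: n => // n _; apply/azumayaP.
pose E (i j : 'I_n.+1) : mx_alg S n.+1 := delta_mx i j.
pose u (p : 'I_n.+1 * 'I_n.+1) : tensor (mx_alg S n.+1) (mx_alg S n.+1) :=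
  \sum_k E k p.1 *t E p.2 k.
exists ('I_n.+1 * 'I_n.+1)%type, (fun p => E p.1 p.2),
  (fun p (X : 'M[S]_n.+1) => X p.1 p.2), u,
  (fun p q => ((p == (0, 0)) && (q == (0, 0)))%:R).
have delta0 (i j k l : 'I_n.+1) (X : 'M[S]_n.+1) :
    delta_mx i j *m X *m delta_mx k l = X j k *: delta_mx i l.
  apply/matrixP => x y; rewrite !mxE (bigD1 k) //= big1 => [|m /negbTE nm].
    rewrite !mxE (bigD1 j) //= big1 => [|m /negbTE nm]; rewrite !mxE ?nm ?andbF ?mul0r //.
    rewrite !eqxx !andbT !addr0 /=; case: (x == i); rewrite ?mul0r ?mulr0 //.
    by case: (y == l); rewrite ?mul1r ?mulr1 ?mulr0.
  by rewrite !mxE nm mulr0.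
have sum_delta : \sum_k delta_mx k k = 1%:M :> 'M[S]_n.+1.
  by rewrite mx1_sum_delta.
split=> [[i j] k X Y|X||[i j] X|b] /=.
- by rewrite [LHS]mxE [X in X + _ = _]mxE.
- rewrite -(pair_bigA _ (fun i j => (X : 'M[S]_n.+1) i j *: E i j)).
  exact: matrix_sum_delta.
- rewrite (bigD1 (0, 0)) //= [X in _ + X]big1 ?addr0 => [|p /negbTE np].
    rewrite (bigD1 (0, 0)) //= big1 ?addr0 => [|p /negbTE np].
      by rewrite !mxE !eqxx mulr1.
    by rewrite np mul0r.
  by rewrite big1 // => q _; rewrite np mul0r.
- rewrite sandwich_suml; under eq_bigr => k _ do rewrite sandwichE.
  transitivity (\sum_k X i j *: delta_mx k k : 'M[S]_n.+1).
    by apply: eq_bigr => k _; apply: delta0.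
  by rewrite -scaler_sumr sum_delta.
- transitivity (\sum_p \sum_k ((b : 'M[S]_n.+1) p.2 k *: E p.1 p.1) *t E p.2 k).
    apply: eq_bigr => -[i j] _ /=; rewrite mulr_sumr; apply: eq_bigr => k _.
    by rewrite mul_tpure mul1r; congr (_ *t _); apply: delta0.
  rewrite -(pair_bigA _ (fun i j => \sum_k ((b : 'M[S]_n.+1) j k *: E i i) *t E j k)) /=.
  have tsuml (I : finType) (F : I -> mx_alg S n.+1) (y : mx_alg S n.+1) :
      (\sum_i F i) *t y = \sum_i F i *t y.
    apply: (big_morph (fun x => x *t y)) => [x x'|]; first exact: tpureDl.
    by rewrite -(scale0r (0 : mx_alg S n.+1)) -scale_tpure scale0r.
  have tsumr (I : finType) (F : I -> mx_alg S n.+1) (x : mx_alg S n.+1) :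
      x *t (\sum_i F i) = \sum_i x *t F i.
    apply: (big_morph (fun y => x *t y)) => [y y'|]; first exact: tpureDr.
    by rewrite -(scale0r (0 : mx_alg S n.+1)) -tpureZ -scale_tpure scale0r.
  have -> : (1 : mx_alg S n.+1) = \sum_i E i i by apply/esym; exact: sum_delta.
  rewrite tsuml; apply: eq_bigr => i _.
  have bE : b = \sum_j \sum_k (b : 'M[S]_n.+1) j k *: E j k by apply: matrix_sum_delta.
  rewrite {2}bE tsumr; apply: eq_bigr => j _; rewrite tsumr; apply: eq_bigr => k _.
  by rewrite tpureZ.
Qed.

End AzumayaBase.

Section AzumayaTensor.
Variables (S : comPzRingType) (A B : pzAlg S).
Notation AB := (tensor_alg A B).

Definition tshuffle (t : tensor A A) (t' : tensor B B) : tensor AB AB :=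
  tlift (fun a a' : A => tlift (fun b b' : B => (a *t b : AB) *t (a' *t b' : AB)) t') t.

Let ABZ (k : S) (x : A) (y : B) : (k *: x) *t y = k *: (x *t y : AB) :> AB.
Proof. by apply/esym; exact: scale_tpure. Qed.

Let ABDl (x x' : A) (y : B) : (x + x') *t y = (x *t y : AB) + (x' *t y : AB) :> AB.
Proof. exact: tpureDl. Qed.
Let ABDr (x : A) (y y' : B) : x *t (y + y') = (x *t y : AB) + (x *t y' : AB) :> AB.
Proof. exact: tpureDr. Qed.
Let ABM (x x' : A) (y y' : B) :
  (x *t y : AB) * (x' *t y' : AB) = (x * x') *t (y * y') :> AB.
Proof. exact: mul_tpure. Qed.

Let bal_in (a a' : A) :
  balanced (fun b b' : B => (a *t b : AB) *t (a' *t b' : AB)).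
Proof.
split=> [x x' y|x y y'|k x y].
- by rewrite ABDr tpureDl.
- by rewrite ABDr tpureDr.
- by rewrite -tpureZ ABZ tpureZ -ABZ tpureZ.
Qed.

Let bal_out t' : balanced (fun a a' : A =>
  tlift (fun b b' : B => (a *t b : AB) *t (a' *t b' : AB)) t').
Proof.
split=> [x x' y|x y y'|k x y]; rewrite -?tlift_add; apply: eq_tlift => b b'.
- by rewrite ABDl tpureDl.
- by rewrite ABDl tpureDr.
- by rewrite !ABZ tpureZ.
Qed.

Lemma tshuffleE (a a' : A) (b b' : B) :
  tshuffle (a *t a') (b *t b') = (a *t b : AB) *t (a' *t b' : AB).
Proof. by rewrite /tshuffle !tliftE. Qed.

Lemma tshuffleDl t u t' : tshuffle (t + u) t' = tshuffle t t' + tshuffle u t'.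
Proof. by rewrite /tshuffle tliftD. Qed.

Lemma tshuffleDr t t' u' : tshuffle t (t' + u') = tshuffle t t' + tshuffle t u'.
Proof. by rewrite /tshuffle -tlift_add; apply: eq_tlift => a a'; rewrite tliftD. Qed.

Lemma tshuffle0l t' : tshuffle 0 t' = 0.
Proof. by apply: (addIr (tshuffle 0 t')); rewrite -tshuffleDl addr0 add0r. Qed.
Lemma tshuffle0r t : tshuffle t 0 = 0.
Proof. by apply: (addIr (tshuffle t 0)); rewrite -tshuffleDr addr0 add0r. Qed.

Lemma tensor_azumaya : is_azumaya A -> is_azumaya B -> is_azumaya AB.
Proof.
move=> /azumayaP[I [a [f [u [c [flin fdual fc fu fid]]]]]].
move=> /azumayaP[J [b [g [v [d [glin gdual gd gv gid]]]]]].
apply/azumayaP.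
have linD (T : lmodType S) (h : T -> S) :
    (forall k x y, h (k *: x + y) = k * h x + h y) ->
    (forall x y, h (x + y) = h x + h y) /\ (forall k x, h (k *: x) = k * h x).
  move=> hlin; have hD x y : h (x + y) = h x + h y.
    by rewrite -[x]scale1r hlin mul1r scale1r.
  have h0 : h 0 = 0 by apply: (addIr (h 0)); rewrite -hD addr0 add0r.
  by split=> // k x; rewrite -[_ *: _]addr0 hlin h0 addr0.
have fD i := (linD _ _ (flin i)).1; have fZ i := (linD _ _ (flin i)).2.
have gD i := (linD _ _ (glin i)).1; have gZ i := (linD _ _ (glin i)).2.
have bal i j : balanced (fun (x : A) (y : B) => f i x * g j y).
  split=> [x x' y|x y y'|k x y]; rewrite ?fD ?gD ?mulrDl ?mulrDr //.
  by rewrite fZ gZ mulrCA mulrA.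
pose h (p : I * J) (t : AB) : S := tlift (fun (x : A) (y : B) => f p.1 x * g p.2 y) t.
have hD p t t' : h p (t + t') = h p t + h p t' by apply: tliftD.
have h0 p : h p 0 = 0 by apply: (addIr (h p 0)); rewrite -hD addr0 add0r.
have hE i j x y : h (i, j) (x *t y) = f i x * g j y by apply: tliftE.
have hZ p k t : h p (k *: t) = k * h p t.
  case: p => i j; elim/tensor_ind: t => [|t t' IHt IHt'|x y].
  - by rewrite scaler0 h0 mulr0.
  - by rewrite scalerDr !hD IHt IHt' mulrDr.
  - by rewrite -ABZ !hE fZ mulrA.
have tsuml (K : finType) (F : K -> A) (y : B) : (\sum_i F i) *t y = \sum_i F i *t y :> AB.
  apply: (big_morph (fun x => x *t y : AB)) => [x x'|]; first exact: tpureDl.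
  by rewrite -(scale0r (0 : A)) ABZ scale0r.
have tsumr (K : finType) (F : K -> B) (x : A) : x *t (\sum_i F i) = \sum_i x *t F i :> AB.
  apply: (big_morph (fun y => x *t y : AB)) => [y y'|]; first exact: tpureDr.
  by rewrite -(scale0r (0 : B)) -tpureZ ABZ scale0r.
exists (I * J)%type, (fun p => a p.1 *t b p.2), h, (fun p => tshuffle (u p.1) (v p.2)),
  (fun p q => c p.1 q.1 * d p.2 q.2).
split.
- by move=> p k x y; rewrite hD hZ.
- elim/tensor_ind => [|t t' IHt IHt'|x y].
  + by rewrite big1 // => p _; rewrite h0 scale0r.
  + rewrite {1}IHt {1}IHt' -big_split; apply: eq_bigr => p _ /=.
    by rewrite hD scalerDl.
  + rewrite {1}(fdual x) {1}(gdual y) tsuml.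
    rewrite -(pair_bigA _ (fun i j => h (i, j) (x *t y) *: (a i *t b j : AB))) /=.
    apply: eq_bigr => i _; rewrite tsumr; apply: eq_bigr => j _.
    by rewrite hE -tpureZ ABZ ABZ scalerA mulrC.
- rewrite -(pair_bigA _ (fun i j => \sum_q c i q.1 * d j q.2 * h q (a i *t b j))) /=.
  have E i j : \sum_q c i q.1 * d j q.2 * h q (a i *t b j) =
      (\sum_k c i k * f k (a i)) * (\sum_l d j l * g l (b j)).
    rewrite mulr_suml.
    rewrite -(pair_bigA _ (fun k l => c i k * d j l * h (k, l) (a i *t b j))) /=.
    apply: eq_bigr => k _; rewrite mulr_sumr; apply: eq_bigr => l _.
    by rewrite hE mulrACA.
  under eq_bigr => i _.
    under eq_bigr => j _ do rewrite E.
    rewrite -mulr_sumr gd mulr1; over.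
  exact: fc.
- move=> [i j] /= x.
  have sand t t' (y : A) (z : B) :
      sandwich (tshuffle t t') (y *t z) = sandwich t y *t sandwich t' z.
    have z1 (w : B) : (0 : A) *t w = 0 :> AB by rewrite -(scale0r (0 : A)) ABZ scale0r.
    have z2 (w : A) : w *t (0 : B) = 0 :> AB.
      by rewrite -(scale0r (0 : B)) -tpureZ ABZ scale0r.
    elim/tensor_ind: t => [|t1 t2 IH1 IH2|p q].
    + by rewrite tshuffle0l !sandwich0l z1.
    + by rewrite tshuffleDl !sandwichDl IH1 IH2 tpureDl.
    elim/tensor_ind: t' => [|t1 t2 IH1 IH2|p' q'].
    + by rewrite tshuffle0r !sandwich0l z2.
    + by rewrite tshuffleDr !sandwichDl IH1 IH2 tpureDr.
    + by rewrite tshuffleE !sandwichE !ABM.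
  elim/tensor_ind: x => [|x x' IHx IHx'|x y].
  + rewrite h0 scale0r; set s := tshuffle _ _.
    by apply: (addIr (sandwich s 0)); rewrite -sandwichDr addr0 add0r.
  + by rewrite sandwichDr IHx IHx' hD scalerDl.
  + rewrite sand fu gv hE ABZ -tpureZ ABZ scalerA; congr (_ *: _).
- have mulsh (p p' : A) (q q' : B) t t' :
      ((p *t q : AB) *t (p' *t q' : AB)) * tshuffle t t' =
      tshuffle ((p *t p') * t) ((q *t q') * t').
    elim/tensor_ind: t => [|t1 t2 IH1 IH2|r s].
    + by rewrite tshuffle0l !mulr0 tshuffle0l.
    + by rewrite tshuffleDl !mulrDr IH1 IH2 tshuffleDl.
    elim/tensor_ind: t' => [|t1 t2 IH1 IH2|r' s'].
    + by rewrite tshuffle0r !mulr0 tshuffle0r.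
    + by rewrite tshuffleDr !mulrDr IH1 IH2 tshuffleDr.
    + by rewrite tshuffleE !mul_tpure tshuffleE; congr (_ *t _); apply: mul_tpure.
  have shsuml (K : finType) (F : K -> tensor A A) t' :
      tshuffle (\sum_i F i) t' = \sum_i tshuffle (F i) t'.
    exact: (big_morph (tshuffle^~ t') (fun x y => tshuffleDl x y t') (tshuffle0l t')).
  have shsumr (K : finType) (F : K -> tensor B B) t :
      tshuffle t (\sum_i F i) = \sum_i tshuffle t (F i).
    exact: (big_morph (tshuffle t) (tshuffleDr t) (tshuffle0r t)).
  elim/tensor_ind => [|t t' IHt IHt'|x y].
  + under eq_bigr => p _.
      rewrite mulr0 -(scale0r (0 : AB)) -scale_tpure scale0r mul0r; over.
    by rewrite big1 // -(scale0r (0 : AB)) -tpureZ -scale_tpure scale0r.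
  + rewrite tpureDr -IHt -IHt' -big_split; apply: eq_bigr => p _ /=.
    by rewrite mulrDr tpureDl mulrDl.
  + rewrite -(pair_bigA _ (fun i j =>
      ((a i *t b j : AB) * (x *t y)) *t (1 : AB) * tshuffle (u i) (v j))) /=.
    rewrite -tpure11 -tshuffleE -fid -gid shsuml; apply: eq_bigr => i _.
    by rewrite shsumr; apply: eq_bigr => j _; rewrite -mulsh ABM.
Qed.

End AzumayaTensor.

Section BaseChange.
Variables (S R : comPzRingType) (phi : {rmorphism S -> R}).

Definition restr_alg : pzAlg S.
Proof.
refine (@PzAlg S R (fun k x => phi k * x) _ _ _ _ _ _).
- by move=> a b x; rewrite rmorphM mulrA.
- by move=> x; rewrite rmorph1 mul1r.
- by move=> k x y; rewrite mulrDr.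
- by move=> x a b; rewrite rmorphD mulrDl.
- by move=> k x y; rewrite mulrA.
- by move=> k x y; rewrite mulrCA.
Defined.

Variable A : pzAlg S.

(* R (x)_S A, with R acting on the left factor. *)
Definition bc_scale (r : R) (t : tensor restr_alg A) : tensor restr_alg A :=
  ((r : restr_alg) *t (1 : A)) * t.

Fact bc_scaleA a b t : bc_scale a (bc_scale b t) = bc_scale (a * b) t.
Proof. by rewrite /bc_scale mulrA mul_tpure mulr1. Qed.
Fact bc_scale1 : left_id 1 bc_scale.
Proof. by move=> t; rewrite /bc_scale tpure11 mul1r. Qed.
Fact bc_scaleDr : right_distributive bc_scale +%R.
Proof. by move=> k t u; rewrite /bc_scale mulrDr. Qed.
Fact bc_scaleDl t : {morph bc_scale^~ t : a b / a + b}.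
Proof. by move=> a b; rewrite /bc_scale -mulrDl -tpureDl. Qed.
Fact bc_scaleAl k t u : bc_scale k (t * u) = bc_scale k t * u.
Proof. by rewrite /bc_scale mulrA. Qed.
Fact bc_scaleAr k t u : bc_scale k (t * u) = t * bc_scale k u.
Proof.
rewrite /bc_scale !mulrA; congr (_ * _).
elim/tensor_ind: t => [|t t' IHt IHt'|x y]; rewrite ?mulr0 ?mul0r //.
  by rewrite mulrDr mulrDl IHt IHt'.
rewrite !mul_tpure mul1r mulr1; congr (_ *t _).
exact: (mulrC (k : R)).
Qed.

Definition bc_alg : pzAlg R := @PzAlg R (tensor restr_alg A) bc_scale
  bc_scaleA bc_scale1 bc_scaleDr bc_scaleDl bc_scaleAl bc_scaleAr.

End BaseChange.

Section BaseChangeAzumaya.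
Variables (S R : comPzRingType) (phi : {rmorphism S -> R}) (A : pzAlg S).
Notation RA := (bc_alg phi A).
Notation R' := (restr_alg phi).

Definition bc_pure (r : R) (x : A) : RA := (r : R') *t x.

Lemma bc_pureDl r r' x : bc_pure (r + r') x = bc_pure r x + bc_pure r' x.
Proof. exact: tpureDl. Qed.
Lemma bc_pureDr r x x' : bc_pure r (x + x') = bc_pure r x + bc_pure r x'.
Proof. exact: tpureDr. Qed.
Lemma bc_pureZ k r x : bc_pure r (k *: x) = bc_pure (phi k * r) x.
Proof. by apply/esym; exact: (@tpureZ _ R' A k r x). Qed.
Lemma scale_bc_pure (k r : R) x : k *: bc_pure r x = bc_pure (k * r) x.
Proof.
rewrite -[in RHS](mul1r x).
exact: (@mul_tpure _ R' A (k : R') (r : R') (1 : A) x).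
Qed.
Lemma mul_bc_pure r r' x x' : bc_pure r x * bc_pure r' x' = bc_pure (r * r') (x * x').
Proof. exact: (@mul_tpure _ R' A). Qed.
Lemma bc_pure11 : bc_pure 1 1 = 1. Proof. by []. Qed.

Lemma bc_ind (P : RA -> Prop) :
  P 0 -> (forall t u, P t -> P u -> P (t + u)) -> (forall r x, P (bc_pure r x)) ->
  forall t, P t.
Proof. exact: (@tensor_ind _ R' A). Qed.

Definition bc_ext (t : tensor A A) : tensor RA RA :=
  tlift (fun a b : A => bc_pure 1 a *t bc_pure 1 b) t.

Let bal_ext : balanced (fun a b : A => bc_pure 1 a *t bc_pure 1 b).
Proof.
split=> [x x' y|x y y'|k x y].
- by rewrite bc_pureDr tpureDl.
- by rewrite bc_pureDr tpureDr.
- by rewrite !bc_pureZ -!scale_bc_pure tpureZ.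
Qed.

Let extE (a b : A) : bc_ext (a *t b) = bc_pure 1 a *t bc_pure 1 b.
Proof. exact: tliftE. Qed.
Let extD : {morph bc_ext : t u / t + u}.
Proof. by move=> t u; apply: tliftD. Qed.
Let ext0 : bc_ext 0 = 0.
Proof. exact: tlift0. Qed.

Lemma bc_azumaya : is_azumaya A -> is_azumaya RA.
Proof.
move=> /azumayaP[I [a [f [u [c [flin dual fc fu fid]]]]]]; apply/azumayaP.
have fD i x y : f i (x + y) = f i x + f i y.
  by rewrite -[x]scale1r flin mul1r scale1r.
have f0 i : f i 0 = 0 by apply: (addIr (f i 0)); rewrite -fD addr0 add0r.
have fZ i k x : f i (k *: x) = k * f i x by rewrite -[_ *: _]addr0 flin f0 addr0.
pose h i (t : RA) : R := tlift (fun (r : R') (x : A) => (r : R) * phi (f i x)) t.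
have bal i : balanced (fun (r : R') (x : A) => (r : R) * phi (f i x)).
  split=> [r r' x|r x x'|k r x].
  - exact: mulrDl.
  - by rewrite fD rmorphD mulrDr.
  - by rewrite fZ rmorphM mulrCA mulrA.
have hD i t t' : h i (t + t') = h i t + h i t' by apply: tliftD.
have h0 i : h i 0 = 0 by apply: (addIr (h i 0)); rewrite -hD addr0 add0r.
have hE i r x : h i (bc_pure r x) = r * phi (f i x) by apply: tliftE.
have hZ i (k : R) t : h i (k *: t) = k * h i t.
  elim/bc_ind: t => [|t t' IHt IHt'|r x].
  - by rewrite scaler0 h0 mulr0.
  - by rewrite scalerDr !hD IHt IHt' mulrDr.
  - by rewrite scale_bc_pure !hE mulrA.
have psumr r (F : I -> A) : bc_pure r (\sum_i F i) = \sum_i bc_pure r (F i).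
  apply: (big_morph (bc_pure r) (bc_pureDr r)).
  by apply: (addIr (bc_pure r 0)); rewrite -bc_pureDr addr0 add0r.
exists I, (fun i => bc_pure 1 (a i)), h, (fun i => bc_ext (u i)),
  (fun i j => phi (c i j)); split.
- by move=> i k x y; rewrite hD hZ.
- elim/bc_ind => [|t t' IHt IHt'|r x].
  + by rewrite big1 // => p _; rewrite h0 scale0r.
  + rewrite {1}IHt {1}IHt' -big_split; apply: eq_bigr => p _ /=.
    by rewrite hD scalerDl.
  + rewrite {1}(dual x) psumr; apply: eq_bigr => i _.
    by rewrite hE scale_bc_pure bc_pureZ mulr1 mulrC.
- rewrite -[RHS](rmorph1 phi) -fc rmorph_sum; apply: eq_bigr => i _.
  rewrite rmorph_sum; apply: eq_bigr => j _.
  by rewrite hE mul1r rmorphM.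
- move=> i x; elim/bc_ind: x => [|x x' IHx IHx'|r x].
  + rewrite h0 scale0r; set s := bc_ext _.
    by apply: (addIr (sandwich s 0)); rewrite -sandwichDr addr0 add0r.
  + by rewrite sandwichDr IHx IHx' hD scalerDl.
  + have sand t : sandwich (bc_ext t) (bc_pure r x) = bc_pure r (sandwich t x).
      elim/tensor_ind: t => [|t t' IHt IHt'|y z].
      * rewrite ext0 !sandwich0l.
        by apply: (addIr (bc_pure r 0)); rewrite -bc_pureDr add0r addr0.
      * by rewrite extD !sandwichDl bc_pureDr IHt IHt'.
      * by rewrite extE !sandwichE !mul_bc_pure mul1r mulr1.
    by rewrite sand fu hE bc_pureZ -bc_pure11 scale_bc_pure mulr1 mulrC.
- have mulext (y z : A) t :
      bc_pure 1 y *t bc_pure 1 z * bc_ext t = bc_ext (y *t z * t).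
    elim/tensor_ind: t => [|t t' IHt IHt'|y' z'].
    + by rewrite ext0 !mulr0 ext0.
    + by rewrite extD !mulrDr IHt IHt' extD.
    + by rewrite extE mul_tpure !mul_bc_pure mul_tpure extE !mulr1.
  have esum (F : I -> tensor A A) : bc_ext (\sum_i F i) = \sum_i bc_ext (F i).
    exact: (big_morph bc_ext extD ext0).
  elim/bc_ind => [|t t' IHt IHt'|r x].
  + under eq_bigr => p _.
      rewrite mulr0 -(scale0r (0 : RA)) -scale_tpure scale0r mul0r; over.
    by rewrite big1 // -(scale0r (0 : RA)) -tpureZ -scale_tpure scale0r.
  + rewrite tpureDr -IHt -IHt' -big_split; apply: eq_bigr => p _ /=.
    by rewrite mulrDr tpureDl mulrDl.
  + transitivity (r *: bc_ext ((1 : A) *t x)).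
      rewrite -fid esum scaler_sumr; apply: eq_bigr => i _.
      rewrite -mulext tensor_scaleAl scale_tpure scale_bc_pure mul_bc_pure.
      by rewrite mul1r mulr1 bc_pure11.
    by rewrite extE scale_tpure tpureZ scale_bc_pure mulr1 bc_pure11.
Qed.

End BaseChangeAzumaya.

Record derivation (A : pzRingType) := Derivation {
  der_fun :> A -> A;
  derD : {morph der_fun : x y / x + y};
  derM : forall x y, der_fun (x * y) = der_fun x * y + x * der_fun y
}.

Section DerivationTheory.
Variables (A : pzRingType) (d : derivation A).

Lemma der0 : d 0 = 0.
Proof. by apply: (addIr (d 0)); rewrite -derD addr0 add0r. Qed.
Lemma der1 : d 1 = 0.
Proof. by apply: (addIr (d 1)); rewrite -{3}[1]mulr1 derM mulr1 mul1r add0r. Qed.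
Lemma derN x : d (- x) = - d x.
Proof. by apply: (addIr (d x)); rewrite -derD !addNr der0. Qed.
Lemma derB x y : d (x - y) = d x - d y.
Proof. by rewrite derD derN. Qed.
Lemma der_sum (I : Type) (r : seq I) (F : I -> A) :
  d (\sum_(i <- r) F i) = \sum_(i <- r) d (F i).
Proof. exact: (big_morph d (@derD _ d) der0). Qed.

End DerivationTheory.

Section Constants.
Variables (R : comPzRingType) (D : derivation R).

Definition const_pred : {pred R} := [pred r | D r == 0].

Fact const_subring_closed : subring_closed const_pred.
Proof.
split=> [|x y|x y]; rewrite !inE ?der1 // => /eqP Dx /eqP Dy.
- by rewrite derB Dx Dy subr0.
- by rewrite derM Dx Dy mul0r mulr0 addr0.
Qed.

Record constants := Constant { const_val :> R; _ : const_val \in const_pred }.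

HB.instance Definition _ := [isSub for const_val].
HB.instance Definition _ := [Choice of constants by <:].
HB.instance Definition _ := GRing.SubChoice_isSubComPzRing.Build R const_pred constants
  const_subring_closed.

Definition const_incl : {rmorphism constants -> R} := (\val : constants -> R).

Lemma der_const (c : constants) : D (const_incl c) = 0.
Proof. by case: c => c cP; apply/eqP. Qed.

End Constants.

Record diffAlg (R : comPzRingType) (D : derivation R) := DiffAlg {
  dalg :> pzAlg R;
  dder : derivation dalg;
  dder_ext : forall r : R, dder (r *: (1 : dalg)) = D r *: (1 : dalg)
}.

Section DiffAlgTheory.
Variables (R : comPzRingType) (D : derivation R).

Lemma dderZ (A : diffAlg D) (k : R) (x : A) :
  dder A (k *: x) = D k *: x + k *: dder A x.
Proof.
rewrite -{1}[x]mul1r palgAl derM dder_ext -palgAl mul1r; congr (_ + _).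
by rewrite -palgAl mul1r.
Qed.

Fact base_dder_ext (r : R) :
  (D : derivation (base_alg R)) (r *: (1 : base_alg R)) = D r *: (1 : base_alg R).
Proof. by rewrite /= [r *: _](mulr1 (r : R)); apply/esym; exact: (mulr1 (D r)). Qed.

Definition base_diff : diffAlg D := @DiffAlg R D (base_alg R) D base_dder_ext.

Section Matrix.
Variable n : nat.

Fact mx_derD : {morph (map_mx D : mx_alg R n -> mx_alg R n) : x y / x + y}.
Proof.
move=> x y; apply/matrixP => i j.
by rewrite [LHS]mxE [X in D X]mxE derD [RHS]mxE !mxE.
Qed.

Fact mx_derM (x y : mx_alg R n) :
  (map_mx D (x * y : 'M[R]_n) : mx_alg R n) =
  (map_mx D x : mx_alg R n) * y + x * (map_mx D y : mx_alg R n).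
Proof.
apply/matrixP => i j; rewrite [LHS]mxE [X in D X]mxE der_sum.
rewrite [RHS]mxE [X in _ = X + _]mxE [X in _ = _ + X]mxE -big_split.
by apply: eq_bigr => k _; rewrite derM !mxE.
Qed.

Definition mx_der : derivation (mx_alg R n) := Derivation mx_derD mx_derM.

Fact mx_dder_ext (r : R) : mx_der (r *: (1 : mx_alg R n)) = D r *: (1 : mx_alg R n).
Proof.
apply/matrixP => i j; rewrite [LHS]mxE [X in D X]mxE [RHS]mxE.
rewrite [X in D (_ * X)]mxE [X in _ = _ * X]mxE.
by case: (i == j); rewrite ?mulr1 ?mulr0 ?der0.
Qed.

Definition mx_diff : diffAlg D := DiffAlg mx_dder_ext.

End Matrix.

Section Tensor.
Variables A B : diffAlg D.
Notation AB := (tensor_alg A B).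

Definition tensor_der_fun (t : AB) : AB :=
  tlift (fun (a : A) (b : B) => dder A a *t b + a *t dder B b) t.

Let bal : balanced (fun (a : A) (b : B) => dder A a *t b + a *t dder B b).
Proof.
split=> [x x' y|x y y'|k x y].
- by rewrite derD !tpureDl addrACA.
- by rewrite derD !tpureDr addrACA.
- by rewrite !dderZ tpureDl tpureDr !tpureZ -addrA addrCA.
Qed.

Fact tensor_derE (a : A) (b : B) :
  tensor_der_fun (a *t b) = dder A a *t b + a *t dder B b.
Proof. exact: tliftE. Qed.

Fact tensor_derD : {morph tensor_der_fun : t u / t + u}.
Proof. by move=> t u; apply: tliftD. Qed.

Fact tensor_derM (t u : AB) :
  tensor_der_fun (t * u) = tensor_der_fun t * u + t * tensor_der_fun u.
Proof.
have d0 : tensor_der_fun 0 = 0 by apply: tlift0.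
elim/tensor_ind: t => [|t t' IHt IHt'|a b].
- by rewrite d0 !mul0r d0 addr0.
- by rewrite mulrDl !tensor_derD IHt IHt' !mulrDl addrACA.
elim/tensor_ind: u => [|u u' IHu IHu'|a' b'].
- by rewrite d0 !mulr0 d0 addr0.
- by rewrite mulrDr !tensor_derD IHu IHu' !mulrDr addrACA.
rewrite [X in tensor_der_fun X]mul_tpure !tensor_derE !derM.
rewrite [X in _ = X + _]mulrDl [X in _ = _ + X]mulrDr.
rewrite [X in _ = (X + _) + _]mul_tpure [X in _ = (_ + X) + _]mul_tpure.
rewrite [X in _ = _ + (X + _)]mul_tpure [X in _ = _ + (_ + X)]mul_tpure.
by rewrite tpureDl tpureDr addrACA.
Qed.

Definition tensor_der : derivation AB := Derivation tensor_derD tensor_derM.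

Fact tensor_dder_ext (r : R) : tensor_der (r *: (1 : AB)) = D r *: (1 : AB).
Proof.
transitivity (tensor_der ((r *: (1 : A)) *t (1 : B))).
  by congr (tensor_der _); exact: (scale_tpure r (1 : A) (1 : B)).
rewrite [LHS]tensor_derE dder_ext der1.
transitivity ((D r *: (1 : A)) *t (1 : B)); last first.
  by apply/esym; exact: (scale_tpure (D r) (1 : A) (1 : B)).
rewrite -[RHS]addr0; congr (_ + _).
by rewrite -(scale0r (0 : B)) -tpureZ -scale_tpure scale0r.
Qed.

Definition tensor_diff : diffAlg D := DiffAlg tensor_dder_ext.

End Tensor.

Section BaseChange.
Variable A : pzAlg (constants D).
Notation R' := (restr_alg (const_incl D)).
Notation RA := (bc_alg (const_incl D) A).

Definition bc_der_fun (t : RA) : RA := tlift (fun (r : R') (x : A) => (D r : R') *t x) t.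

Let bal : balanced (fun (r : R') (x : A) => (D r : R') *t x).
Proof.
split=> [r r' x|r x x'|k r x].
- by rewrite -tpureDl; congr (_ *t _); exact: derD.
- exact: tpureDr.
- rewrite -tpureZ; congr (_ *t _).
  transitivity (D (const_incl D k * (r : R))) => //.
  by rewrite derM der_const mul0r add0r.
Qed.

Fact bc_derE (r : R) (x : A) : bc_der_fun (bc_pure _ r x) = bc_pure _ (D r) x.
Proof. exact: tliftE. Qed.

Fact bc_derD : {morph bc_der_fun : t u / t + u}.
Proof. by move=> t u; apply: tliftD. Qed.

Fact bc_derM (t u : RA) : bc_der_fun (t * u) = bc_der_fun t * u + t * bc_der_fun u.
Proof.
have d0 : bc_der_fun 0 = 0 by apply: tlift0.
elim/bc_ind: t => [|t t' IHt IHt'|a b].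
- by rewrite d0 !mul0r d0 addr0.
- by rewrite mulrDl !bc_derD IHt IHt' !mulrDl addrACA.
elim/bc_ind: u => [|u u' IHu IHu'|a' b'].
- by rewrite d0 !mulr0 d0 addr0.
- by rewrite mulrDr !bc_derD IHu IHu' !mulrDr addrACA.
by rewrite mul_bc_pure !bc_derE !mul_bc_pure derM bc_pureDl.
Qed.

Definition bc_der : derivation RA := Derivation bc_derD bc_derM.

Fact bc_dder_ext (r : R) : bc_der (r *: (1 : RA)) = D r *: (1 : RA).
Proof. by rewrite -bc_pure11 !scale_bc_pure !mulr1 [LHS]bc_derE. Qed.

Definition bc_diff : diffAlg D := DiffAlg bc_dder_ext.

End BaseChange.

End DiffAlgTheory.

Definition alg_hom (S : comPzRingType) (A B : pzAlg S) (f : A -> B) : Prop :=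
  linear f /\ monoid_morphism f.

Definition alg_iso (S : comPzRingType) (A B : pzAlg S) : Prop :=
  exists2 f : A -> B, alg_hom f & bijective f.

Definition diff_hom (R : comPzRingType) (D : derivation R) (A B : diffAlg D)
    (f : A -> B) : Prop :=
  alg_hom f /\ forall x, f (dder A x) = dder B (f x).

Definition diff_iso (R : comPzRingType) (D : derivation R) (A B : diffAlg D) : Prop :=
  exists2 f : A -> B, diff_hom f & bijective f.

Section HomTheory.
Variable S : comPzRingType.

Section Basic.
Variables (A B : pzAlg S) (f : A -> B).
Hypothesis fh : alg_hom f.

Lemma homD x y : f (x + y) = f x + f y.
Proof. by have := fh.1 1 x y; rewrite !scale1r. Qed.
Lemma hom0 : f 0 = 0.
Proof. by apply: (addIr (f 0)); rewrite -homD addr0 add0r. Qed.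
Lemma homZ k x : f (k *: x) = k *: f x.
Proof. by have := fh.1 k x 0; rewrite !addr0 hom0 addr0. Qed.
Lemma homM x y : f (x * y) = f x * f y.
Proof. exact: fh.2.2. Qed.
Lemma hom1 : f 1 = 1.
Proof. exact: fh.2.1. Qed.

Lemma inv_hom g : cancel f g -> cancel g f -> alg_hom g.
Proof.
move=> fK gK; have fI := can_inj fK; split; first move=> k x y.
  by apply: fI; rewrite homD homZ !gK.
split=> [|x y]; apply: fI; rewrite ?homM !gK //.
by rewrite hom1.
Qed.

End Basic.

Lemma id_hom (A : pzAlg S) : alg_hom (id : A -> A).
Proof. by []. Qed.

Lemma comp_hom (A B C : pzAlg S) (g : B -> C) (f : A -> B) :
  alg_hom g -> alg_hom f -> alg_hom (g \o f).
Proof.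
move=> gh fh; split=> [k x y|] /=; first by rewrite (homD fh) (homZ fh) (homD gh) (homZ gh).
by split=> [|x y] /=; rewrite ?(hom1 fh) ?(hom1 gh) // (homM fh) (homM gh).
Qed.

Lemma inl_hom (A B : pzAlg S) : @alg_hom S A (tensor_alg A B) (fun a => a *t (1 : B)).
Proof.
split=> [k x y|]; first by rewrite tpureDl -scale_tpure.
by split=> // x y; rewrite -[in LHS](mulr1 (1 : B)) -mul_tpure.
Qed.

Lemma inr_hom (A B : pzAlg S) : @alg_hom S B (tensor_alg A B) (fun b => (1 : A) *t b).
Proof.
split=> [k x y|]; first by rewrite tpureDr -tpureZ -scale_tpure.
by split=> // x y; rewrite -[in LHS](mulr1 (1 : A)) -mul_tpure.
Qed.

Section Pair.
Variables (A B E : pzAlg S) (g : A -> E) (h : B -> E).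
Hypotheses (gh : alg_hom g) (hh : alg_hom h).
Hypothesis comm_gh : forall a b, g a * h b = h b * g a.

Definition tpair (t : tensor_alg A B) : E := tlift (fun (a : A) (b : B) => g a * h b) t.

Let bal : balanced (fun (a : A) (b : B) => g a * h b).
Proof.
split=> [x x' y|x y y'|k x y].
- by rewrite (homD gh) mulrDl.
- by rewrite (homD hh) mulrDr.
- by rewrite (homZ gh) (homZ hh) -palgAl -palgAr.
Qed.

Lemma tpairE a b : tpair (a *t b) = g a * h b.
Proof. exact: tliftE. Qed.
Lemma tpairD : {morph tpair : x y / x + y}.
Proof. by move=> x y; apply: tliftD. Qed.
Lemma tpair0 : tpair 0 = 0.
Proof. exact: tlift0. Qed.

Lemma tpair_hom : alg_hom tpair.
Proof.
split=> [k x y|].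
  rewrite tpairD; congr (_ + _); elim/tensor_ind: x => [|t t' IHt IHt'|a b].
  - by rewrite scaler0 tpair0 scaler0.
  - by rewrite scalerDr !tpairD IHt IHt' scalerDr.
  - rewrite [X in tpair X](scale_tpure k a b) !tpairE (homZ gh).
    by rewrite -palgAl.
split=> [|x y]; first by rewrite [LHS]tpairE (hom1 gh) (hom1 hh) mulr1.
elim/tensor_ind: x => [|t t' IHt IHt'|a b].
- by rewrite mul0r tpair0 mul0r.
- by rewrite mulrDl !tpairD IHt IHt' mulrDl.
elim/tensor_ind: y => [|t t' IHt IHt'|a' b'].
- by rewrite mulr0 tpair0 mulr0.
- by rewrite mulrDr !tpairD IHt IHt' mulrDr.
rewrite [X in tpair X]mul_tpure !tpairE (homM gh) (homM hh) !mulrA; congr (_ * _).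
by rewrite -!mulrA comm_gh.
Qed.

End Pair.

Lemma tensor_hom_ext (A B E : pzAlg S) (f g : tensor_alg A B -> E) :
    alg_hom f -> alg_hom g ->
    (forall a, f (a *t (1 : B)) = g (a *t (1 : B))) ->
    (forall b, f ((1 : A) *t b) = g ((1 : A) *t b)) ->
  f =1 g.
Proof.
move=> fh gh fgl fgr; apply: additive_tensor_ext => [x y|x y|a b].
- exact: (homD fh).
- exact: (homD gh).
have -> : a *t b = (a *t (1 : B) : tensor_alg A B) * ((1 : A) *t b).
  by rewrite [RHS]mul_tpure mulr1 mul1r.
by rewrite (homM fh) (homM gh) fgl fgr.
Qed.

Lemma inlr_comm (A B : pzAlg S) (a : A) (b : B) :
  (a *t (1 : B) : tensor_alg A B) * ((1 : A) *t b) =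
  ((1 : A) *t b : tensor_alg A B) * (a *t (1 : B)).
Proof. by rewrite [LHS]mul_tpure [RHS]mul_tpure !mulr1 !mul1r. Qed.

Lemma inlrE (A B : pzAlg S) (a : A) (b : B) :
  (a *t (1 : B) : tensor_alg A B) * ((1 : A) *t b) = a *t b.
Proof. by rewrite [LHS]mul_tpure mulr1 mul1r. Qed.

Definition tswap (A B : pzAlg S) : tensor_alg A B -> tensor_alg B A :=
  tpair (fun a : A => (1 : B) *t a : tensor_alg B A)
        (fun b : B => b *t (1 : A) : tensor_alg B A).

Lemma tswap_hom (A B : pzAlg S) : alg_hom (@tswap A B).
Proof.
apply: tpair_hom; [exact: inr_hom | exact: inl_hom | move=> a b].
by rewrite inlr_comm.
Qed.

Lemma tswapE (A B : pzAlg S) (a : A) (b : B) : tswap (a *t b) = b *t a.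
Proof.
rewrite /tswap tpairE; [| exact: inr_hom | exact: inl_hom].
by rewrite -inlr_comm inlrE.
Qed.

Lemma tswapK (A B : pzAlg S) : cancel (@tswap A B) (@tswap B A).
Proof.
apply: additive_tensor_ext => // [x y|a b]; last by rewrite !tswapE.
by rewrite /= !(homD (tswap_hom _ _)).
Qed.

Definition tmap (A B A' B' : pzAlg S) (f : A -> A') (g : B -> B') :
    tensor_alg A B -> tensor_alg A' B' :=
  tpair (fun a => f a *t (1 : B') : tensor_alg A' B')
        (fun b => (1 : A') *t g b : tensor_alg A' B').

Section Map.
Variables (A B A' B' : pzAlg S) (f : A -> A') (g : B -> B').
Hypotheses (fh : alg_hom f) (gh : alg_hom g).

Let lh := comp_hom (inl_hom A' B') fh.
Let rh := comp_hom (inr_hom A' B') gh.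

Lemma tmap_hom : alg_hom (tmap f g).
Proof.
by apply: tpair_hom; [exact: lh | exact: rh | move=> a b; apply: inlr_comm].
Qed.

Lemma tmapE a b : tmap f g (a *t b) = f a *t g b.
Proof. by rewrite /tmap tpairE; [rewrite inlrE | exact: lh | exact: rh]. Qed.

End Map.

Lemma tmapK (A B A' B' : pzAlg S) (f : A -> A') (g : B -> B') f' g' :
  alg_hom f -> alg_hom g -> alg_hom f' -> alg_hom g' ->
  cancel f f' -> cancel g g' -> cancel (tmap f g) (tmap f' g').
Proof.
move=> fh gh fh' gh' fK gK; apply: additive_tensor_ext => // [x y|a b].
  by rewrite /= (homD (tmap_hom fh gh)) (homD (tmap_hom fh' gh')).
by rewrite !tmapE // fK gK.
Qed.

Definition tunit (A : pzAlg S) : tensor_alg (base_alg S) A -> A :=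
  tpair (fun k : base_alg S => (k : S) *: (1 : A)) id.

Lemma alg_map_hom (A : pzAlg S) :
  @alg_hom S (base_alg S) A (fun k : base_alg S => (k : S) *: (1 : A)).
Proof.
split=> [k x y|].
  by rewrite scalerDl scalerA.
split=> [|x y]; first by rewrite scale1r.
by rewrite -palgAl mul1r scalerA.
Qed.

Lemma tunit_hom (A : pzAlg S) : alg_hom (@tunit A).
Proof.
apply: tpair_hom; [exact: alg_map_hom | exact: id_hom | move=> k b].
by rewrite -palgAl -palgAr mul1r mulr1.
Qed.

Lemma tunitK (A : pzAlg S) : cancel (@tunit A) (fun a => (1 : base_alg S) *t a).
Proof.
move=> t; move: t; apply: additive_tensor_ext => // [x y|k a].
  by rewrite /= (homD (tunit_hom _)) tpureDr.
rewrite /tunit tpairE; [| exact: alg_map_hom | exact: id_hom].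
rewrite -palgAl mul1r -tpureZ; congr (_ *t _); exact: (mulr1 (k : S)).
Qed.

Lemma tunitKr (A : pzAlg S) : cancel (fun a => (1 : base_alg S) *t a) (@tunit A).
Proof.
move=> a; rewrite /tunit tpairE; [| exact: alg_map_hom | exact: id_hom].
by rewrite scale1r mul1r.
Qed.

Section Assoc.
Variables A B C : pzAlg S.
Notation ABC := (tensor_alg A (tensor_alg B C)).
Notation ABC' := (tensor_alg (tensor_alg A B) C).

Definition tassoc_l (t : tensor_alg B C) : ABC' :=
  tpair (fun b : B => ((1 : A) *t b : tensor_alg A B) *t (1 : C) : ABC')
        (fun c : C => (1 : tensor_alg A B) *t c : ABC') t.

Definition tassoc : ABC -> ABC' :=
  tpair (fun a : A => (a *t (1 : B) : tensor_alg A B) *t (1 : C) : ABC') tassoc_l.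

Let h1 := comp_hom (inl_hom (tensor_alg A B) C) (inl_hom A B).
Let h2 := comp_hom (inl_hom (tensor_alg A B) C) (inr_hom A B).
Let h3 := inr_hom (tensor_alg A B) C.

Let hl : alg_hom tassoc_l.
Proof. by apply: tpair_hom; [exact: h2 | exact: h3 | move=> b c; apply: inlr_comm]. Qed.

Let hlE b c : tassoc_l (b *t c) = ((1 : A) *t b : tensor_alg A B) *t c.
Proof. by rewrite /tassoc_l tpairE; [rewrite inlrE | exact: h2 | exact: h3]. Qed.

Lemma tassocE a b c : tassoc (a *t (b *t c : tensor_alg B C)) =
  (a *t b : tensor_alg A B) *t c.
Proof.
rewrite /tassoc tpairE; [rewrite hlE | exact: h1 | exact: hl].
by rewrite [LHS]mul_tpure mul1r inlrE.
Qed.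

Lemma tassoc_hom : alg_hom tassoc.
Proof.
apply: tpair_hom; [exact: h1 | exact: hl | move=> a t].
elim/tensor_ind: t => [|t t' IHt IHt'|b c].
- by rewrite (hom0 hl) mulr0 mul0r.
- by rewrite (homD hl) mulrDr mulrDl IHt IHt'.
- by rewrite hlE [LHS]mul_tpure [RHS]mul_tpure mul1r mulr1 inlr_comm.
Qed.

Definition tassoc'_l (t : tensor_alg A B) : ABC :=
  tpair (fun a : A => a *t (1 : tensor_alg B C) : ABC)
        (fun b : B => (1 : A) *t (b *t (1 : C) : tensor_alg B C) : ABC) t.

Definition tassoc' : ABC' -> ABC :=
  tpair tassoc'_l (fun c : C => (1 : A) *t ((1 : B) *t c : tensor_alg B C) : ABC).

Let k1 := inl_hom A (tensor_alg B C).
Let k2 := comp_hom (inr_hom A (tensor_alg B C)) (inl_hom B C).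
Let k3 := comp_hom (inr_hom A (tensor_alg B C)) (inr_hom B C).

Let kl : alg_hom tassoc'_l.
Proof. by apply: tpair_hom; [exact: k1 | exact: k2 | move=> b c; apply: inlr_comm]. Qed.

Let klE a b : tassoc'_l (a *t b) = a *t (b *t (1 : C) : tensor_alg B C).
Proof. by rewrite /tassoc'_l tpairE; [rewrite inlrE | exact: k1 | exact: k2]. Qed.

Lemma tassoc'E a b c : tassoc' ((a *t b : tensor_alg A B) *t c) =
  a *t (b *t c : tensor_alg B C).
Proof.
rewrite /tassoc' tpairE; [rewrite klE | exact: kl | exact: k3].
by rewrite [LHS]mul_tpure mulr1 inlrE.
Qed.

Lemma tassoc'_hom : alg_hom tassoc'.
Proof.
apply: tpair_hom; [exact: kl | exact: k3 | move=> t c].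
elim/tensor_ind: t => [|t t' IHt IHt'|a b].
- by rewrite (hom0 kl) mulr0 mul0r.
- by rewrite (homD kl) mulrDr mulrDl IHt IHt'.
- by rewrite klE [LHS]mul_tpure [RHS]mul_tpure mul1r mulr1 inlr_comm.
Qed.

Lemma tassocK : cancel tassoc tassoc'.
Proof.
apply: additive_tensor_ext => // [x y|a t].
  by rewrite /= (homD tassoc_hom) (homD tassoc'_hom).
elim/tensor_ind: t => [|t t' IHt IHt'|b c].
- rewrite -(scale0r (0 : tensor_alg B C)) -tpureZ -scale_tpure scale0r.
  by rewrite (hom0 tassoc_hom) (hom0 tassoc'_hom).
- by rewrite tpureDr (homD tassoc_hom) (homD tassoc'_hom) IHt IHt'.
- by rewrite tassocE tassoc'E.
Qed.

Lemma tassoc'K : cancel tassoc' tassoc.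
Proof.
apply: additive_tensor_ext => // [x y|t c].
  by rewrite /= (homD tassoc'_hom) (homD tassoc_hom).
elim/tensor_ind: t => [|t t' IHt IHt'|a b].
- rewrite -(scale0r (0 : tensor_alg A B)) -scale_tpure scale0r.
  by rewrite (hom0 tassoc'_hom) (hom0 tassoc_hom).
- by rewrite tpureDl (homD tassoc'_hom) (homD tassoc_hom) IHt IHt'.
- by rewrite tassoc'E tassocE.
Qed.

End Assoc.

Section Kronecker.
Variables n m : nat.
Notation Mn := (mx_alg S n).
Notation Mm := (mx_alg S m).
Notation Mnm := (mx_alg S (n * m)).

Definition kron_unindex (p : 'I_(n * m)) : 'I_n * 'I_m :=
  enum_val (cast_ord (esym (mxvec_cast n m)) p).

Lemma kron_indexK i j : kron_unindex (mxvec_index i j) = (i, j).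
Proof. by rewrite /kron_unindex /mxvec_index cast_ordK enum_rankK. Qed.

Lemma kron_unindexK p : mxvec_index (kron_unindex p).1 (kron_unindex p).2 = p.
Proof. by rewrite /kron_unindex /mxvec_index -surjective_pairing enum_valK cast_ordKV. Qed.

Lemma kron_big (V : nmodType) (F : 'I_(n * m) -> V) :
  \sum_p F p = \sum_i \sum_j F (mxvec_index i j).
Proof.
rewrite (pair_bigA _ (fun i j => F (mxvec_index i j))) /=.
rewrite (reindex (fun q : 'I_n * 'I_m => mxvec_index q.1 q.2)) //=.
exists kron_unindex => [[i j]|p] _ /=; [exact: kron_indexK | exact: kron_unindexK].
Qed.

Definition kron (X : 'M[S]_n) (Y : 'M[S]_m) : 'M[S]_(n * m) :=
  \matrix_(p, q) (X (kron_unindex p).1 (kron_unindex q).1 *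
                  Y (kron_unindex p).2 (kron_unindex q).2).

Lemma kron_mul X Y X' Y' : kron X Y *m kron X' Y' = kron (X *m X') (Y *m Y').
Proof.
apply/matrixP => p q; rewrite !mxE kron_big big_distrl; apply: eq_bigr => i _ /=.
by rewrite big_distrr; apply: eq_bigr => j _; rewrite /= !mxE kron_indexK mulrACA.
Qed.

Lemma kron11 : kron 1%:M 1%:M = 1%:M.
Proof.
apply/matrixP => p q; rewrite !mxE -natrM mulnb -xpair_eqE -!surjective_pairing.
by rewrite (can_eq (g := fun r => mxvec_index r.1 r.2)) //; apply: kron_unindexK.
Qed.

Definition kron_l (X : Mn) : Mnm := kron X 1%:M.
Definition kron_r (Y : Mm) : Mnm := kron 1%:M Y.

Lemma kron_l_hom : alg_hom kron_l.
Proof.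
split=> [k X Y|]; first by apply/matrixP => p q; rewrite !mxE mulrDl mulrA.
split=> [|X Y]; first exact: kron11.
by rewrite [RHS](kron_mul X 1%:M Y 1%:M) mulmx1.
Qed.

Lemma kron_r_hom : alg_hom kron_r.
Proof.
split=> [k X Y|]; first by apply/matrixP => p q; rewrite !mxE mulrDr mulrCA.
split=> [|X Y]; first exact: kron11.
by rewrite [RHS](kron_mul 1%:M X 1%:M Y) mulmx1.
Qed.

Definition tkron : tensor_alg Mn Mm -> Mnm := tpair kron_l kron_r.

Lemma tkronE (X : Mn) (Y : Mm) : tkron (X *t Y) = kron X Y.
Proof.
rewrite /tkron tpairE; [| exact: kron_l_hom | exact: kron_r_hom].
by rewrite [LHS](kron_mul X 1%:M 1%:M Y) mulmx1 mul1mx.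
Qed.

Lemma tkron_hom : alg_hom tkron.
Proof.
apply: tpair_hom; [exact: kron_l_hom | exact: kron_r_hom | move=> X Y].
rewrite [LHS](kron_mul X 1%:M 1%:M Y) [RHS](kron_mul 1%:M Y X 1%:M).
by rewrite !mulmx1 !mul1mx.
Qed.

Definition tkron' (Z : Mnm) : tensor_alg Mn Mm :=
  \sum_p \sum_q (Z : 'M[S]_(n * m)) p q *:
    ((delta_mx (kron_unindex p).1 (kron_unindex q).1 : Mn) *t
     (delta_mx (kron_unindex p).2 (kron_unindex q).2 : Mm) : tensor_alg Mn Mm).

Lemma tkron_bij : bijective tkron.
Proof.
exists tkron' => [|Z].
  apply: additive_tensor_ext => // [x y|X Y].
    rewrite /= (homD tkron_hom) /tkron' -big_split; apply: eq_bigr => p _ /=.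
    rewrite -big_split; apply: eq_bigr => q _ /=.
    by rewrite mxE scalerDl.
  rewrite tkronE /tkron' kron_big.
  have tsuml (I : finType) (F : I -> Mn) (y : Mm) :
      (\sum_i F i) *t y = \sum_i F i *t y :> tensor_alg Mn Mm.
    apply: (big_morph (fun x => x *t y : tensor_alg Mn Mm)) => [x x'|].
      exact: tpureDl.
    by rewrite -(scale0r (0 : Mn)) -scale_tpure scale0r.
  have tsumr (I : finType) (F : I -> Mm) (x : Mn) :
      x *t (\sum_i F i) = \sum_i x *t F i :> tensor_alg Mn Mm.
    apply: (big_morph (fun y => x *t y : tensor_alg Mn Mm)) => [y y'|].
      exact: tpureDr.
    by rewrite -(scale0r (0 : Mm)) -tpureZ -scale_tpure scale0r.
  have XE : X = \sum_i \sum_j (X : 'M[S]_n) i j *: (delta_mx i j : Mn).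
    exact: matrix_sum_delta.
  have YE : Y = \sum_i \sum_j (Y : 'M[S]_m) i j *: (delta_mx i j : Mm).
    exact: matrix_sum_delta.
  rewrite {2}XE tsuml; apply: eq_bigr => i _; rewrite {2}YE tsumr.
  apply: eq_bigr => i' _; rewrite kron_big tsuml; apply: eq_bigr => j _.
  rewrite tsumr; apply: eq_bigr => j' _.
  rewrite mxE !kron_indexK /= mulrC -scalerA.
  rewrite [X in _ *: X](scale_tpure _ (delta_mx i j : Mn) (delta_mx i' j' : Mm)).
  rewrite [LHS](scale_tpure _ (_ *: (delta_mx i j : Mn)) (delta_mx i' j' : Mm)).
  exact: tpureZ.
have tksum (I : finType) (F : I -> tensor_alg Mn Mm) :
    tkron (\sum_i F i) = \sum_i tkron (F i).
  exact: (big_morph tkron (homD tkron_hom) (hom0 tkron_hom)).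
transitivity (\sum_p \sum_q (Z : 'M[S]_(n * m)) p q *: (delta_mx p q : Mnm)).
  rewrite tksum; apply: eq_bigr => p _; rewrite tksum; apply: eq_bigr => q _.
  rewrite (homZ tkron_hom) tkronE; congr (_ *: _); apply/matrixP => r s.
  rewrite !mxE -natrM mulnb; congr ((nat_of_bool _)%:R).
  have E (x y : 'I_(n * m)) : (x == y) =
      ((kron_unindex x).1 == (kron_unindex y).1) &&
      ((kron_unindex x).2 == (kron_unindex y).2).
    rewrite -xpair_eqE -!surjective_pairing.
    by rewrite (can_eq (g := fun r => mxvec_index r.1 r.2)) //; apply: kron_unindexK.
  by rewrite !E andbACA.
by apply/esym; exact: matrix_sum_delta.
Qed.

End Kronecker.

Definition mx1_map (k : base_alg S) : mx_alg S 1 := (k : S)%:M.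

Lemma mx1_hom : alg_hom mx1_map.
Proof.
split=> [k x y|]; first by apply/matrixP => i j; rewrite !ord1 !mxE.
by split=> // x y; apply: scalar_mxM.
Qed.

Lemma mx1_bij : bijective mx1_map.
Proof.
exists (fun X : 'M[S]_1 => X 0 0) => [k|X]; first by rewrite mxE.
by apply/matrixP => i j; rewrite !ord1 !mxE.
Qed.

End HomTheory.

Section DiffIso.
Variables (R : comPzRingType) (D : derivation R).
Implicit Types A B C E : diffAlg D.

Lemma inl_diff A B : @diff_hom R D A (tensor_diff A B) (fun a => a *t (1 : B)).
Proof.
split=> [|a]; first exact: inl_hom.
rewrite [RHS]tensor_derE der1 -[LHS]addr0; congr (_ + _).
by rewrite -(scale0r (0 : B)) -tpureZ -scale_tpure scale0r.
Qed.

Lemma inr_diff A B : @diff_hom R D B (tensor_diff A B) (fun b => (1 : A) *t b).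
Proof.
split=> [|b]; first exact: inr_hom.
rewrite [RHS]tensor_derE der1 -[LHS]add0r; congr (_ + _).
by rewrite -(scale0r (0 : A)) -scale_tpure scale0r.
Qed.

Lemma comp_diff A B C (g : B -> C) (f : A -> B) :
  diff_hom g -> diff_hom f -> diff_hom (g \o f).
Proof.
by move=> [gh gd] [fh fd]; split=> [|x] /=; [apply: comp_hom | rewrite fd gd].
Qed.

Lemma tpair_diff A B E (g : A -> E) (h : B -> E) :
    diff_hom g -> diff_hom h -> (forall a b, g a * h b = h b * g a) ->
  @diff_hom R D (tensor_diff A B) E (tpair g h).
Proof.
move=> [gh gd] [hh hd] gh_comm; have th := tpair_hom gh hh gh_comm; split=> //.
apply: additive_tensor_ext => [x y|x y|a b] /=.
- by rewrite [X in tpair g h X](derD (dder (tensor_diff A B))) (homD th).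
- by rewrite (homD th) derD.
rewrite [X in tpair g h X]tensor_derE (homD th).
rewrite [X in X + _](tpairE gh hh) [X in _ + X](tpairE gh hh) (tpairE gh hh).
by rewrite gd hd derM.
Qed.

Lemma tswap_diff A B : @diff_hom R D (tensor_diff A B) (tensor_diff B A) (@tswap R A B).
Proof.
apply: tpair_diff; [exact: (inr_diff B A) | exact: (inl_diff B A) | move=> a b].
by rewrite [RHS]inlr_comm.
Qed.

Lemma tmap_diff A B A' B' (f : A -> A') (g : B -> B') : diff_hom f -> diff_hom g ->
  @diff_hom R D (tensor_diff A B) (tensor_diff A' B') (tmap f g).
Proof.
move=> fd gd; apply: tpair_diff => [||a b].
- exact: (comp_diff (inl_diff A' B') fd).
- exact: (comp_diff (inr_diff A' B') gd).
- exact: inlr_comm.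
Qed.

Lemma tunit_diff A : @diff_hom R D (tensor_diff (base_diff D) A) A (@tunit R A).
Proof.
apply: tpair_diff => [||k b].
- by split=> [|k]; [exact: alg_map_hom | rewrite dder_ext].
- by split.
- by rewrite -palgAl -palgAr mul1r mulr1.
Qed.

Lemma tassoc_diff A B C : @diff_hom R D (tensor_diff A (tensor_diff B C))
  (tensor_diff (tensor_diff A B) C) (@tassoc R A B C).
Proof.
split=> [|x]; first exact: tassoc_hom.
have th := @tassoc_hom R A B C.
have add1 x' y' : tassoc (dder (tensor_diff A (tensor_diff B C)) (x' + y')) =
    tassoc (dder (tensor_diff A (tensor_diff B C)) x') +
    tassoc (dder (tensor_diff A (tensor_diff B C)) y').
  by rewrite derD (homD th).
have add2 x' y' : dder (tensor_diff (tensor_diff A B) C) (tassoc (x' + y')) =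
    dder (tensor_diff (tensor_diff A B) C) (tassoc x') +
    dder (tensor_diff (tensor_diff A B) C) (tassoc y').
  by rewrite (homD th) derD.
move: x; apply: additive_tensor_ext => // a t.
have t0 : a *t (0 : tensor_diff B C) = 0 :> tensor_diff A (tensor_diff B C).
  by rewrite -(scale0r (0 : tensor_diff B C)) -tpureZ -scale_tpure scale0r.
elim/tensor_ind: t => [|t t' IHt IHt'|b c].
- by rewrite t0 der0 !(hom0 th) der0.
- rewrite (_ : a *t (t + t') = (a *t (t : tensor_diff B C) : tensor_diff A (tensor_diff B C))
    + a *t (t' : tensor_diff B C)); last exact: tpureDr.
  by rewrite add1 add2 IHt IHt'.
rewrite [in RHS]tassocE [X in tassoc X]tensor_derE [X in _ *t X + _]/=.
rewrite [X in tassoc (_ + _ *t X)]tensor_derE.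
rewrite [X in tassoc (_ + X)](tpureDr a (dder B b *t c : tensor_alg B C)
  (b *t dder C c : tensor_alg B C)).
rewrite !(homD th) !tassocE [RHS]tensor_derE [X in _ = X *t c + _]tensor_derE.
by rewrite [X in _ = X + _]tpureDl -[RHS]addrA.
Qed.

Lemma tkron_diff n m : @diff_hom R D (tensor_diff (mx_diff D n) (mx_diff D m))
  (mx_diff D (n * m)) (@tkron R n m).
Proof.
have Db (b : bool) : D b%:R = 0 by case: b; rewrite ?der1 ?der0.
apply: tpair_diff => [||X Y].
- split=> [|X]; first exact: kron_l_hom.
  by apply/matrixP => p q; rewrite !mxE derM Db mulr0 addr0.
- split=> [|Y]; first exact: kron_r_hom.
  by apply/matrixP => p q; rewrite !mxE derM Db mul0r add0r.
- rewrite [LHS](kron_mul X 1%:M 1%:M Y) [RHS](kron_mul 1%:M Y X 1%:M).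
  by rewrite !mulmx1 !mul1mx.
Qed.

Lemma mx1_diff : @diff_hom R D (base_diff D) (mx_diff D 1) (@mx1_map R).
Proof.
split=> [|k]; first exact: mx1_hom.
by apply/matrixP => i j; rewrite !ord1 !mxE.
Qed.

Lemma inv_diff A B (f : A -> B) g :
  diff_hom f -> cancel f g -> cancel g f -> diff_hom g.
Proof.
move=> [fh fd] fK gK; split=> [|x]; first exact: (inv_hom fh fK gK).
by apply: (can_inj fK); rewrite fd !gK.
Qed.

Lemma diff_iso_refl A : diff_iso A A.
Proof. by exists id => //; exists id. Qed.
Lemma diff_iso_sym A B : diff_iso A B -> diff_iso B A.
Proof.
move=> [f fd [g fK gK]]; exists g; last by exists f.
exact: (inv_diff fd fK gK).
Qed.
Lemma diff_iso_trans A B C : diff_iso A B -> diff_iso B C -> diff_iso A C.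
Proof.
by move=> [f fd fb] [g gd gb]; exists (g \o f); [apply: comp_diff | apply: bij_comp].
Qed.
Lemma diff_iso_tensor A A' B B' :
  diff_iso A A' -> diff_iso B B' -> diff_iso (tensor_diff A B) (tensor_diff A' B').
Proof.
move=> [f fd [f' fK f'K]] [g gd [g' gK g'K]].
have fd' := inv_diff fd fK f'K; have gd' := inv_diff gd gK g'K.
exists (tmap f g); first exact: tmap_diff.
exists (tmap f' g'); apply: tmapK => //.
- exact: fd.1.
- exact: gd.1.
- exact: fd'.1.
- exact: gd'.1.
- exact: fd'.1.
- exact: gd'.1.
- exact: fd.1.
- exact: gd.1.
Qed.
Lemma diff_iso_tensorC A B : diff_iso (tensor_diff A B) (tensor_diff B A).
Proof.
exists (@tswap R A B); first exact: tswap_diff.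
by exists (@tswap R B A); apply: tswapK.
Qed.
Lemma diff_iso_tensorA A B C :
  diff_iso (tensor_diff A (tensor_diff B C)) (tensor_diff (tensor_diff A B) C).
Proof.
exists (@tassoc R A B C); first exact: tassoc_diff.
by exists (@tassoc' R A B C); [apply: tassocK | apply: tassoc'K].
Qed.
Lemma diff_iso_tensor1 A : diff_iso (tensor_diff (base_diff D) A) A.
Proof.
exists (@tunit R A); first exact: tunit_diff.
by exists (fun a => (1 : base_alg R) *t a); [apply: tunitK | apply: tunitKr].
Qed.
Lemma diff_iso_kron n m :
  diff_iso (tensor_diff (mx_diff D n) (mx_diff D m)) (mx_diff D (n * m)).
Proof. by exists (@tkron R n m); [apply: tkron_diff | apply: tkron_bij]. Qed.
Lemma diff_iso_mx1 : diff_iso (base_diff D) (mx_diff D 1).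
Proof. by exists (@mx1_map R); [apply: mx1_diff | apply: mx1_bij]. Qed.

End DiffIso.

Section AlgIso.
Variable S : comPzRingType.
Implicit Types A B C : pzAlg S.

Lemma alg_iso_refl A : alg_iso A A.
Proof. by exists id => //; exists id. Qed.
Lemma alg_iso_sym A B : alg_iso A B -> alg_iso B A.
Proof.
move=> [f fh [g fK gK]]; exists g; last by exists f.
exact: (inv_hom fh fK gK).
Qed.
Lemma alg_iso_trans A B C : alg_iso A B -> alg_iso B C -> alg_iso A C.
Proof.
by move=> [f fh fb] [g gh gb]; exists (g \o f); [apply: comp_hom | apply: bij_comp].
Qed.
Lemma alg_iso_tensor A A' B B' :
  alg_iso A A' -> alg_iso B B' -> alg_iso (tensor_alg A B) (tensor_alg A' B').
Proof.
move=> [f fh [f' fK f'K]] [g gh [g' gK g'K]].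
have fh' := inv_hom fh fK f'K; have gh' := inv_hom gh gK g'K.
by exists (tmap f g); [apply: tmap_hom | exists (tmap f' g'); apply: tmapK].
Qed.
Lemma alg_iso_tensorC A B : alg_iso (tensor_alg A B) (tensor_alg B A).
Proof.
exists (@tswap S A B); first exact: tswap_hom.
by exists (@tswap S B A); apply: tswapK.
Qed.
Lemma alg_iso_tensorA A B C :
  alg_iso (tensor_alg A (tensor_alg B C)) (tensor_alg (tensor_alg A B) C).
Proof.
exists (@tassoc S A B C); first exact: tassoc_hom.
by exists (@tassoc' S A B C); [apply: tassocK | apply: tassoc'K].
Qed.
Lemma alg_iso_tensor1 A : alg_iso (tensor_alg (base_alg S) A) A.
Proof.
exists (@tunit S A); first exact: tunit_hom.
by exists (fun a => (1 : base_alg S) *t a); [apply: tunitK | apply: tunitKr].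
Qed.
Lemma alg_iso_kron n m :
  alg_iso (tensor_alg (mx_alg S n) (mx_alg S m)) (mx_alg S (n * m)).
Proof. by exists (@tkron S n m); [apply: tkron_hom | apply: tkron_bij]. Qed.
Lemma alg_iso_mx1 : alg_iso (base_alg S) (mx_alg S 1).
Proof. by exists (@mx1_map S); [apply: mx1_hom | apply: mx1_bij]. Qed.

End AlgIso.

Record comMonoid := ComMonoid {
  cm_sort :> Type;
  cm_mul : cm_sort -> cm_sort -> cm_sort;
  cm_one : cm_sort;
  cm_mulA : associative cm_mul;
  cm_mulC : commutative cm_mul;
  cm_mul1 : left_id cm_one cm_mul
}.

Definition monoid_iso (M N : comMonoid) (f : M -> N) : Prop :=
  [/\ f (cm_one M) = cm_one N,
      forall x y, f (cm_mul x y) = cm_mul (f x) (f y)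
    & bijective f].

Section EqClass.
Variables (T : Type) (E : T -> T -> Prop).

(* Equivalence classes as predicates. The library's quotients are not used:
   they would require a choiceType structure on T, which here ranges over large
   types such as the type of all Azumaya algebras over a ring. *)
Definition eq_class : Type := {C : T -> Prop | exists x, C = E x}.
Definition class_of (x : T) : eq_class := exist _ (E x) (ex_intro _ x erefl).
Definition class_repr (C : eq_class) : T := sval (cid (svalP C)).

Lemma class_reprK C : class_of (class_repr C) = C.
Proof.
case: C => C hC; apply: eq_exist => /=.
by rewrite /class_repr /=; case: (cid _).
Qed.

Hypotheses (Erefl : forall x, E x x) (Esym : forall x y, E x y -> E y x).
Hypothesis Etrans : forall x y z, E x y -> E y z -> E x z.

Lemma class_ofP x y : class_of x = class_of y <-> E x y.
Proof.
split=> [/(congr1 sval) /= Exy|Exy]; first by rewrite Exy.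
apply: eq_exist; apply/funext => z; apply/propext; split => [|/(Etrans Exy)//].
exact/Etrans/Esym.
Qed.

Lemma class_reprE x : E (class_repr (class_of x)) x.
Proof. by apply/class_ofP; rewrite class_reprK. Qed.

Variables (mul : T -> T -> T) (one : T).
Hypothesis mulE : forall x x' y y', E x x' -> E y y' -> E (mul x y) (mul x' y').
Hypothesis mulA : forall x y z, E (mul x (mul y z)) (mul (mul x y) z).
Hypothesis mulC : forall x y, E (mul x y) (mul y x).
Hypothesis mul1 : forall x, E (mul one x) x.

Definition class_mul (p q : eq_class) : eq_class :=
  class_of (mul (class_repr p) (class_repr q)).

Lemma class_mulE x y : class_mul (class_of x) (class_of y) = class_of (mul x y).
Proof. by apply/class_ofP; apply: mulE; apply: class_reprE. Qed.

Fact class_mulA : associative class_mul.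
Proof.
move=> p q r; rewrite -(class_reprK p) -(class_reprK q) -(class_reprK r) !class_mulE.
exact/class_ofP/mulA.
Qed.
Fact class_mulC : commutative class_mul.
Proof.
move=> p q; rewrite -(class_reprK p) -(class_reprK q) !class_mulE.
exact/class_ofP/mulC.
Qed.
Fact class_mul1 : left_id (class_of one) class_mul.
Proof.
move=> p; rewrite -(class_reprK p) !class_mulE.
exact/class_ofP/mul1.
Qed.

Definition class_monoid : comMonoid := ComMonoid class_mulA class_mulC class_mul1.

End EqClass.

Record submonoid (M : comMonoid) := Submonoid {
  sm_pred :> M -> Prop;
  sm_one : sm_pred (cm_one M);
  sm_mul : forall x y, sm_pred x -> sm_pred y -> sm_pred (cm_mul x y)
}.

Section QuotientMonoid.
Variables (M : comMonoid) (N : submonoid M).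

Definition quot_rel (m1 m2 : M) : Prop :=
  exists n1 n2, [/\ N n1, N n2 & cm_mul m1 n1 = cm_mul m2 n2].

Fact quot_rel_refl m : quot_rel m m.
Proof. by exists (cm_one M), (cm_one M); split=> //; apply: sm_one. Qed.
Fact quot_rel_sym m1 m2 : quot_rel m1 m2 -> quot_rel m2 m1.
Proof. by move=> [n1 [n2 [h1 h2 e]]]; exists n2, n1. Qed.
Fact quot_rel_trans m1 m2 m3 : quot_rel m1 m2 -> quot_rel m2 m3 -> quot_rel m1 m3.
Proof.
move=> [n1 [n2 [h1 h2 e]]] [p1 [p2 [k1 k2 e']]].
exists (cm_mul n1 p1), (cm_mul n2 p2); split; try exact: sm_mul.
by rewrite cm_mulA e -cm_mulA (cm_mulC n2 p1) cm_mulA e' -cm_mulA (cm_mulC p2).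
Qed.
Fact quot_rel_mul x x' y y' :
  quot_rel x x' -> quot_rel y y' -> quot_rel (cm_mul x y) (cm_mul x' y').
Proof.
move=> [n1 [n2 [h1 h2 e]]] [p1 [p2 [k1 k2 e']]].
exists (cm_mul n1 p1), (cm_mul n2 p2); split; try exact: sm_mul.
have ACA a b c d : @cm_mul M (cm_mul a b) (cm_mul c d) = cm_mul (cm_mul a c) (cm_mul b d).
  by rewrite -!cm_mulA; congr cm_mul; rewrite !cm_mulA (cm_mulC b).
by rewrite ACA e e' ACA.
Qed.

Fact eq_quot_rel x y : x = y -> quot_rel x y.
Proof. by move=> ->; apply: quot_rel_refl. Qed.

Definition quot_monoid : comMonoid :=
  @class_monoid M quot_rel quot_rel_refl quot_rel_sym quot_rel_trans
    (@cm_mul M) (cm_one M) quot_rel_mul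
    (fun x y z => eq_quot_rel (cm_mulA x y z))
    (fun x y => eq_quot_rel (cm_mulC x y))
    (fun x => eq_quot_rel (cm_mul1 x)).

Definition quot_class (m : M) : quot_monoid := class_of quot_rel m.

End QuotientMonoid.

Section Units.
Variable M : comMonoid.

Record unit_elt := UnitElt {
  unit_val :> M;
  unit_valP : exists v, cm_mul unit_val v = cm_one M
}.

Lemma unit_val_inj : injective unit_val.
Proof.
move=> [x hx] [y hy] /= exy; move: hx hy; rewrite exy => hx hy.
by rewrite (Prop_irrelevance hx hy).
Qed.

Fact unit_mul_subproof (x y : unit_elt) :
  exists v, cm_mul (cm_mul x y : M) v = cm_one M.
Proof.
case: x y => [x [x' hx]] [y [y' hy]] /=; exists (cm_mul x' y').
by rewrite (cm_mulC x) -cm_mulA (cm_mulA x) hx cm_mul1.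
Qed.
Definition unit_mul (x y : unit_elt) : unit_elt := UnitElt (unit_mul_subproof x y).

Definition unit_one : unit_elt := UnitElt (ex_intro _ _ (cm_mul1 (cm_one M))).

Fact unit_mulA : associative unit_mul.
Proof. by move=> x y z; apply: unit_val_inj; apply: cm_mulA. Qed.
Fact unit_mulC : commutative unit_mul.
Proof. by move=> x y; apply: unit_val_inj; apply: cm_mulC. Qed.
Fact unit_mul1 : left_id unit_one unit_mul.
Proof. by move=> x; apply: unit_val_inj; apply: cm_mul1. Qed.

Definition unit_group : comMonoid := ComMonoid unit_mulA unit_mulC unit_mul1.

End Units.

Record azumaya (S : comPzRingType) := Azumaya {
  az_alg :> pzAlg S;
  az_azumaya : is_azumaya az_alg
}.

Record diffAzumaya (R : comPzRingType) (D : derivation R) := DiffAzumaya {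
  daz_alg :> diffAlg D;
  daz_azumaya : is_azumaya daz_alg
}.

Section BrauerMonoid.
Variable S : comPzRingType.
Implicit Types A B C : azumaya S.

Definition az_base : azumaya S := Azumaya (base_azumaya S).
Definition az_tensor A B : azumaya S :=
  Azumaya (tensor_azumaya (az_azumaya A) (az_azumaya B)).
Definition az_mx n (n_gt0 : (0 < n)%N) : azumaya S := Azumaya (mx_azumaya S n_gt0).

Definition az_iso A B : Prop := alg_iso A B.

Definition MA : comMonoid :=
  @class_monoid (azumaya S) az_iso
    (fun A => alg_iso_refl A) (fun A B => @alg_iso_sym S A B)
    (fun A B C => @alg_iso_trans S A B C)
    az_tensor az_base
    (fun A A' B B' => @alg_iso_tensor S A A' B B')
    (fun A B C => alg_iso_tensorA A B C) (fun A B => alg_iso_tensorC A B)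
    (fun A => alg_iso_tensor1 A).

Definition MA_class A : MA := class_of az_iso A.

Definition MM_pred (x : MA) : Prop :=
  exists (n : nat) (n_gt0 : (0 < n)%N), x = MA_class (az_mx n_gt0).

Fact MM_one : MM_pred (cm_one MA).
Proof.
exists 1%N, isT; apply/class_ofP.
- exact: (fun A => alg_iso_refl A).
- exact: (fun A B => @alg_iso_sym S A B).
- exact: (fun A B C => @alg_iso_trans S A B C).
- exact: alg_iso_mx1.
Qed.

Fact MM_mul x y : MM_pred x -> MM_pred y -> MM_pred (cm_mul x y).
Proof.
move=> [n [n_gt0 ->]] [m [m_gt0 ->]].
have nm_gt0 : (0 < n * m)%N by rewrite muln_gt0 n_gt0.
have r := fun A => alg_iso_refl A.
have s := fun A B => @alg_iso_sym S A B.
have t := fun A B C => @alg_iso_trans S A B C.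
exists (n * m)%N, nm_gt0; rewrite [LHS]class_mulE.
- apply/class_ofP; [exact: r | exact: s | exact: t | exact: alg_iso_kron].
- exact: r.
- exact: s.
- exact: t.
- exact: (fun A A' B B' => @alg_iso_tensor S A A' B B').
Qed.

Definition MM : submonoid MA := Submonoid MM_one MM_mul.

Definition BM : comMonoid := quot_monoid MM.

Definition BM_class A : BM := quot_class MM (MA_class A).

End BrauerMonoid.

Section DiffBrauerMonoid.
Variables (R : comPzRingType) (D : derivation R).
Implicit Types A B C : diffAzumaya D.

Definition daz_base : diffAzumaya D :=
  @DiffAzumaya R D (base_diff D) (base_azumaya R).
Definition daz_tensor A B : diffAzumaya D :=
  @DiffAzumaya R D (tensor_diff A B) (tensor_azumaya (daz_azumaya A) (daz_azumaya B)).
Definition daz_mx n (n_gt0 : (0 < n)%N) : diffAzumaya D :=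
  @DiffAzumaya R D (mx_diff D n) (mx_azumaya R n_gt0).
Definition daz_bc (A0 : azumaya (constants D)) : diffAzumaya D :=
  @DiffAzumaya R D (bc_diff A0) (bc_azumaya (const_incl D) (az_azumaya A0)).

Definition daz_iso A B : Prop := diff_iso A B.

Definition MAdiff : comMonoid :=
  @class_monoid (diffAzumaya D) daz_iso
    (fun A => diff_iso_refl A) (fun A B => @diff_iso_sym R D A B)
    (fun A B C => @diff_iso_trans R D A B C)
    daz_tensor daz_base
    (fun A A' B B' => @diff_iso_tensor R D A A' B B')
    (fun A B C => diff_iso_tensorA A B C) (fun A B => diff_iso_tensorC A B)
    (fun A => diff_iso_tensor1 A).

Definition MAdiff_class A : MAdiff := class_of daz_iso A.

Definition MM0diff_pred (x : MAdiff) : Prop :=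
  exists (n : nat) (n_gt0 : (0 < n)%N), x = MAdiff_class (daz_mx n_gt0).

Fact MM0diff_one : MM0diff_pred (cm_one MAdiff).
Proof.
exists 1%N, isT; apply/class_ofP.
- exact: (fun A => diff_iso_refl A).
- exact: (fun A B => @diff_iso_sym R D A B).
- exact: (fun A B C => @diff_iso_trans R D A B C).
- exact: diff_iso_mx1.
Qed.

Fact MM0diff_mul x y : MM0diff_pred x -> MM0diff_pred y -> MM0diff_pred (cm_mul x y).
Proof.
move=> [n [n_gt0 ->]] [m [m_gt0 ->]].
have nm_gt0 : (0 < n * m)%N by rewrite muln_gt0 n_gt0.
have r := fun A => diff_iso_refl A.
have s := fun A B => @diff_iso_sym R D A B.
have t := fun A B C => @diff_iso_trans R D A B C.
exists (n * m)%N, nm_gt0; rewrite [LHS]class_mulE.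
- apply/class_ofP; [exact: r | exact: s | exact: t | exact: diff_iso_kron].
- exact: r.
- exact: s.
- exact: t.
- exact: (fun A A' B B' => @diff_iso_tensor R D A A' B B').
Qed.

Definition MM0diff : submonoid MAdiff := Submonoid MM0diff_one MM0diff_mul.

Definition BMdiff : comMonoid := quot_monoid MM0diff.

Definition BMdiff_class A : BMdiff := quot_class MM0diff (MAdiff_class A).

End DiffBrauerMonoid.

(* Main.v *)
(* Write S for the ring of constants of R.

   Base change is injective, and compatible with tensor products and matrices, because
   an Azumaya S-algebra A_0 has a dual basis, so that the constants of R (x)_S A_0 are A_0.

   If A is invertible, then A (x) B is M_n(R) for some B. The (0, 0) entry restricts to a
   differential functional on B with value 1 at 1, which makes A a direct summand of
   M_n(R) as a differential module. Hence A = R (x)_S A^D, the algebra A^D (x)_S B^D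
   is M_n(S), and a tensor factor of an Azumaya algebra with such a functional is Azumaya.

   It remains to see that BM(S) is a group. If the Azumaya algebra A acts on a free module
   of finite rank n > 0, then A (x) C is M_n(S) with C the centralizer of A. To find such
   a module one shows, following Bass, that P (x) Q is free of positive rank for some Q,
   where P = A is a faithful finitely generated projective module. Expanding
   \det (e + (1 - e)) = 1 for an idempotent e presenting P gives scalars f_J of sum 1 and,
   for each J, maps P -> S^|J| -> P and back whose composites are multiplication by f_J.
   Such matrix factorizations can be tensored, the scalars adding up; the result is an
   isomorphism S^N (+) P (x) E = P (x) O with N > 0. So P divides N up to projective
   summands of opposite sign, which are removed after passing to multiples, since a
   Toeplitz matrix shows that large multiples of a module of positive rank have almost as
   many free summands as their rank allows. *)

Require Import Defs.
From HB Require Import structures.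
From mathcomp Require Import all_boot all_algebra.
From mathcomp Require Import perm boolp.

Set Implicit Arguments.
Unset Strict Implicit.
Unset Printing Implicit Defensive.

Import GRing.Theory.
Local Open Scope ring_scope.

(** * Subalgebras, restriction of scalars and the universal property of base change *)

Record subalg (S : comPzRingType) (A : pzAlg S) := Subalg {
  sa_pred : {pred A};
  sa_ring : subring_closed sa_pred;
  sa_scale : forall (k : S) x, x \in sa_pred -> k *: x \in sa_pred
}.

Section SubAlgebra.
Variables (S : comPzRingType) (A : pzAlg S) (P : subalg A).

Record sub_sort := SubSort { sub_val : A; _ : sub_val \in sa_pred P }.

HB.instance Definition _ := [isSub for sub_val].
HB.instance Definition _ := [Choice of sub_sort by <:].
HB.instance Definition _ :=
  GRing.SubChoice_isSubPzRing.Build A (sa_pred P) sub_sort (sa_ring P).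

Definition sub_scale (k : S) (x : sub_sort) : sub_sort :=
  SubSort (sa_scale k (valP x)).

Definition sub_alg : pzAlg S.
Proof.
refine (@PzAlg S sub_sort sub_scale _ _ _ _ _ _).
- by move=> a b x; apply: val_inj; apply: scalerA.
- by move=> x; apply: val_inj; apply: scale1r.
- by move=> k x y; apply: val_inj; apply: scalerDr.
- by move=> x a b; apply: val_inj; apply: scalerDl.
- by move=> k x y; apply: val_inj; apply: palgAl.
- by move=> k x y; apply: val_inj; apply: palgAr.
Defined.

Definition sub_incl (x : sub_alg) : A := sub_val x.

Lemma sub_incl_hom : alg_hom sub_incl.
Proof. by []. Qed.

Lemma sub_incl_inj : injective sub_incl.
Proof. exact: val_inj. Qed.

Lemma sub_inclP (x : sub_alg) : sub_incl x \in sa_pred P.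
Proof. exact: valP. Qed.

Definition sub_in (x : A) (h : x \in sa_pred P) : sub_alg := SubSort h.

End SubAlgebra.

(** The carrier is kept, so that a map into [E] can be S-linear while its values are still scaled by
    R. *)
Definition rescale (S R : comPzRingType) (phi : {rmorphism S -> R}) (E : pzAlg R) : pzAlg S.
Proof.
refine (@PzAlg S (palg_ring E) (fun k (x : E) => phi k *: x) _ _ _ _ _ _).
- by move=> a b x; rewrite rmorphM; exact: (scalerA (phi a) (phi b) (x : E)).
- by move=> x; rewrite rmorph1; exact: (scale1r (x : E)).
- by move=> k x y; exact: (scalerDr (phi k) (x : E) y).
- by move=> x a b; rewrite rmorphD; exact: (scalerDl (x : E)).
- by move=> k x y; exact: (palgAl (phi k) (x : E) y).
- by move=> k x y; exact: (palgAr (phi k) (x : E) y).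
Defined.

Section BaseChangeLift.
Variables (S R : comPzRingType) (phi : {rmorphism S -> R}) (A : pzAlg S) (E : pzAlg R).
Variable g : A -> E.
Hypothesis gh : @alg_hom S A (rescale phi E) g.

Definition bc_lift (t : bc_alg phi A) : E :=
  tlift (fun (r : restr_alg phi) (x : A) => (r : R) *: g x) t.

Let gD x y : g (x + y) = g x + g y. Proof. exact: (homD gh). Qed.
Let gZ k x : g (k *: x) = phi k *: g x. Proof. exact: (homZ gh). Qed.
Let gM x y : g (x * y) = g x * g y. Proof. exact: (homM gh). Qed.
Let g1 : g 1 = 1. Proof. exact: (hom1 gh). Qed.

Let bal : balanced (fun (r : restr_alg phi) (x : A) => (r : R) *: g x).
Proof.
split=> [x x' y|x y y'|k x y].
- exact: scalerDl.
- by rewrite gD scalerDr.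
- by rewrite gZ scalerA [(x : R) * _]mulrC.
Qed.

Lemma bc_liftE r x : bc_lift (bc_pure phi r x) = r *: g x.
Proof. exact: tliftE. Qed.

Lemma bc_liftD : {morph bc_lift : t u / t + u}.
Proof. by move=> t u; apply: tliftD. Qed.

Lemma bc_lift0 : bc_lift 0 = 0.
Proof. exact: tlift0. Qed.

Lemma bc_lift_hom : alg_hom bc_lift.
Proof.
split=> [k x y|].
  rewrite bc_liftD; congr (_ + _); elim/bc_ind: x => [|t t' IHt IHt'|r x].
  - by rewrite scaler0 bc_lift0 scaler0.
  - by rewrite scalerDr !bc_liftD IHt IHt' scalerDr.
  - by rewrite scale_bc_pure !bc_liftE scalerA.
split=> [|x y]; first by rewrite -bc_pure11 bc_liftE scale1r.
elim/bc_ind: x => [|t t' IHt IHt'|r x].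
- by rewrite mul0r bc_lift0 mul0r.
- by rewrite mulrDl !bc_liftD IHt IHt' mulrDl.
elim/bc_ind: y => [|t t' IHt IHt'|r' x'].
- by rewrite mulr0 bc_lift0 mulr0.
- by rewrite mulrDr !bc_liftD IHt IHt' mulrDr.
by rewrite mul_bc_pure !bc_liftE gM -palgAl -palgAr scalerA.
Qed.

End BaseChangeLift.

(** * Linear functionals and finite sums in tensor products *)

Section ScalarFunctions.
Variables (S : comPzRingType) (M : lmodType S) (f : M -> S).
Hypothesis fl : scalar f.

Lemma scalar_funD x y : f (x + y) = f x + f y.
Proof. by have := fl 1 x y; rewrite !scale1r mul1r. Qed.
Lemma scalar_fun0 : f 0 = 0.
Proof. by apply: (addIr (f 0)); rewrite -scalar_funD addr0 add0r. Qed.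
Lemma scalar_funZ k x : f (k *: x) = k * f x.
Proof. by have := fl k x 0; rewrite !addr0 scalar_fun0 addr0. Qed.
Lemma scalar_fun_sum (I : finType) (F : I -> M) : f (\sum_i F i) = \sum_i f (F i).
Proof. exact: (big_morph f scalar_funD scalar_fun0). Qed.

End ScalarFunctions.

Section HomSums.
Variables (S : comPzRingType).

Lemma hom_sum (A B : pzAlg S) (f : A -> B) (I : finType) (F : I -> A) :
  alg_hom f -> f (\sum_i F i) = \sum_i f (F i).
Proof. by move=> fh; apply: (big_morph f (homD fh) (hom0 fh)). Qed.

Lemma tpure0l (M N : lmodType S) (y : N) : (0 : M) *t y = 0.
Proof. by rewrite -(scale0r (0 : M)) -scale_tpure scale0r. Qed.
Lemma tpure0r (M N : lmodType S) (x : M) : x *t (0 : N) = 0.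
Proof. by rewrite -(scale0r (0 : N)) -tpureZ -scale_tpure scale0r. Qed.

Lemma tpure_suml (M N : lmodType S) (I : finType) (F : I -> M) (y : N) :
  (\sum_i F i) *t y = \sum_i F i *t y.
Proof.
exact: (big_morph (fun x => x *t y) (fun x x' => tpureDl x x' y) (tpure0l M y)).
Qed.
Lemma tpure_sumr (M N : lmodType S) (I : finType) (F : I -> N) (x : M) :
  x *t (\sum_i F i) = \sum_i x *t F i.
Proof.
exact: (big_morph (fun y => x *t y) (fun y y' => tpureDr x y y') (tpure0r N x)).
Qed.

End HomSums.

Section TensorFunctional.
Variables (S : comPzRingType) (M N : lmodType S) (f : M -> S) (g : N -> S).
Hypotheses (fl : scalar f) (gl : scalar g).

Definition tfun (t : tensor M N) : S := tlift (fun x y => f x * g y) t.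

Let bal : balanced (fun x y => f x * g y).
Proof.
split=> [x x' y|x y y'|k x y].
- by rewrite (scalar_funD fl) mulrDl.
- by rewrite (scalar_funD gl) mulrDr.
- by rewrite (scalar_funZ fl) (scalar_funZ gl) mulrCA mulrA.
Qed.

Lemma tfunE x y : tfun (x *t y) = f x * g y.
Proof. exact: tliftE. Qed.

Lemma tfun_scalar : scalar tfun.
Proof.
move=> k t u; rewrite [LHS]tliftD //; congr (_ + _).
elim/tensor_ind: t => [|t t' IHt IHt'|x y].
- by rewrite scaler0 /tfun tlift0 // mulr0.
- by rewrite scalerDr [LHS]tliftD // [in RHS]/tfun tliftD // IHt IHt' mulrDr.
- by rewrite scale_tpure tfunE [LHS]tfunE (scalar_funZ fl) mulrA.
Qed.

End TensorFunctional.

(** Transport of structure on the data of [azumayaP], instead of on projectivity and the sandwich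
    bijection separately. *)
Lemma alg_iso_azumaya (S : comPzRingType) (A B : pzAlg S) :
  alg_iso A B -> is_azumaya A -> is_azumaya B.
Proof.
move=> [h hh [h' hK h'K]] /azumayaP[I [a [f [u [c [flin dual fc fu fid]]]]]].
have h'h := inv_hom hh hK h'K.
apply/azumayaP; exists I, (h \o a), (fun i => f i \o h'), (fun i => tmap h h (u i)), c.
have th := tmap_hom hh hh.
split=> [i k x y|x||i x|b] /=.
- by rewrite (homD h'h) (homZ h'h) flin.
- rewrite -{1}(h'K x) {1}(dual (h' x)) (hom_sum _ hh).
  by apply: eq_bigr => i _; rewrite (homZ hh).
- by under eq_bigr => i _ do under eq_bigr => j _ do rewrite hK.
- have sE t y : sandwich (tmap h h t) (h y) = h (sandwich t y).
    elim/tensor_ind: t => [|t t' IHt IHt'|p q].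
    + by rewrite (hom0 th) !sandwich0l (hom0 hh).
    + by rewrite (homD th) !sandwichDl IHt IHt' (homD hh).
    + by rewrite tmapE // !sandwichE !(homM hh).
  by rewrite -{1}(h'K x) sE fu (homZ hh) (hom1 hh).
- rewrite -{2}(h'K b) -[in RHS](hom1 hh) -(tmapE hh hh) -fid (hom_sum _ th).
  apply: eq_bigr => i _; rewrite (homM th) tmapE // (hom1 hh); congr (_ *t _ * _).
  by rewrite (homM hh) h'K.
Qed.

Section ConstantForms.
Variables (R : comPzRingType) (D : derivation R).
Notation S := (constants D).
Notation phi := (const_incl D).
Implicit Types (X Y : pzAlg S) (E F : diffAlg D).

Fact const_ring_closed E :
  subring_closed ([pred x | dder E x == 0] : {pred rescale phi E}).
Proof.
split=> [|x y|x y]; rewrite !inE ?der1 // => /eqP Dx /eqP Dy; apply/eqP.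
- by rewrite (derB (dder E) x y) Dx Dy subr0.
- by rewrite (derM (dder E) x y) Dx Dy mul0r mulr0 addr0.
Qed.

Fact const_scale_closed E (k : S) (x : rescale phi E) :
  x \in [pred x | dder E x == 0] -> k *: x \in [pred x | dder E x == 0].
Proof.
rewrite !inE => /eqP Dx; apply/eqP.
by rewrite (dderZ (phi k) (x : E)) der_const Dx scale0r scaler0 addr0.
Qed.

Definition const_alg E : pzAlg S :=
  sub_alg (Subalg (const_ring_closed E) (@const_scale_closed E)).

Definition const_alg_val E (x : const_alg E) : E := sub_incl x.

Lemma const_alg_valP E (x : const_alg E) : dder E (const_alg_val x) = 0.
Proof. by have := sub_inclP x; rewrite inE => /eqP. Qed.

Lemma const_alg_val_inj E : injective (@const_alg_val E).
Proof. exact: val_inj. Qed.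

Lemma const_alg_val_hom E : @alg_hom S (const_alg E) (rescale phi E) (@const_alg_val E).
Proof. by []. Qed.

Lemma const_alg_lift E (x : E) : dder E x = 0 -> exists y, const_alg_val y = x.
Proof.
move=> Dx; have xP : (x : rescale phi E) \in [pred x | dder E x == 0] by rewrite inE Dx.
by exists (SubSort (P := Subalg (const_ring_closed E) (@const_scale_closed E)) xP).
Qed.

Lemma const_lift (r : R) : D r = 0 -> exists c : S, phi c = r.
Proof.
move=> Dr; have rP : r \in const_pred D by rewrite inE Dr.
by exists (Constant rP).
Qed.

(** This encodes that E is R (x) X through a dual basis (x, c) of X which [psi] turns into a dual
    basis of E whose functionals respect the derivations. In this shape forms pass to tensor
    products and isomorphic algebras without touching base changes, and constants can be computed by
    coordinates. *)
Definition const_form X E : Prop :=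
  exists (psi : X -> E) (I : finType) (x : I -> X) (c : I -> X -> S) (f : I -> E -> R),
  [/\ @alg_hom S X (rescale phi E) psi, forall t, dder E (psi t) = 0,
      (forall i, scalar (f i)) /\ (forall i y, f i (dder E y) = D (f i y)),
      forall y, y = \sum_i f i y *: psi (x i)
    & (forall i t, phi (c i t) = f i (psi t)) /\ (forall t, t = \sum_i c i t *: x i)].

(** The inverse of the lift of [psi] rebuilds y as the sum of the f_i(y) (x) x_i; the two are
    mutually inverse because f_i restricts to c_i along [psi]. *)
Lemma const_form_bc X E : const_form X E -> diff_iso (bc_diff X) E.
Proof.
move=> [psi [I [x [c [f [ph pc [fl fd] dual [cE cdual]]]]]]].
have lh := bc_lift_hom ph.
have pureD r : {morph bc_pure (A := X) phi r : a b / a + b} by move=> a b; apply: bc_pureDr.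
exists (bc_lift psi).
  split=> // t; elim/bc_ind: t => [|t t' IHt IHt'|r a].
  - by rewrite !(der0, hom0 lh).
  - by rewrite !(derD, homD lh) IHt IHt'.
  - by rewrite [X in bc_lift _ X]bc_derE !(bc_liftE ph) dderZ pc scaler0 addr0.
have p0r r : bc_pure phi r (0 : X) = 0.
  by apply: (addIr (bc_pure phi r 0)); rewrite -bc_pureDr addr0 add0r.
have p0l a : bc_pure phi 0 (a : X) = 0.
  by apply: (addIr (bc_pure phi 0 a)); rewrite -bc_pureDl addr0 add0r.
exists (fun y => \sum_i bc_pure phi (f i y) (x i)) => [t|y].
  elim/bc_ind: t => [|t t' IHt IHt'|r a].
  - by rewrite (hom0 lh) big1 // => i _; rewrite scalar_fun0.
  - rewrite (homD lh) -{2}IHt -{2}IHt' -big_split; apply: eq_bigr => i _ /=.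
    by rewrite scalar_funD // bc_pureDl.
  - rewrite bc_liftE // {2}(cdual a) (big_morph _ (pureD r) (p0r r)).
    by apply: eq_bigr => i _; rewrite scalar_funZ // bc_pureZ cE mulrC.
rewrite (hom_sum _ lh) [RHS]dual; apply: eq_bigr => i _; exact: bc_liftE.
Qed.

(** Since f_i commutes with the derivations, the coordinates of a constant of E are constants of R,
    so the constant is the image of an S-combination of the x_i. *)
Lemma const_form_const X E : const_form X E -> alg_iso X (const_alg E).
Proof.
move=> [psi [I [x [c [f [ph pc [fl fd] dual [cE cdual]]]]]]].
have [g gE] := choice (fun t => const_alg_lift (pc t)).
exists g.
  split=> [k s t|].
    apply: const_alg_val_inj; rewrite gE (homD ph) (homZ ph) -!gE.
    by rewrite (homD (@const_alg_val_hom E)) (homZ (@const_alg_val_hom E)).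
  split=> [|s t]; apply: const_alg_val_inj.
    by rewrite gE (hom1 ph) (hom1 (@const_alg_val_hom E)).
  by rewrite gE (homM ph) -!gE (homM (@const_alg_val_hom E)).
have /choice[d dE] (p : I * const_alg E) : exists c : S, phi c = f p.1 (const_alg_val p.2).
  by apply: const_lift; rewrite -fd const_alg_valP scalar_fun0.
exists (fun y => \sum_i d (i, y) *: x i) => [t|y].
  rewrite [RHS]cdual; apply: eq_bigr => i _; congr (_ *: _); apply: val_inj.
  by rewrite [LHS]dE gE -cE.
apply: const_alg_val_inj; rewrite gE (hom_sum _ ph) [RHS]dual.
by apply: eq_bigr => i _; rewrite (homZ ph) -(dE (i, y)).
Qed.

Lemma const_form_isor X E F : diff_iso E F -> const_form X E -> const_form X F.
Proof.
move=> [h [hh hd] [h' hK h'K]] [psi [I [x [c [f [ph pc [fl fd] dual [cE cdual]]]]]]].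
have [h'h h'd] : diff_hom h' by apply: inv_diff hK h'K.
exists (h \o psi), I, x, c, (fun i => f i \o h').
split=> [|t||y|] /=.
- split=> [k s t|].
    by rewrite /= (homD ph) (homZ ph) (homD hh) (homZ hh).
  by split=> [|s t] /=; rewrite ?(hom1 ph) ?(hom1 hh) // (homM ph) (homM hh).
- by rewrite -hd pc (hom0 hh).
- split=> [i k s t|i y] /=.
    by rewrite (homD h'h) (homZ h'h) (scalar_funD (fl i)) (scalar_funZ (fl i)).
  by rewrite h'd fd.
- rewrite -{1}(h'K y) {1}(dual (h' y)) (hom_sum _ hh).
  by apply: eq_bigr => i _; rewrite (homZ hh).
- by split=> [i t|t]; [rewrite hK; exact: cE | exact: cdual].
Qed.

Lemma const_form_isol X Y E : alg_iso Y X -> const_form X E -> const_form Y E.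
Proof.
move=> [h hh [h' hK h'K]] [psi [I [x [c [f [ph pc [fl fd] dual [cE cdual]]]]]]].
have h'h : alg_hom h' by apply: inv_hom hK h'K.
exists (psi \o h), I, (h' \o x), (fun i => c i \o h), f.
split=> [|t|//|y|].
- exact: (comp_hom ph hh).
- exact: pc.
- by rewrite {1}(dual y); apply: eq_bigr => i _; rewrite /= h'K.
- split=> [i t|t]; first exact: cE.
  rewrite -{1}(hK t) {1}(cdual (h t)) (hom_sum _ h'h).
  by apply: eq_bigr => i _; rewrite (homZ h'h).
Qed.

Lemma const_form_tensor X Y E F :
  const_form X E -> const_form Y F -> const_form (tensor_alg X Y) (tensor_diff E F).
Proof.
move=> [psi [I [x [c [f [ph pc [fl fd] dual [cE cdual]]]]]]].
move=> [chi [J [y [d [g [qh qc [gl gd] dual' [dE ddual]]]]]]].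
pose EF := rescale phi (tensor_alg E F).
have lh : @alg_hom S X EF (fun s => psi s *t (1 : F)).
  have ih := inl_hom E F; split=> [k s t|].
    by rewrite (homD ph) (homZ ph) (homD ih) (homZ ih).
  by split=> [|s t]; rewrite ?(hom1 ph) ?(hom1 ih) // (homM ph) (homM ih).
have rh : @alg_hom S Y EF (fun s => (1 : E) *t chi s).
  have ih := inr_hom E F; split=> [k s t|].
    by rewrite (homD qh) (homZ qh) (homD ih) (homZ ih).
  by split=> [|s t]; rewrite ?(hom1 qh) ?(hom1 ih) // (homM qh) (homM ih).
have th := tpair_hom lh rh (fun a b => inlr_comm (psi a) (chi b)).
set tp := tpair _ _ in th.
have tpE a b : tp (a *t b) = psi a *t chi b.
  by rewrite /tp tpairE //; exact: (inlrE (psi a) (chi b)).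
exists tp, (I * J)%type, (fun p => x p.1 *t y p.2), (fun p => tfun (c p.1) (d p.2)),
  (fun p => tfun (f p.1) (g p.2)).
(* Linearity of the coordinates of X is inherited from E because S embeds in R. *)
have cl i : scalar (c i).
  move=> k s t; apply: val_inj; rewrite [LHS]cE (homD ph) (homZ ph).
  by rewrite (scalar_funD (fl i)) (scalar_funZ (fl i)) -!cE.
have dl i : scalar (d i).
  move=> k s t; apply: val_inj; rewrite [LHS]dE (homD qh) (homZ qh).
  by rewrite (scalar_funD (gl i)) (scalar_funZ (gl i)) -!dE.
have fgl p : scalar (tfun (f p.1) (g p.2)) by apply: tfun_scalar.
have cdl p : scalar (tfun (c p.1) (d p.2)) by apply: tfun_scalar.
split=> [//|t||z|].
- elim/tensor_ind: t => [|t t' IHt IHt'|a b].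
  + by rewrite (hom0 th) (der0 (dder (tensor_diff E F))).
  + by rewrite (homD th) [LHS](derD (dder (tensor_diff E F))) IHt IHt' addr0.
  + by rewrite tpE [LHS]tensor_derE pc qc tpure0l tpure0r addr0.
- split=> // p z; elim/tensor_ind: z => [|t t' IHt IHt'|a b].
  + by rewrite (der0 (dder (tensor_diff E F))) (scalar_fun0 (fgl p)) der0.
  + rewrite (derD (dder (tensor_diff E F))) !(scalar_funD (fgl p)) IHt IHt' derD.
    by [].
  + rewrite [X in tfun _ _ X]tensor_derE (scalar_funD (fgl p)) !tfunE //.
    by rewrite fd gd derM.
- elim/tensor_ind: z => [|t t' IHt IHt'|a b].
  + by rewrite big1 // => p _; rewrite (scalar_fun0 (fgl p)) scale0r.
  + rewrite {1}IHt {1}IHt' -big_split; apply: eq_bigr => p _ /=.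
    by rewrite (scalar_funD (fgl p)) scalerDl.
  + rewrite {1}(dual a) {1}(dual' b) tpure_suml.
    rewrite -(pair_bigA _ (fun i j => tfun (f i) (g j) (a *t b) *: tp (x i *t y j))) /=.
    apply: eq_bigr => i _; rewrite tpure_sumr; apply: eq_bigr => j _.
    by rewrite tfunE // tpE -scale_tpure -tpureZ -scale_tpure scalerA.
- split=> [p t|t].
    elim/tensor_ind: t => [|t t' IHt IHt'|a b].
    + by rewrite (hom0 th) (scalar_fun0 (fgl p)) (scalar_fun0 (cdl p)) rmorph0.
    + rewrite (homD th) (scalar_funD (fgl p)) (scalar_funD (cdl p)) rmorphD.
      by rewrite IHt IHt'.
    + by rewrite tpE !tfunE // rmorphM cE dE.
  elim/tensor_ind: t => [|t t' IHt IHt'|a b].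
  + by rewrite big1 // => p _; rewrite (scalar_fun0 (cdl p)) scale0r.
  + rewrite {1}IHt {1}IHt' -big_split; apply: eq_bigr => p _ /=.
    by rewrite (scalar_funD (cdl p)) scalerDl.
  + rewrite {1}(cdual a) {1}(ddual b) tpure_suml.
    rewrite -(pair_bigA _ (fun i j => tfun (c i) (d j) (a *t b) *: (x i *t y j))) /=.
    apply: eq_bigr => i _; rewrite tpure_sumr; apply: eq_bigr => j _.
    by rewrite tfunE // -scale_tpure -tpureZ -scale_tpure scalerA.
Qed.

End ConstantForms.

(** * Tensor factors of Azumaya algebras *)

Section TensorFactor.
Variables (S : comPzRingType) (A B : pzAlg S) (lam : B -> S).
Hypotheses (laml : scalar lam) (lam1 : lam 1 = 1).
Notation AB := (tensor_alg A B).

Definition tproj (t : AB) : A := tlift (fun (a : A) (b : B) => lam b *: a) t.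

Let tproj_bal : balanced (fun (a : A) (b : B) => lam b *: a).
Proof.
split=> [x x' y|x y y'|k x y].
- exact: scalerDr.
- by rewrite (scalar_funD laml) scalerDl.
- by rewrite (scalar_funZ laml) scalerA mulrC.
Qed.

Lemma tprojE (a : A) (b : B) : tproj (a *t b) = lam b *: a.
Proof. exact: tliftE. Qed.

Lemma tproj_linear : linear tproj.
Proof.
move=> k t u; rewrite [LHS]tliftD //; congr (_ + _).
elim/tensor_ind: t => [|t t' IHt IHt'|x y].
- by rewrite scaler0 /tproj tlift0 // scaler0.
- by rewrite scalerDr [LHS]tliftD // [in RHS]/tproj tliftD // IHt IHt' scalerDr.
- by rewrite [X in tlift _ X](scale_tpure k x y) tprojE [LHS]tprojE !scalerA mulrC.
Qed.

Lemma tprojD : {morph tproj : t u / t + u}.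
Proof. by move=> t u; apply: tliftD. Qed.

Lemma tprojK (a : A) : tproj (a *t (1 : B)) = a.
Proof. by rewrite tprojE lam1 scale1r. Qed.

(** First of three lifts, [contr_in], [contr2] and [contr], which define the contraction sending (a
    (x) b) (x) (a' (x) b') to lam(b b') a (x) a'. It turns preimages under the sandwich map of A (x)
    B into preimages for A. *)
Let contr_in (a : A) (b : B) (m : AB) : tensor A A :=
  tlift (fun (a' : A) (b' : B) => lam (b * b') *: (a *t a')) m.

Let contr_in_bal (a : A) (b : B) :
  balanced (fun (a' : A) (b' : B) => lam (b * b') *: (a *t a')).
Proof.
split=> [x x' y|x y y'|k x y].
- by rewrite tpureDr scalerDr.
- by rewrite mulrDr (scalar_funD laml) scalerDl.
- by rewrite -palgAr (scalar_funZ laml) -tpureZ -scale_tpure scalerA mulrC.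
Qed.

Let contr_inE a b a' b' : contr_in a b (a' *t b') = lam (b * b') *: (a *t a').
Proof. exact: tliftE. Qed.

Let contr_out_bal (m : AB) : balanced (fun (a : A) (b : B) => contr_in a b m).
Proof.
split=> [x x' y|x y y'|k x y]; rewrite /contr_in -?tlift_add; apply: eq_tlift => a' b'.
- by rewrite tpureDl scalerDr.
- by rewrite mulrDl (scalar_funD laml) scalerDl.
- by rewrite -palgAl (scalar_funZ laml) -scale_tpure scalerA mulrC.
Qed.

Let contr2 (m m' : AB) : tensor A A := tlift (fun (a : A) (b : B) => contr_in a b m') m.

Let contr2E a b m : contr2 (a *t b) m = contr_in a b m.
Proof. exact: tliftE. Qed.

Let contr2Dl m1 m2 m : contr2 (m1 + m2) m = contr2 m1 m + contr2 m2 m.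
Proof. exact: tliftD. Qed.
Let contr2Dr m m1 m2 : contr2 m (m1 + m2) = contr2 m m1 + contr2 m m2.
Proof.
by rewrite /contr2 -tlift_add; apply: eq_tlift => a b; apply: tliftD.
Qed.
Let contr20l m : contr2 0 m = 0.
Proof. by apply: (addIr (contr2 0 m)); rewrite -contr2Dl addr0 add0r. Qed.
Let contr20r m : contr2 m 0 = 0.
Proof. by apply: (addIr (contr2 m 0)); rewrite -contr2Dr addr0 add0r. Qed.

Let contr2_bal : balanced contr2.
Proof.
split=> [x x' y|x y y'|k x y]; rewrite ?contr2Dl ?contr2Dr //.
elim/tensor_ind: x => [|t t' IHt IHt'|a b].
- by rewrite scaler0 !contr20l.
- by rewrite scalerDr !contr2Dl IHt IHt'.
elim/tensor_ind: y => [|t t' IHt IHt'|a' b'].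
- by rewrite scaler0 !contr20r.
- by rewrite scalerDr !contr2Dr IHt IHt'.
rewrite [X in contr2 X _](scale_tpure k a b) [X in _ = contr2 _ X](scale_tpure k a' b').
by rewrite !contr2E !contr_inE tpureZ.
Qed.

Let contr (t : tensor AB AB) : tensor A A := tlift contr2 t.

Let contrE (a a' : A) (b b' : B) :
  contr ((a *t b : AB) *t (a' *t b' : AB)) = lam (b * b') *: (a *t a').
Proof. by rewrite /contr tliftE // contr2E contr_inE. Qed.

Let contrD t u : contr (t + u) = contr t + contr u.
Proof. exact: tliftD. Qed.
Let contr0 : contr 0 = 0.
Proof. exact: tlift0. Qed.

Let sandwichZ (C : pzAlg S) k (t : tensor C C) x : sandwich (k *: t) x = k *: sandwich t x.
Proof.
elim/tensor_ind: t => [|t t' IHt IHt'|a b].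
- by rewrite scaler0 sandwich0l scaler0.
- by rewrite scalerDr !sandwichDl IHt IHt' scalerDr.
- by rewrite scale_tpure !sandwichE -!palgAl.
Qed.

Let tproj0 : tproj 0 = 0.
Proof. exact: tlift0. Qed.

Let sandwich_contr t x : sandwich (contr t) x = tproj (sandwich t (x *t (1 : B) : AB)).
Proof.
elim/tensor_ind: t => [|t t' IHt IHt'|m m'].
- by rewrite contr0 !sandwich0l tproj0.
- by rewrite contrD !sandwichDl IHt IHt' tprojD.
elim/tensor_ind: m => [|t t' IHt IHt'|a b].
- by rewrite tpure0l contr0 !sandwich0l tproj0.
- by rewrite tpureDl contrD !sandwichDl IHt IHt' tprojD.
elim/tensor_ind: m' => [|t t' IHt IHt'|a' b'].
- by rewrite tpure0r contr0 !sandwich0l tproj0.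
- by rewrite tpureDr contrD !sandwichDl IHt IHt' tprojD.
rewrite contrE sandwichZ !sandwichE [X in tproj (X * _)]mul_tpure.
by rewrite [X in tproj X]mul_tpure tprojE mulr1.
Qed.

Let contr_shuffle s : contr (tshuffle s ((1 : B) *t (1 : B))) = s.
Proof.
elim/tensor_ind: s => [|t t' IHt IHt'|a a'].
- by rewrite tshuffle0l contr0.
- by rewrite tshuffleDl contrD IHt IHt'.
- by rewrite tshuffleE contrE mulr1 lam1 scale1r.
Qed.

Let sandwich_shuffle s (a : A) (b : B) :
  sandwich (tshuffle s ((1 : B) *t (1 : B))) (a *t b : AB) = sandwich s a *t b.
Proof.
elim/tensor_ind: s => [|t t' IHt IHt'|x y].
- by rewrite tshuffle0l !sandwich0l tpure0l.
- by rewrite tshuffleDl !sandwichDl IHt IHt' tpureDl.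
- rewrite tshuffleE !sandwichE [X in X * _]mul_tpure [LHS]mul_tpure.
  by rewrite mul1r mulr1.
Qed.

(** By [tproj], A is a module retract of A (x) B, so finite generation and projectivity descend. An
    endomorphism psi of A is extended to psi (x) 1, whose preimage is contracted to one of psi. It
    is unique, since s is recovered by [contr] from its shuffle with 1 (x) 1, which is a preimage of
    psi (x) 1. *)
Lemma azumaya_tensor_factor : is_azumaya AB -> is_azumaya A.
Proof.
move=> [[I [g gE]] projAB fAB bij].
have tl := tproj_linear.
have inl_lin : linear (fun a : A => a *t (1 : B) : AB) := (inl_hom A B).1.
split.
- exists I, (tproj \o g) => x; have [c cE] := gE (x *t (1 : B)).
  exists c; rewrite -{1}(tprojK x) cE.
  rewrite (big_morph _ tprojD tproj0); apply: eq_bigr => i _ /=.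
  by have := tl (c i) (g i) 0; rewrite addr0 tproj0 addr0.
- move=> M N p f psurj.
  have fl : linear (fun t : AB => f (tproj t)) by move=> k t u; rewrite tl linearP.
  have [h hE] := projAB _ _ p (lin_pack fl) psurj.
  have hl : linear (fun a : A => h (a *t (1 : B))).
    by move=> k x y; rewrite inl_lin linearP.
  by exists (lin_pack hl) => x; rewrite /= hE /= tprojK.
- move=> k kA; apply: fAB => t.
  rewrite -[t]mul1r palgAl -[X in k *: X](tpure11 A B).
  rewrite [X in X * _](scale_tpure k (1 : A) (1 : B)) kA tpure0l.
  exact: mul0r.
- move=> psi.
  have psi0 : balanced (fun (a : A) (b : B) => psi a *t b : AB).
    split=> [x x' y|x y y'|k x y]; first by rewrite linearD tpureDl.
      by rewrite tpureDr.
    by rewrite linearZ /= tpureZ.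
  pose Psi (t : AB) : AB := tlift (fun (a : A) (b : B) => psi a *t b) t.
  have PsiE (a : A) (b : B) : Psi (a *t b) = psi a *t b by apply: tliftE.
  have PsiD t u : Psi (t + u) = Psi t + Psi u by apply: tliftD.
  have Psi00 : Psi 0 = 0 by apply: tlift0.
  have Psil : linear Psi.
    move=> k t u; rewrite PsiD; congr (_ + _).
    elim/tensor_ind: t => [|t t' IHt IHt'|a b].
    + by rewrite scaler0 Psi00 scaler0.
    + by rewrite scalerDr !PsiD IHt IHt' scalerDr.
    + rewrite [X in Psi X](scale_tpure k a b) !PsiE linearZ /=.
      by apply/esym; exact: scale_tpure.
  have [t [tE tU]] := bij (lin_pack Psil).
  exists (contr t); split=> [x|s sE].
    by rewrite sandwich_contr tE /= PsiE tprojK.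
  rewrite (tU (tshuffle s ((1 : B) *t (1 : B)))) ?contr_shuffle //.
  elim/tensor_ind => [|u u' IHu IHu'|a b].
  + rewrite [RHS]Psi00; set v := tshuffle _ _.
    by apply: (addIr (sandwich v 0)); rewrite -sandwichDr addr0 add0r.
  + by rewrite sandwichDr IHu IHu' [RHS]PsiD.
  + by rewrite sandwich_shuffle sE [RHS]PsiE.
Qed.

End TensorFactor.

(** The functional [lam] on B is the (0, 0) entry of the image of 1 (x) b; positivity of n provides
    this entry. *)
Lemma azumaya_factor_mx (S : comPzRingType) (A B : pzAlg S) n :
  (0 < n)%N -> alg_iso (tensor_alg A B) (mx_alg S n) -> is_azumaya A.
Proof.
case: n => // n _ iso; have [h hh _] := iso.
have rh := inr_hom A B.
apply: (@azumaya_tensor_factor S A B (fun b => (h ((1 : A) *t b) : 'M_n.+1) 0 0)).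
- by move=> k x y; rewrite (homD rh) (homZ rh) (homD hh) (homZ hh) !mxE.
- by rewrite (hom1 rh) (hom1 hh) mxE.
- exact: (alg_iso_azumaya (alg_iso_sym iso)) (mx_azumaya S (ltn0Sn n)).
Qed.

(** * Differential algebras spanned by constants *)

Section ConstantBasis.
Variables (R : comPzRingType) (D : derivation R).
Notation S := (constants D).
Notation phi := (const_incl D).
Implicit Types (X Y : pzAlg S) (E F : diffAlg D).

(** Equivalently, E is a direct summand, as a differential module, of a free module of finite rank
    with entrywise derivation. *)
Definition const_basis E : Prop :=
  exists (I : finType) (e : I -> E) (f : I -> E -> R),
  [/\ forall i, dder E (e i) = 0, forall i, scalar (f i),
      forall i y, f i (dder E y) = D (f i y)
    & forall y, y = \sum_i f i y *: e i].

Lemma const_basis_form E : const_basis E -> const_form (const_alg E) E.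
Proof.
move=> [I [e [f [ec fl fd dual]]]].
have [x xE] := choice (fun i => const_alg_lift (ec i)).
have /choice[d dE] (p : I * const_alg E) : exists c : S, phi c = f p.1 (const_alg_val p.2).
  by apply: const_lift; rewrite -fd const_alg_valP scalar_fun0.
exists (@const_alg_val _ _ E), I, x, (fun i t => d (i, t)), f.
split=> [|t|//|y|].
- exact: const_alg_val_hom.
- exact: const_alg_valP.
- by rewrite {1}(dual y); apply: eq_bigr => i _; rewrite xE.
- split=> [i t|t]; first exact: dE.
  apply: const_alg_val_inj; rewrite (hom_sum _ (@const_alg_val_hom _ _ E)) [LHS]dual.
  apply: eq_bigr => i _.
  by rewrite (homZ (@const_alg_val_hom _ _ E)) xE -(dE (i, t)).
Qed.

(** Both are isomorphic to the constants of E. *)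
Lemma const_form_unique X Y E : const_form X E -> const_form Y E -> alg_iso X Y.
Proof.
move=> /const_form_const fX /const_form_const/alg_iso_sym fY.
exact: alg_iso_trans fX fY.
Qed.

Lemma const_form_mx n : const_form (mx_alg S n) (mx_diff D n).
Proof.
exists (fun X : 'M[S]_n => map_mx phi X), ('I_n * 'I_n)%type,
  (fun p => delta_mx p.1 p.2), (fun p (X : 'M[S]_n) => X p.1 p.2),
  (fun p (X : 'M[R]_n) => X p.1 p.2).
split.
- split=> [k X Y|]; first by apply/matrixP => i j; rewrite !mxE rmorphD rmorphM.
  split=> [|X Y]; first exact: map_mx1.
  exact: map_mxM.
- by move=> t; apply/matrixP => i j; rewrite !mxE der_const.
- by split=> [p k X Y|p X]; rewrite !mxE.
- move=> y; rewrite -(pair_bigA _ (fun i j =>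
    (y : 'M[R]_n) i j *: (map_mx phi (delta_mx i j) : mx_alg R n))) /=.
  rewrite {1}[y](matrix_sum_delta (y : 'M[R]_n)).
  apply: eq_bigr => i _; apply: eq_bigr => j _; congr (_ *: _).
  by apply/matrixP => k l; rewrite !mxE; case: (_ && _).
- split=> [p t|t]; first by rewrite mxE.
  rewrite -(pair_bigA _ (fun i j => (t : 'M[S]_n) i j *: (delta_mx i j : mx_alg S n))) /=.
  exact: (matrix_sum_delta (t : 'M[S]_n)).
Qed.

(** A dual basis of X extends R-linearly, and the extended functionals commute with the derivations
    because the values phi(f_i(x)) are constants. Together with uniqueness of forms this makes base
    change injective. *)
Lemma const_form_base_change X : is_azumaya X -> const_form X (bc_diff X).
Proof.
move=> /azumayaP[I [a [f [_ [_ [fl dual _ _ _]]]]]].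
have fs i : scalar (f i) by move=> k x y; rewrite fl.
pose h i (t : bc_alg phi X) : R :=
  tlift (fun (r : restr_alg phi) (x : X) => (r : R) * phi (f i x)) t.
have bal i : balanced (fun (r : restr_alg phi) (x : X) => (r : R) * phi (f i x)).
  split=> [r r' x|r x x'|k r x].
  - exact: mulrDl.
  - by rewrite (scalar_funD (fs i)) rmorphD mulrDr.
  - by rewrite (scalar_funZ (fs i)) rmorphM mulrCA mulrA.
have hD i t t' : h i (t + t') = h i t + h i t' by apply: tliftD.
have h0 i : h i 0 = 0 by apply: (addIr (h i 0)); rewrite -hD addr0 add0r.
have hE i r x : h i (bc_pure phi r x) = r * phi (f i x) by apply: tliftE.
have p0r r : bc_pure phi r (0 : X) = 0.
  by apply: (addIr (bc_pure phi r 0)); rewrite -bc_pureDr addr0 add0r.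
exists (bc_pure phi 1), I, a, f, h; split.
- split=> [k x y|].
    by rewrite bc_pureDr bc_pureZ -scale_bc_pure.
  by split=> [|x y] //; rewrite [RHS]mul_bc_pure mulr1.
- move=> t; rewrite [LHS]bc_derE der1.
  by apply: (addIr (bc_pure phi 0 t)); rewrite -bc_pureDl addr0 add0r.
- split=> [i k t u|i t].
    rewrite hD; congr (_ + _); elim/bc_ind: t => [|t t' IHt IHt'|r x].
    + by rewrite scaler0 h0 mulr0.
    + by rewrite scalerDr !hD IHt IHt' mulrDr.
    + by rewrite scale_bc_pure !hE mulrA.
  elim/bc_ind: t => [|t t' IHt IHt'|r x].
  + by rewrite der0 h0 der0.
  + by rewrite derD !hD IHt IHt' derD.
  + by rewrite [X in h i X]bc_derE !hE derM der_const mulr0 addr0.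
- elim/bc_ind => [|t t' IHt IHt'|r x].
  + by rewrite big1 // => i _; rewrite h0 scale0r.
  + rewrite {1}IHt {1}IHt' -big_split; apply: eq_bigr => i _ /=.
    by rewrite hD scalerDl.
  + rewrite {1}(dual x) (big_morph _ (bc_pureDr phi r) (p0r r)).
    by apply: eq_bigr => i _; rewrite hE bc_pureZ scale_bc_pure mulr1 mulrC.
- by split=> // i t; rewrite hE mul1r.
Qed.

(* If A (x) B is M_n(R), the entry at (0, 0) restricts to a differential functional
   on B with value 1 at 1, so A is a direct summand of M_n(R) as a differential module. *)
Lemma const_basis_factor_mx E F n : (0 < n)%N ->
  diff_iso (tensor_diff E F) (mx_diff D n) -> const_basis E.
Proof.
case: n => // n _ [h hd0 [h' hK h'K]].
have [h'h h'd] : diff_hom h' by apply: inv_diff hK h'K.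
have [hh hd] := hd0.
have rh := inr_hom E F; have lh := inl_hom E F.
pose lam (y : F) : R := (h ((1 : E) *t y) : 'M[R]_n.+1) 0 0.
have laml : scalar lam.
  by move=> k x y; rewrite /lam (homD rh) (homZ rh) (homD hh) (homZ hh) !mxE.
have lam1 : lam 1 = 1 by rewrite /lam (hom1 rh) (hom1 hh) mxE.
have lamd y : lam (dder F y) = D (lam y).
  by rewrite /lam (inr_diff E F).2 hd mxE.
have pl := @tproj_linear R E F lam laml.
have p0 : tproj lam (0 : tensor_diff E F) = 0.
  by have := pl (-1) 0 0; rewrite !scaleN1r oppr0 addr0 addNr.
have pD := @tprojD R E F lam laml.
have pd t : tproj lam (dder (tensor_diff E F) t) = dder E (tproj lam t).
  elim/tensor_ind: t => [|t t' IHt IHt'|x y].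
  - by rewrite der0 p0 der0.
  - by rewrite derD !pD IHt IHt' derD.
  - rewrite [X in tproj _ X]tensor_derE pD !tprojE // lamd dderZ addrC.
    by [].
(* The generators are the projections of the matrix units, constant because matrix units are; the
   coordinates of x are the matrix entries of x (x) 1. *)
exists ('I_n.+1 * 'I_n.+1)%type, (fun p => tproj lam (h' (delta_mx p.1 p.2))),
  (fun p x => (h (x *t (1 : F)) : 'M[R]_n.+1) p.1 p.2).
split=> [p|p k x y|p y|y].
- rewrite -pd -h'd (_ : dder _ _ = 0) ?(hom0 h'h) ?p0 //.
  by apply/matrixP => i j; rewrite !mxE; case: (_ && _); rewrite ?der1 ?der0.
- by rewrite (homD lh) (homZ lh) (homD hh) (homZ hh) !mxE.
- by rewrite (inl_diff E F).2 hd mxE.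
- rewrite -{1}(tprojK laml lam1 y) -{1}(hK (y *t (1 : F))).
  set M := h _; rewrite {1}[M](matrix_sum_delta (M : 'M[R]_n.+1)).
  rewrite -(pair_bigA _ (fun i j =>
    (M : 'M[R]_n.+1) i j *: tproj lam (h' (delta_mx i j : mx_alg R n.+1)))) /=.
  rewrite (hom_sum _ h'h) (big_morph _ pD p0); apply: eq_bigr => i _.
  rewrite (hom_sum _ h'h) (big_morph _ pD p0); apply: eq_bigr => j _.
  rewrite (homZ h'h).
  by have := pl ((M : 'M[R]_n.+1) i j) (h' (delta_mx i j : mx_alg R n.+1)) 0; rewrite p0 !addr0.
Qed.

(** By symmetry F has a constant basis too, so the tensor product of the two algebras of constants
    is a form of M_n(R). So is M_n(S); uniqueness of forms exhibits the constants of E as a tensor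
    factor of M_n(S). *)
Lemma const_alg_azumaya E F n : (0 < n)%N ->
    diff_iso (tensor_diff E F) (mx_diff D n) ->
  is_azumaya (const_alg E) /\ const_form (const_alg E) E.
Proof.
move=> n_gt0 iso.
have fE := const_basis_form (const_basis_factor_mx n_gt0 iso).
have fF := const_basis_form (const_basis_factor_mx n_gt0
  (diff_iso_trans (diff_iso_tensorC F E) iso)).
split=> //; apply: (azumaya_factor_mx n_gt0 (B := const_alg F)).
apply: const_form_unique (const_form_mx n).
exact: const_form_isor iso (const_form_tensor fE fF).
Qed.

End ConstantBasis.

(** * An Azumaya subalgebra and its centralizer *)

Section DoubleCentralizer.
Variables (S : comPzRingType) (A M : pzAlg S) (h : A -> M).
Hypotheses (hh : alg_hom h) (azA : is_azumaya A).

Definition cent_pred : {pred M} := [pred m | `[< forall a, h a * m = m * h a >]].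

Fact cent_ring_closed : subring_closed cent_pred.
Proof.
split=> [|x y /asboolP cx /asboolP cy|x y /asboolP cx /asboolP cy]; apply/asboolP => a.
- by rewrite mulr1 mul1r.
- by rewrite mulrBr mulrBl cx cy.
- by rewrite mulrA cx -mulrA cy mulrA.
Qed.

Fact cent_scale_closed k x : x \in cent_pred -> k *: x \in cent_pred.
Proof.
by move=> /asboolP cx; apply/asboolP => a; rewrite -palgAr cx palgAl.
Qed.

Definition centralizer : pzAlg S := sub_alg (Subalg cent_ring_closed cent_scale_closed).

Definition bimod_act (t : tensor A A) (m : M) : M := tlift (fun x y : A => h x * m * h y) t.

Let bal m : balanced (fun x y : A => h x * m * h y).
Proof.
split=> [x x' y|x y y'|k x y].
- by rewrite (homD hh) !mulrDl.
- by rewrite (homD hh) mulrDr.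
- by rewrite !(homZ hh) -!palgAl -palgAr.
Qed.

Let actE x y m : bimod_act (x *t y) m = h x * m * h y.
Proof. exact: tliftE. Qed.
Let actD t u m : bimod_act (t + u) m = bimod_act t m + bimod_act u m.
Proof. exact: tliftD. Qed.
Let act0 m : bimod_act 0 m = 0.
Proof. exact: tlift0. Qed.
Let actDr t m m' : bimod_act t (m + m') = bimod_act t m + bimod_act t m'.
Proof.
rewrite /bimod_act -tlift_add; apply: eq_tlift => x y.
by rewrite mulrDr mulrDl.
Qed.
Let act_mull a t m : bimod_act (a *t (1 : A) * t) m = h a * bimod_act t m.
Proof.
elim/tensor_ind: t => [|t u IHt IHu|b c]; rewrite ?mulr0 ?act0 ?mulr0 //.
  by rewrite mulrDr !actD IHt IHu mulrDr.
by rewrite mul_tpure !actE mul1r (homM hh) !mulrA.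
Qed.
Let act_mulr a t m : bimod_act (t * ((1 : A) *t a)) m = bimod_act t m * h a.
Proof.
elim/tensor_ind: t => [|t u IHt IHu|b c]; rewrite ?mul0r ?act0 ?mul0r //.
  by rewrite mulrDl !actD IHt IHu mulrDl.
by rewrite mul_tpure !actE mulr1 (homM hh) !mulrA.
Qed.
Let act_hom t a m : (forall b, h b * m = m * h b) ->
  bimod_act t (h a * m) = h (sandwich t a) * m.
Proof.
move=> cm; elim/tensor_ind: t => [|t u IHt IHu|b c].
- by rewrite act0 sandwich0l (hom0 hh) mul0r.
- by rewrite actD sandwichDl (homD hh) mulrDl IHt IHu.
- by rewrite actE sandwichE !(homM hh) -!mulrA cm.
Qed.

(* The preimages u i of the coordinate forms under the sandwich map send M into the
   centralizer of A, and m = \sum_i a_i (u_i m). *)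
Lemma double_centralizer : alg_iso (tensor_alg A centralizer) M.
Proof.
have [_ _ _ bij] := azA.
have [I [a [f [u [_ [fl dual _ fu fid]]]]]] := azumaya_data_nec azA.
have fs i : scalar (f i) by move=> k x y; rewrite fl.
(* Both sides are preimages of the endomorphism sending x to f_i(x) b, and preimages under the
   sandwich map are unique. *)
have u_comm i b : b *t (1 : A) * u i = u i * ((1 : A) *t b).
  have bl : linear (fun x : A => f i x *: b).
    by move=> k x y; rewrite fl scalerDl scalerA.
  have [t [_ tU]] := bij (lin_pack bl).
  transitivity t; [apply/esym|]; apply: tU => x /=.
    by rewrite sandwich_mull fu -palgAr mulr1.
  have sr v : sandwich (v * ((1 : A) *t b)) x = sandwich v x * b.
    elim/tensor_ind: v => [|v w IHv IHw|y z].
    - by rewrite mul0r !sandwich0l mul0r.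
    - by rewrite mulrDl !sandwichDl IHv IHw mulrDl.
    - by rewrite mul_tpure !sandwichE mulr1 mulrA.
  by rewrite sr fu -palgAl mul1r.
have um_cent i m : bimod_act (u i) m \in cent_pred.
  by apply/asboolP => b; rewrite -act_mull -act_mulr u_comm.
pose c i m : centralizer :=
  sub_in (P := Subalg cent_ring_closed cent_scale_closed) (um_cent i m).
have cE i m : sub_incl (c i m) = bimod_act (u i) m by [].
have ih : alg_hom (fun x : centralizer => sub_incl x : M) by apply: sub_incl_hom.
have comm b (x : centralizer) : h b * sub_incl x = sub_incl x * h b.
  by have /asboolP := sub_inclP x; apply.
have th := tpair_hom hh ih comm.
have fid1 : \sum_i a i *t (1 : A) * u i = 1.
  by rewrite -[RHS]tpure11 -fid; apply: eq_bigr => i _; rewrite mulr1.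
exists (tpair h (fun x : centralizer => sub_incl x)) => //.
exists (fun m => \sum_i a i *t c i m) => [t|m].
  have incl_inj := @sub_incl_inj S M (Subalg cent_ring_closed cent_scale_closed).
  have cD i m m' : c i (m + m') = c i m + c i m'.
    by apply: incl_inj; rewrite (homD ih) !cE actDr.
  have c0 i : c i 0 = 0 by apply: (addIr (c i 0)); rewrite -cD addr0 add0r.
  elim/tensor_ind: t => [|t t' IHt IHt'|x y].
  - by rewrite (hom0 th) big1 // => i _; rewrite c0 tpure0r.
  - rewrite (homD th) -{2}IHt -{2}IHt' -big_split; apply: eq_bigr => i _ /=.
    by rewrite cD tpureDr.
  - rewrite tpairE // {2}(dual x) tpure_suml; apply: eq_bigr => i _.
    rewrite tpureZ; congr (_ *t _); apply: incl_inj.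
    rewrite cE act_hom; last by move=> b; apply: comm.
    by rewrite fu (homZ hh) (hom1 hh) -palgAl mul1r (homZ ih).
rewrite (hom_sum _ th).
transitivity (bimod_act (\sum_i a i *t (1 : A) * u i) m).
  rewrite (big_morph (bimod_act^~ m) (fun t v => actD t v m) (act0 m)).
  by apply: eq_bigr => i _; rewrite tpairE // cE act_mull.
by rewrite fid1 -tpure11 actE (hom1 hh) mul1r mulr1.
Qed.

End DoubleCentralizer.

(** * Projective modules as idempotent matrices, and matrix factorizations *)

Section IndexedMatrices.
Variable S : comPzRingType.
Implicit Types I J K L : finType.

(** With arbitrary finite index types, direct sums and tensor products of modules are sums and
    products of index types, without casts between dimensions. *)
Definition mat I J : Type := I -> J -> S.

Definition mm I J K (a : mat I J) (b : mat J K) : mat I K :=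
  fun i k => \sum_j a i j * b j k.
Definition idm I : mat I I := fun i j => (i == j)%:R.
Definition mzero I J : mat I J := fun _ _ => 0.
Arguments mzero : clear implicits.
Definition madd I J (a b : mat I J) : mat I J := fun i j => a i j + b i j.
Definition mscale I J (k : S) (a : mat I J) : mat I J := fun i j => k * a i j.
Definition kr I J K L (a : mat I J) (b : mat K L) : mat (I * K)%type (J * L)%type :=
  fun p q => a p.1 q.1 * b p.2 q.2.
Definition blk I J K L (a : mat I K) (b : mat I L) (c : mat J K) (d : mat J L) :
    mat (I + J)%type (K + L)%type := fun p q =>
  match p, q with
  | inl i, inl k => a i k | inl i, inr l => b i l
  | inr j, inl k => c j k | inr j, inr l => d j l
  end.

Lemma matP I J (a b : mat I J) : (forall i j, a i j = b i j) -> a = b.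
Proof. by move=> ab; apply/funext => i; apply/funext => j. Qed.

Lemma mmA I J K L (a : mat I J) (b : mat J K) (c : mat K L) :
  mm a (mm b c) = mm (mm a b) c.
Proof.
apply: matP => i l; rewrite /mm.
under eq_bigr => j _ do rewrite big_distrr /=.
rewrite exchange_big /=; apply: eq_bigr => k _.
by rewrite big_distrl /=; apply: eq_bigr => j _; rewrite mulrA.
Qed.

Lemma sum_deltal I (i : I) (F : I -> S) : \sum_j (i == j)%:R * F j = F i.
Proof.
rewrite (bigD1 i) //= eqxx mul1r big1 ?addr0 // => j.
by rewrite eq_sym => /negbTE ->; rewrite mul0r.
Qed.

Lemma sum_deltar I (i : I) (F : I -> S) : \sum_j F j * (j == i)%:R = F i.
Proof.
by rewrite -[RHS](sum_deltal i F); apply: eq_bigr => j _; rewrite mulrC eq_sym.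
Qed.

Lemma mm1l I J (a : mat I J) : mm (@idm I) a = a.
Proof. by apply: matP => i j; apply: sum_deltal. Qed.
Lemma mm1r I J (a : mat I J) : mm a (@idm J) = a.
Proof. by apply: matP => i j; apply: (sum_deltar j (a i)). Qed.

Lemma mmDl I J K (a b : mat I J) (c : mat J K) : mm (madd a b) c = madd (mm a c) (mm b c).
Proof.
by apply: matP => i j; rewrite /mm /madd -big_split; apply: eq_bigr => k _; rewrite mulrDl.
Qed.
Lemma mmDr I J K (a : mat I J) (b c : mat J K) : mm a (madd b c) = madd (mm a b) (mm a c).
Proof.
by apply: matP => i j; rewrite /mm /madd -big_split; apply: eq_bigr => k _; rewrite mulrDr.
Qed.
Lemma mmZl I J K k (a : mat I J) (b : mat J K) : mm (mscale k a) b = mscale k (mm a b).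
Proof.
by apply: matP => i j; rewrite /mm /mscale big_distrr /=; apply: eq_bigr => l _; rewrite mulrA.
Qed.
Lemma mmZr I J K k (a : mat I J) (b : mat J K) : mm a (mscale k b) = mscale k (mm a b).
Proof.
by apply: matP => i j; rewrite /mm /mscale big_distrr /=; apply: eq_bigr => l _; rewrite mulrCA.
Qed.
Lemma mm0l I J K (b : mat J K) : mm (mzero I J) b = mzero I K.
Proof. by apply: matP => i j; rewrite /mm big1 // => k _; rewrite mul0r. Qed.
Lemma mm0r I J K (a : mat I J) : mm a (mzero J K) = mzero I K.
Proof. by apply: matP => i j; rewrite /mm big1 // => k _; rewrite mulr0. Qed.
Lemma madd0 I J (a : mat I J) : madd a (mzero I J) = a.
Proof. by apply: matP => i j; apply: addr0. Qed.
Lemma madd0l I J (a : mat I J) : madd (mzero I J) a = a.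
Proof. by apply: matP => i j; apply: add0r. Qed.
Lemma mscaleA I J k l (a : mat I J) : mscale k (mscale l a) = mscale (k * l) a.
Proof. by apply: matP => i j; apply: mulrA. Qed.
Lemma mscale1 I J (a : mat I J) : mscale 1 a = a.
Proof. by apply: matP => i j; apply: mul1r. Qed.
Lemma mscaleD I J k l (a : mat I J) : madd (mscale k a) (mscale l a) = mscale (k + l) a.
Proof. by apply: matP => i j; rewrite /madd /mscale mulrDl. Qed.
Lemma mscale0 I J (a : mat I J) : mscale 0 a = mzero I J.
Proof. by apply: matP => i j; apply: mul0r. Qed.

Lemma mm_kr I J K I' J' K' (a : mat I J) (b : mat J K) (a' : mat I' J') (b' : mat J' K') :
  mm (kr a a') (kr b b') = kr (mm a b) (mm a' b').
Proof.
apply: matP => -[i i'] [k k']; rewrite /mm /kr /= big_distrl /=.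
rewrite -(pair_bigA _ (fun j j' => a i j * a' i' j' * (b j k * b' j' k'))) /=.
apply: eq_bigr => j _; rewrite big_distrr /=; apply: eq_bigr => j' _.
by rewrite mulrACA.
Qed.

Lemma kr_idm I J : kr (@idm I) (@idm J) = @idm (I * J)%type.
Proof. by apply: matP => -[i i'] [j j']; rewrite /kr /idm -natrM mulnb xpair_eqE. Qed.
Lemma krZl I J K L k (a : mat I J) (b : mat K L) : kr (mscale k a) b = mscale k (kr a b).
Proof. by apply: matP => p q; rewrite /kr /mscale mulrA. Qed.
Lemma krZr I J K L k (a : mat I J) (b : mat K L) : kr a (mscale k b) = mscale k (kr a b).
Proof. by apply: matP => p q; rewrite /kr /mscale mulrCA. Qed.

Lemma mm_blk I J K L M N (a : mat I K) (b : mat I L) (c : mat J K) (d : mat J L)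
    (a' : mat K M) (b' : mat K N) (c' : mat L M) (d' : mat L N) :
  mm (blk a b c d) (blk a' b' c' d') =
  blk (madd (mm a a') (mm b c')) (madd (mm a b') (mm b d'))
      (madd (mm c a') (mm d c')) (madd (mm c b') (mm d d')).
Proof. by apply: matP => -[i|j] [k|l]; rewrite /mm big_sumType. Qed.

Lemma blkZ I J K L k (a : mat I K) (b : mat I L) (c : mat J K) (d : mat J L) :
  mscale k (blk a b c d) = blk (mscale k a) (mscale k b) (mscale k c) (mscale k d).
Proof. by apply: matP => -[i|j] [l|m]. Qed.

Lemma blk_idm I J : blk (@idm I) (mzero I J) (mzero J I) (@idm J) = @idm (I + J)%type.
Proof. by apply: matP => -[i|j] [k|l]. Qed.

Lemma mm_reindex I J K I' J' K' (u : I' -> I) (v : J' -> J) (w : K' -> K)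
    (a : mat I J) (b : mat J K) : bijective v ->
  mm (fun i j => a (u i) (v j)) (fun j k => b (v j) (w k)) =
  (fun i k => mm a b (u i) (w k)).
Proof.
by move=> bv; apply: matP => i k; rewrite /mm [RHS](reindex v) //; apply: onW_bij.
Qed.

Record idem := Idem {
  ix : finType;
  im : mat ix ix;
  imP : mm im im = im
}.
Arguments im : clear implicits.
Implicit Types X Y Z U V : idem.

(** These matrices are the homomorphisms between the presented projective modules, with [im X] as
    the identity of X. *)
Definition ismor X Y (a : mat (ix X) (ix Y)) : Prop :=
  mm (im X) a = a /\ mm a (im Y) = a.

(* A matrix factorization of f; for f = 1 it is an isomorphism of the projective
   modules presented by X and Y. *)
Definition mfact (f : S) X Y : Prop :=
  exists (a : mat (ix X) (ix Y)) (b : mat (ix Y) (ix X)),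
  [/\ ismor a, ismor b, mm a b = mscale f (im X) & mm b a = mscale f (im Y)].

Lemma mfact_sym f X Y : mfact f X Y -> mfact f Y X.
Proof. by move=> [a [b [ha hb ab ba]]]; exists b, a. Qed.

Lemma mfact_comp f g X Y Z : mfact f X Y -> mfact g Y Z -> mfact (f * g) X Z.
Proof.
move=> [a [b [[a1 a2] [b1 b2] ab ba]]] [c [d [[c1 c2] [d1 d2] cd dc]]].
exists (mm a c), (mm d b); split.
- by split; rewrite ?mmA ?a1 // -mmA c2.
- by split; rewrite ?mmA ?d1 // -mmA b2.
- by rewrite -mmA (mmA c) cd mmZl b1 mmZr ab mscaleA mulrC.
- by rewrite -mmA (mmA b) ba mmZl c1 mmZr dc mscaleA.
Qed.

Lemma mfact_scale g f X Y : mfact f X Y -> mfact (g * f) X Y.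
Proof.
move=> [a [b [[a1 a2] hb ab ba]]]; exists (mscale g a), b; split=> //.
- by split; rewrite ?mmZr ?mmZl ?a1 ?a2.
- by rewrite mmZl ab mscaleA.
- by rewrite mmZr ba mscaleA.
Qed.

Lemma mfact0 X Y : mfact 0 X Y.
Proof.
by exists (mzero _ _), (mzero _ _); split;
  rewrite ?mscale0 ?mm0l //; split; rewrite ?mm0l ?mm0r.
Qed.

Lemma mfact_refl X : mfact 1 X X.
Proof. by exists (im X), (im X); split; rewrite ?mscale1 ?imP //; split; rewrite imP. Qed.

Lemma mfact1_trans X Y Z : mfact 1 X Y -> mfact 1 Y Z -> mfact 1 X Z.
Proof. by rewrite -{3}(mulr1 1); apply: mfact_comp. Qed.

Definition osum X Y : idem.
Proof.
refine (@Idem (ix X + ix Y)%type (blk (im X) (mzero _ _) (mzero _ _) (im Y)) _).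
by rewrite mm_blk !imP !mm0l !mm0r !madd0 madd0l.
Defined.

Definition otens X Y : idem.
Proof.
refine (@Idem (ix X * ix Y)%type (kr (im X) (im Y)) _).
by rewrite mm_kr !imP.
Defined.

Definition fr I : idem := @Idem I (@idm I) (mm1l (@idm I)).

Lemma mfact_osum f X X' Y Y' :
  mfact f X X' -> mfact f Y Y' -> mfact f (osum X Y) (osum X' Y').
Proof.
move=> [a [b [[a1 a2] [b1 b2] ab ba]]] [c [d [[c1 c2] [d1 d2] cd dc]]].
exists (blk a (mzero _ _) (mzero _ _) c), (blk b (mzero _ _) (mzero _ _) d); split.
- by split; rewrite /= mm_blk !mm0l !mm0r !madd0 madd0l ?a1 ?a2 ?c1 ?c2.
- by split; rewrite /= mm_blk !mm0l !mm0r !madd0 madd0l ?b1 ?b2 ?d1 ?d2.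
- rewrite /= mm_blk !mm0l !mm0r !madd0 madd0l ab cd blkZ.
  by congr (blk _ _ _ _); apply: matP => i j; rewrite /mscale mulr0.
- rewrite /= mm_blk !mm0l !mm0r !madd0 madd0l ba dc blkZ.
  by congr (blk _ _ _ _); apply: matP => i j; rewrite /mscale mulr0.
Qed.

Lemma mfact_otens f g X X' Y Y' :
  mfact f X X' -> mfact g Y Y' -> mfact (f * g) (otens X Y) (otens X' Y').
Proof.
move=> [a [b [[a1 a2] [b1 b2] ab ba]]] [c [d [[c1 c2] [d1 d2] cd dc]]].
exists (kr a c), (kr b d); split.
- by split; rewrite /= mm_kr ?a1 ?a2 ?c1 ?c2.
- by split; rewrite /= mm_kr ?b1 ?b2 ?d1 ?d2.
- by rewrite /= mm_kr ab cd krZl krZr mscaleA.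
- by rewrite /= mm_kr ba dc krZl krZr mscaleA.
Qed.

(* With Koszul signs the mixed terms cancel and the two scalars add up. *)
Lemma mfact_tensor f g U V X Y : mfact f U V -> mfact g X Y ->
  mfact (f + g) (osum (otens U X) (otens V Y)) (osum (otens U Y) (otens V X)).
Proof.
move=> [a [b [[a1 a2] [b1 b2] ab ba]]] [c [d [[c1 c2] [d1 d2] cd dc]]].
pose N I J (m : mat I J) := mscale (-1) m.
exists (blk (kr (im U) c) (kr a (im X)) (N _ _ (kr b (im Y))) (kr (im V) d)).
exists (blk (kr (im U) d) (N _ _ (kr a (im Y))) (kr b (im X)) (kr (im V) c)).
have cancel I J (m : mat I J) : madd (mscale (-1) m) m = mzero I J.
  by apply: matP => i j; rewrite /madd /mscale mulN1r addNr.
have cancel' I J (m : mat I J) : madd m (mscale (-1) m) = mzero I J.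
  by apply: matP => i j; rewrite /madd /mscale mulN1r addrN.
have NN I J (m : mat I J) : mscale (-1) (mscale (-1) m) = m.
  by rewrite mscaleA mulrNN mulr1 mscale1.
have z I J k : mscale k (mzero I J) = mzero I J.
  by apply: matP => i j; rewrite /mscale mulr0.
split.
- split; rewrite /= mm_blk ?mm0l ?mm0r ?madd0 ?madd0l /N ?mmZr ?mmZl !mm_kr !imP.
  + by rewrite c1 a1 b1 d1.
  + by rewrite c2 a2 b2 d2.
- split; rewrite /= mm_blk ?mm0l ?mm0r ?madd0 ?madd0l /N ?mmZr ?mmZl !mm_kr !imP.
  + by rewrite c1 a1 b1 d1.
  + by rewrite c2 a2 b2 d2.
- rewrite /= mm_blk !mmZr !mmZl ?NN !mm_kr !imP a1 a2 b1 b2 c1 c2 d1 d2 ab ba cd dc.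
  rewrite !krZl !krZr ?mscaleA !blkZ !z.
  by rewrite !mscaleD ?cancel ?cancel' [g + f]addrC.
- rewrite /= mm_blk !mmZr !mmZl ?NN !mm_kr !imP a1 a2 b1 b2 c1 c2 d1 d2 ab ba cd dc.
  rewrite !krZl !krZr ?mscaleA !blkZ !z.
  by rewrite !mscaleD ?cancel ?cancel' [g + f]addrC.
Qed.

Lemma mfact1_reindex X Y (u : ix X -> ix Y) : bijective u ->
  (forall i j, im X i j = im Y (u i) (u j)) -> mfact 1 X Y.
Proof.
move=> bu uE.
have imXE : im X = fun i j => im Y (u i) (u j) by apply: matP.
have bid (I : finType) : bijective (@id I) by exists id.
exists (fun i j => im Y (u i) j), (fun j i => im Y j (u i)).
split; rewrite ?mscale1 ?imXE.
- split; first by rewrite imXE [LHS](mm_reindex u id (im Y) (im Y) bu) imP.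
  by rewrite [LHS](mm_reindex u id (im Y) (im Y) (bid _)) imP.
- split; first by rewrite [LHS](mm_reindex id u (im Y) (im Y) (bid _)) imP.
  by rewrite imXE [LHS](mm_reindex id u (im Y) (im Y) bu) imP.
- by rewrite [LHS](mm_reindex u u (im Y) (im Y) (bid _)) imP.
- by rewrite [LHS](mm_reindex id id (im Y) (im Y) bu) imP.
Qed.

End IndexedMatrices.

Arguments mm {S I J K}.
Arguments idm S I : clear implicits.
Arguments mzero S I J : clear implicits.
Arguments im {S} i.

(** * Local freeness of projective modules *)

Section LocallyFree.
Variable S : comPzRingType.
Implicit Types X Y Z : idem S.

(* 1 = \det (e + (1 - e)) is expanded along the columns: the summand of J is the
   determinant of a matrix g with e g = g E_J, where E_J is the diagonal idempotent of J. *)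
Lemma locally_free_ord n (e : mat S 'I_n 'I_n) (eP : mm e e = e) :
  exists f : {set 'I_n} -> S,
    \sum_J f J = 1 /\ forall J : {set 'I_n}, mfact (f J) (Idem eP) (fr S 'I_(#|J|)).
Proof.
pose g (J : {set 'I_n}) : 'M[S]_n :=
  \matrix_(i, j) (if j \in J then e i j else (i == j)%:R - e i j).
exists (fun J => \det (g J)); split.
  transitivity (\det (1%:M : 'M[S]_n)); last exact: det1.
  under eq_bigr => J _ do rewrite -det_tr.
  rewrite /determinant exchange_big /=; apply: eq_bigr => s _.
  rewrite -big_distrr /=; congr (_ * _).
  transitivity (\prod_i (e (s i) i + ((s i == i)%:R - e (s i) i))).
    rewrite bigA_distr; apply: eq_big => [J|J _]; first by rewrite inE.
    by apply: eq_bigr => i _; rewrite !mxE.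
  by apply: eq_bigr => i _; rewrite !mxE addrCA subrr addr0 eq_sym.
move=> J; set G := g J.
pose ev (k : 'I_(#|J|)) : 'I_n := enum_val k.
have evJ k : ev k \in J by apply: enum_valP.
have eG i j : \sum_k e i k * G k j = (if j \in J then e i j else 0).
  case: ifP => jJ.
    transitivity (mm e e i j); last by rewrite eP.
    by apply: eq_bigr => k _; rewrite mxE jJ.
  transitivity (e i j - mm e e i j); last by rewrite eP subrr.
  rewrite -{1}(sum_deltar j (e i)) -sumrB; apply: eq_bigr => k _.
  by rewrite mxE jJ mulrBr.
have GJ i j : j \in J -> G i j = e i j by move=> jJ; rewrite mxE jJ.
pose d : S := \det G.
have adjG i j : \sum_k (\adj G) i k * G k j = d * (i == j)%:R.
  have := mul_adj_mx G => /matrixP/(_ i j); rewrite !mxE => ->.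
  exact/esym/mulr_natr.
have Gadj i j : \sum_k G i k * (\adj G) k j = d * (i == j)%:R.
  have := mul_mx_adj G => /matrixP/(_ i j); rewrite !mxE => ->.
  exact/esym/mulr_natr.
(* The map [a] consists of the columns of G in J, and [b] of the rows of adj(G) e in J. Then a b = e
   G adj(G) e = d e, while b a is the J-block of adj(G) G, because e fixes the columns of G in J. *)
pose a : mat S 'I_n 'I_(#|J|) := fun i k => G i (ev k).
pose A : mat S 'I_n 'I_n := fun i j => (\adj G) i j.
pose b : mat S 'I_(#|J|) 'I_n := fun k j => mm A e (ev k) j.
have GA : mm (fun i j => G i j : S) A = mscale d (idm S 'I_n).
  by apply: matP => i j; apply: Gadj.
have ab : mm a b = mscale d e.
  apply: matP => i j; rewrite /mm /a /b.
  transitivity (\sum_(k in J) G i k * mm A e k j).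
    by rewrite [RHS]big_enum_val; apply: eq_bigr => k _.
  transitivity (mm (mm e (fun i j => G i j : S)) (mm A e) i j).
    rewrite big_mkcond; apply: eq_bigr => k _; rewrite [in RHS]/mm eG.
    by case: ifP => kJ; rewrite ?mul0r ?GJ.
  by rewrite -mmA (mmA _ A) GA mmZl mm1l mmZr eP.
exists a, b; split=> //=.
- split; last exact: mm1r.
  by apply: matP => i k; rewrite /mm /a eG evJ GJ.
- split; first exact: mm1l.
  by apply: matP => k j; rewrite /b -[in RHS]eP mmA.
- apply: matP => k l.
  transitivity (mm (mm A e) (fun i j => G i j : S) (ev k) (ev l)) => //.
  rewrite -mmA; transitivity (\sum_j A (ev k) j * G j (ev l)).
    by apply: eq_bigr => j _; rewrite /mm eG evJ GJ.
  by rewrite adjG /mscale /idm (inj_eq enum_val_inj).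
Qed.

Lemma locally_free X : exists (I : finType) (f : I -> S) (k : I -> nat),
  \sum_i f i = 1 /\ forall i, mfact (f i) X (fr S 'I_(k i)).
Proof.
pose n := #|ix X|.
pose e : mat S 'I_n 'I_n := fun i j => im X (enum_val i) (enum_val j).
have eP : mm e e = e.
  by rewrite [LHS](mm_reindex _ _ (im X) (im X) (enum_val_bij _)) imP.
have [f [f1 fX]] := locally_free_ord eP.
exists {set 'I_n}, f, (fun J : {set 'I_n} => #|J|); split=> // J; rewrite -(mul1r (f J)).
apply: mfact_comp (fX J).
apply: (@mfact1_reindex _ X (Idem eP) enum_rank); first exact: enum_rank_bij.
by move=> i j /=; rewrite /e !enum_rankK.
Qed.

(** Padding the two factors of f times the identity with zeros makes them square; the first then has
    a zero column, so the determinant of the product vanishes. *)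
Lemma mfact_fr_small f m n : mfact f (fr S 'I_(m + n.+1)) (fr S 'I_m) -> f ^+ (m + n.+1) = 0.
Proof.
move=> [a [b [_ _ ab _]]].
pose A : 'M[S]_(m + n.+1) := row_mx (\matrix_(i, j) a i j) 0.
pose B : 'M[S]_(m + n.+1) := col_mx (\matrix_(i, j) b i j) 0.
have AB : A *m B = f%:M.
  rewrite mul_row_col mul0mx addr0; apply/matrixP => i j; rewrite !mxE.
  transitivity (mm a b i j); first by apply: eq_bigr => k _; rewrite !mxE.
  by rewrite ab /mscale /= /idm mulr_natr.
rewrite -det_scalar -AB det_mulmx (expand_det_col A (rshift m ord0)) big1 ?mul0r //.
by move=> i _; rewrite row_mxEr mxE mul0r.
Qed.

Lemma mfact_fr_neq f m n : mfact f (fr S 'I_m) (fr S 'I_n) -> m <> n -> exists k, f ^+ k = 0.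
Proof.
move=> h /eqP; rewrite neq_ltn => /orP[mn|nm].
  exists n; have {}h := mfact_sym h.
  have E : n = (m + (n - m.+1).+1)%N by rewrite addnS -addSn subnKC.
  by rewrite E in h *; apply: mfact_fr_small h.
exists m; have E : m = (n + (m - n.+1).+1)%N by rewrite addnS -addSn subnKC.
by rewrite E in h *; apply: mfact_fr_small h.
Qed.

End LocallyFree.

(** * Splitting off free summands by Toeplitz matrices *)

Section FreeSummands.
Variable S : comPzRingType.
Implicit Types (X Y Z : idem S) (I J : finType).

(** The scalars r up to which T has a right inverse form an ideal. *)
Definition splits I J (T : mat S I J) (r : S) : Prop :=
  exists T' : mat S J I, mm T T' = mscale r (idm S I).

Lemma splitsD I J (T : mat S I J) r s : splits T r -> splits T s -> splits T (r + s).
Proof.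
by move=> [T1 E1] [T2 E2]; exists (madd T1 T2); rewrite mmDr E1 E2 mscaleD.
Qed.

Lemma splitsM I J (T : mat S I J) k r : splits T r -> splits T (k * r).
Proof. by move=> [T1 E1]; exists (mscale k T1); rewrite mmZr E1 mscaleA. Qed.

Lemma splits0 I J (T : mat S I J) : splits T 0.
Proof. by exists (mzero _ _ _); rewrite mm0r mscale0. Qed.

(** The radical of an ideal is closed under addition: for the exponent m + n every term of the
    binomial expansion contains r^m or y^n. *)
Lemma splits_sum I J (T : mat S I J) (s : seq S) :
    (forall r, r \in s -> exists n, splits T (r ^+ n)) ->
  exists n, splits T ((\sum_(r <- s) r) ^+ n).
Proof.
elim: s => [|r s IHs] h.
  by exists 1%N; rewrite big_nil expr1; apply: splits0.
have [m hm] := h r (mem_head r s).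
have [|n hn] := IHs; first by move=> x xs; apply: h; rewrite inE xs orbT.
exists (m + n)%N; rewrite big_cons; set y := \sum_(_ <- _) _ in hn *.
rewrite exprDn; apply: (big_ind (splits T)) => [|x x'|i _].
- exact: splits0.
- exact: splitsD.
rewrite -mulr_natl; apply: splitsM.
have [mi|im] := leqP i n.
  have -> : r ^+ (m + n - i) = r ^+ (n - i) * r ^+ m.
    by rewrite -exprD [in RHS]addnC addnBA.
  by rewrite mulrC mulrA; apply: splitsM.
have -> : y ^+ i = y ^+ (i - n) * y ^+ n by rewrite -exprD subnK // ltnW.
by rewrite mulrA; apply: splitsM.
Qed.

(** The k-th power of the nilpotent shift, in closed form so that it visibly vanishes for k = N;
    [shiftd] is its transpose. *)
Definition shiftu N (k : nat) : mat S 'I_N 'I_N := fun i j => (j == (i + k)%N :> nat)%:R.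
Definition shiftd N (k : nat) : mat S 'I_N 'I_N := fun i j => (i == (j + k)%N :> nat)%:R.

Arguments shiftu : clear implicits.
Arguments shiftd : clear implicits.

Lemma shiftu_mul N k : mm (shiftu N 1) (shiftu N k) = shiftu N k.+1.
Proof.
apply: matP => i j; rewrite /mm /shiftu.
have [iN|Ni] := ltnP (i + 1)%N N.
  rewrite (bigD1 (Ordinal iN)) //= eqxx mul1r big1 ?addr0 ?addnS ?addSn ?addn0 //.
  move=> l /negbTE; rewrite -val_eqE /= => ->; exact: mul0r.
rewrite big1 => [|l _].
  case: eqP => // ji; have := leq_trans (ltn_ord j) Ni.
  by rewrite ji ltn_add2l ltnS ltn0.
case: eqP => [li|_]; rewrite ?mul0r //.
by have := ltn_ord l; rewrite li ltnNge Ni.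
Qed.

Lemma shiftd_mul N k : mm (shiftd N 1) (shiftd N k) = shiftd N k.+1.
Proof.
apply: matP => i j; rewrite /mm /shiftd.
have [jN|Nj] := ltnP (j + k)%N N.
  rewrite (bigD1 (Ordinal jN)) //= eqxx mulr1 big1 ?addr0 ?addnS ?addn0 //.
  move=> l /negbTE; rewrite -val_eqE /= => ->; exact: mulr0.
rewrite big1 => [|l _].
  case: eqP => // ij; have := leq_trans (ltn_ord i) Nj.
  by rewrite ij ltn_add2l ltnNge leqnSn.
case: (l =P _ :> nat) => [lj|_]; rewrite ?mulr0 //.
by have := ltn_ord l; rewrite lj ltnNge Nj.
Qed.

(** Truncated geometric series: with n k the k-th power of the nilpotent n 1, multiplying r + c (x)
    n 1 by it leaves r^k - (-c)^k (x) n k, which is r^N for k = N. *)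
Lemma scalar_plus_nilpotent I N r (c : mat S I I) (n : nat -> mat S 'I_N 'I_N) :
    n 0%N = idm S 'I_N -> (forall k, mm (n 1%N) (n k) = n k.+1) ->
    n N = mzero S 'I_N 'I_N ->
  splits (madd (mscale r (idm S (I * 'I_N)%type)) (kr c (n 1%N))) (r ^+ N).
Proof.
move=> n0 nS nN; pose p k : mat S I I := iter k (mm (mscale (-1) c)) (idm S I).
set T := madd _ _.
have geom k : exists g, mm T g =
    madd (mscale (r ^+ k) (idm S (I * 'I_N)%type)) (mscale (-1) (kr (p k) (n k))).
  elim: k => [|k [g gE]].
    exists (mzero S _ _); rewrite mm0r n0 kr_idm expr0 mscaleD subrr.
    exact/esym/mscale0.
  exists (madd (mscale r g) (kr (p k) (n k))).
  rewrite mmDr mmZr gE mmDl mmZl mm1l mm_kr nS exprS.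
  apply: matP => i j; rewrite /= mmZl krZl /madd /mscale.
  by rewrite mulrDr !mulN1r opprK mulrN mulrA -addrA addKr.
have [g gE] := geom N.
exists g; rewrite gE nN; apply: matP => i j.
by rewrite /madd /mscale /kr /mzero !mulr0 addr0.
Qed.

End FreeSummands.

Arguments shiftu S N k : clear implicits.
Arguments shiftd S N k : clear implicits.

Section Toeplitz.
Variable S : comPzRingType.
Implicit Types (X Y Z : idem S) (I J : finType).

Lemma splits_mull I J K (T : mat S I J) (U : mat S J K) r : splits (mm T U) r -> splits T r.
Proof. by move=> [V VE]; exists (mm U V); rewrite mmA. Qed.

Lemma sum_eq_eq I (x y : I) : \sum_l (l == x)%:R * (l == y)%:R = (x == y)%:R :> S.
Proof.
rewrite (bigD1 x) //= eqxx mul1r big1 ?addr0 // => l /negbTE ->.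
exact: mul0r.
Qed.

(* Toeplitz matrix of the pencil T1 + t T2, from polynomials of degree < N to
   polynomials of degree <= N. *)
Lemma pencil I Z (T1 T2 : mat S I (ix Z)) N :
    mm T1 (im Z) = T1 -> mm T2 (im Z) = T2 ->
  exists T : mat S (I * 'I_N)%type (ix Z * 'I_N.+1)%type,
  [/\ mm T (im (otens Z (fr S 'I_N.+1))) = T,
      forall r, splits T1 r -> splits T (r ^+ N)
    & forall r, splits T2 r -> splits T (r ^+ N)].
Proof.
move=> T1Z T2Z.
(* In monomial bases [L] is the inclusion of polynomials and [H] the multiplication by t; each is
   split by its transpose. *)
pose L : mat S 'I_N 'I_N.+1 := fun i j => (j == widen_ord (leqnSn N) i)%:R.
pose H : mat S 'I_N 'I_N.+1 := fun i j => (j == lift ord0 i)%:R.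
pose L' : mat S 'I_N.+1 'I_N := fun j i => L i j.
pose H' : mat S 'I_N.+1 'I_N := fun j i => H i j.
have LL : mm L L' = idm S 'I_N by apply: matP => i j; apply: sum_eq_eq.
have HH : mm H H' = idm S 'I_N.
  by apply: matP => i j; rewrite /mm sum_eq_eq /idm -val_eqE.
have HL : mm H L' = shiftu S N 1.
  apply: matP => i j; rewrite /mm sum_eq_eq /shiftu; congr (nat_of_bool _)%:R.
  by rewrite -val_eqE /= eq_sym addn1.
have LH : mm L H' = shiftd S N 1.
  apply: matP => i j; rewrite /mm sum_eq_eq /shiftd; congr (nat_of_bool _)%:R.
  by rewrite -val_eqE /= addn1.
exists (madd (kr T1 L) (kr T2 H)); split.
- by rewrite mmDl !mm_kr T1Z T2Z !mm1r.
(* Composing with T' (x) L' gives r plus the product of T2 T' with a nilpotent shift. *)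
- move=> r [T' T'E]; apply: (@splits_mull _ _ _ _ (kr T' L')).
  rewrite mmDl !mm_kr LL HL T'E krZl kr_idm.
  apply: (scalar_plus_nilpotent r (mm T2 T') (n := shiftu S N)).
  + by apply: matP => i j; rewrite /shiftu /idm addn0 eq_sym.
  + exact: shiftu_mul.
  + apply: matP => i j; rewrite /shiftu /mzero; case: eqP => // ji.
    by have := ltn_ord j; rewrite ji ltnNge leq_addl.
- move=> r [T' T'E]; apply: (@splits_mull _ _ _ _ (kr T' H')).
  rewrite mmDl !mm_kr HH LH T'E krZl kr_idm.
  have -> (a b : mat S (I * 'I_N)%type (I * 'I_N)%type) : madd a b = madd b a.
    by apply: matP => i j; apply: addrC.
  apply: (scalar_plus_nilpotent r (mm T1 T') (n := shiftd S N)).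
  + by apply: matP => i j; rewrite /shiftd /idm addn0.
  + exact: shiftd_mul.
  + apply: matP => i j; rewrite /shiftd /mzero; case: eqP => // ij.
    by have := ltn_ord i; rewrite ij ltnNge leq_addl.
Qed.

(** One matrix is to serve all scalars of s. They are absorbed one at a time by a pencil, each
    multiplying the copies of the source by N and those of the target by N + 1, a ratio close to 1
    for large N. *)
Lemma amplify I Z (s : seq S) N :
    (forall r, r \in s -> exists2 T : mat S I (ix Z),
       mm T (im Z) = T & exists m, splits T (r ^+ m)) ->
  exists (A B : finType) (T : mat S (I * A)%type (ix Z * B)%type),
  [/\ #|A| = (N ^ size s)%N, #|B| = (N.+1 ^ size s)%N,
      mm T (im (otens Z (fr S B))) = T
    & forall r, r \in s -> exists m, splits T (r ^+ m)].
Proof.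
elim: s => [|x s IHs] h.
  exists unit, unit, (mzero S _ _); rewrite !expn0 card_unit.
  by split=> //; rewrite mm0l.
have [r xs|A [B [T [cA cB TZ Ts]]]] := IHs; first by apply: h; rewrite inE xs orbT.
have [T1 T1Z [m T1x]] := h x (mem_head x s).
have leAB : (#|A| <= #|B|)%N by rewrite cA cB; case: (size s) => // k; rewrite leq_exp2r.
(* An injection of A into B inflates [T1] to a matrix of the same shape as [T], as the pencil
   requires. *)
pose u (a : A) : B := enum_val (widen_ord leAB (enum_rank a)).
have u_inj : injective u.
  by move=> a a' /enum_val_inj/(congr1 val)/= /val_inj/enum_rank_inj.
pose io : mat S A B := fun a b => (b == u a)%:R.
pose io' : mat S B A := fun b a => (b == u a)%:R.
have ioK : mm io io' = idm S A.
  by apply: matP => a a'; rewrite /mm sum_eq_eq (inj_eq u_inj).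
have T2Z : mm (kr T1 io) (im (otens Z (fr S B))) = kr T1 io.
  by rewrite mm_kr T1Z mm1r.
have [T3 [T3Z T3T T3x]] := pencil N TZ T2Z.
pose v (p : I * (A * 'I_N)) : I * A * 'I_N := ((p.1, p.2.1), p.2.2).
pose w (p : ix Z * (B * 'I_N.+1)) : ix Z * B * 'I_N.+1 := ((p.1, p.2.1), p.2.2).
have v_inj : injective v by move=> [i [a n]] [i' [a' n']] [-> -> ->].
have w_bij : bijective w by exists (fun p => (p.1.1, (p.1.2, p.2))) => [[? []]|[[]]].
pose T4 : mat S (I * (A * 'I_N))%type (ix Z * (B * 'I_N.+1))%type := fun p q => T3 (v p) (w q).
have T4s r : splits T3 r -> splits T4 r.
  move=> [T' T'E]; exists (fun q p => T' (w q) (v p)).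
  rewrite /T4 (mm_reindex v v T3 T' w_bij) T'E; apply: matP => i j.
  by rewrite /mscale /idm (inj_eq v_inj).
exists (A * 'I_N)%type, (B * 'I_N.+1)%type, T4; split.
- by rewrite card_prod card_ord cA expnSr.
- by rewrite card_prod card_ord cB expnSr.
- have -> : im (otens Z (fr S (B * 'I_N.+1)%type)) = (fun q q' =>
      im (otens (otens Z (fr S B)) (fr S 'I_N.+1)) (w q) (w q')).
    by apply: matP => -[z [b n]] [z' [b' n']]; rewrite /= -kr_idm /kr /= mulrA.
  by rewrite [LHS](mm_reindex v w T3 _ w_bij) T3Z.
- move=> r; rewrite inE => /orP[/eqP->|/Ts[k Tk]].
    exists (m * N)%N; rewrite exprM; apply/T4s/T3x.
    have [T' T'E] := T1x; exists (kr T' io').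
    by rewrite mm_kr T'E ioK krZl kr_idm.
  by exists (k * N)%N; rewrite exprM; apply/T4s/T3T.
Qed.

Lemma split_off X Y (T : mat S (ix X) (ix Y)) (T' : mat S (ix Y) (ix X)) :
    ismor T -> ismor T' -> mm T T' = im X ->
  exists W, mfact 1 Y (osum X W).
Proof.
move=> [XT TY] [T'Y T'X] TT'.
(* The complement of X in Y is the image of the idempotent 1 - T' T of Y. *)
pose w : mat S (ix Y) (ix Y) := madd (im Y) (mscale (-1) (mm T' T)).
have sub0 K K' (m : mat S K K') : madd m (mscale (-1) m) = mzero S K K'.
  by apply: matP => i j; rewrite /madd /mscale mulN1r subrr.
have subK K K' (m n : mat S K K') : madd n (madd m (mscale (-1) n)) = m.
  by apply: matP => i j; rewrite /madd /mscale mulN1r addrC subrK.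
have Tw : mm T w = mzero S _ _ by rewrite mmDr mmZr TY mmA TT' XT sub0.
have wT : mm w T' = mzero S _ _ by rewrite mmDl mmZl T'Y -mmA TT' T'X sub0.
have Yw : mm (im Y) w = w by rewrite mmDr imP mmZr mmA T'Y.
have wY : mm w (im Y) = w by rewrite mmDl imP mmZl -mmA TY.
have wP : mm w w = w.
  rewrite {1}/w mmDl Yw mmZl -mmA Tw mm0r.
  by apply: matP => i j; rewrite /madd /mscale /mzero mulr0 addr0.
exists (Idem wP).
exists (fun i q => match q with inl k => T' i k | inr j => w i j end).
exists (fun q j => match q with inl k => T k j | inr i => w i j end).
split.
- split; apply: matP => i.
    by move=> [k|j] /=; [rewrite -[in RHS]T'Y | rewrite -[in RHS]Yw].
  move=> [k|j]; rewrite /mm big_sumType /=.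
    rewrite [X in _ + X]big1 ?addr0 => [|l _]; last exact: mulr0.
    by rewrite -[in RHS]T'X.
  rewrite [X in X + _]big1 ?add0r => [|l _]; last exact: mulr0.
  by rewrite -[in RHS]wP.
- split; apply: matP.
    move=> [k|i] j; rewrite /mm big_sumType /=.
      rewrite [X in _ + X]big1 ?addr0 => [|l _]; last exact: mul0r.
      by rewrite -[in RHS]XT.
    rewrite [X in X + _]big1 ?add0r => [|l _]; last exact: mul0r.
    by rewrite -[in RHS]wP.
  by move=> [k|i] j /=; [rewrite -[in RHS]TY | rewrite -[in RHS]wY].
- rewrite mscale1; apply: matP => i j; rewrite /mm big_sumType /=.
  transitivity (madd (mm T' T) (mm w w) i j) => //.
  by rewrite wP subK.
- rewrite mscale1; apply: matP => -[k|i] [l|j] /=.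
  + by rewrite -TT'.
  + by rewrite -[RHS]/(mzero S _ _ k j) -Tw.
  + by rewrite -[RHS]/(mzero S _ _ i l) -wT.
  + by rewrite -[in RHS]wP.
Qed.

Lemma split_off_free I Y (T : mat S I (ix Y)) : mm T (im Y) = T -> splits T 1 ->
  exists W, mfact 1 Y (osum (fr S I) W).
Proof.
move=> TY [T']; rewrite mscale1 => TT'.
apply: (@split_off (fr S I) Y T (mm (im Y) T')).
- by split; rewrite ?mm1l.
- by split; rewrite ?mm1r // mmA imP.
- by rewrite mmA TY.
Qed.

End Toeplitz.

Local Notation "x +m y" := (cm_mul x y) (at level 50, left associativity).
Local Notation "0m" := (cm_one _).

(** * Multiples in a commutative monoid *)

Section Multiples.
Variable M : comMonoid.
Implicit Types x y z : M.

Definition nmul (n : nat) x : M := iter n (cm_mul x) 0m.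

Lemma cm_mul0 x : x +m 0m = x.
Proof. by rewrite cm_mulC cm_mul1. Qed.
Lemma cm_mulCA x y z : x +m (y +m z) = y +m (x +m z).
Proof. by rewrite !cm_mulA (cm_mulC x). Qed.
Lemma cm_mulACA x y z t : (x +m y) +m (z +m t) = (x +m z) +m (y +m t).
Proof. by rewrite -!cm_mulA (cm_mulCA y). Qed.

Lemma nmulS n x : nmul n.+1 x = x +m nmul n x.
Proof. by []. Qed.
Lemma nmulDn m n x : nmul (m + n) x = nmul m x +m nmul n x.
Proof. by elim: m => [|m IHm]; rewrite ?cm_mul1 // addSn !nmulS IHm cm_mulA. Qed.
Lemma nmulDr n x y : nmul n (x +m y) = nmul n x +m nmul n y.
Proof. by elim: n => [|n IHn]; rewrite ?cm_mul1 // !nmulS IHn cm_mulACA. Qed.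
Lemma nmulM m n x : nmul (m * n) x = nmul m (nmul n x).
Proof. by elim: m => [|m IHm] //; rewrite mulSn nmulDn IHm. Qed.

Lemma nmul_additive (F : M -> M) : F 0m = 0m -> {morph F : x y / x +m y} ->
  forall n x, F (nmul n x) = nmul n (F x).
Proof. by move=> F0 FD n x; elim: n => [|n IHn] //; rewrite !nmulS FD IHn. Qed.

(* b x = l u + w gives (b + 1) x = q u + b x, hence (b + j) x = j q u + b x, where
   b x can be absorbed into the free part as soon as j q >= l b. *)
Lemma stably_free_multiple (u x w : M) (l q b : nat) : (0 < q)%N -> (0 < b)%N ->
    x +m nmul l u = nmul (l + q) u -> nmul b x = nmul l u +m w ->
  exists n m, [/\ (0 < n)%N, (0 < m)%N & nmul n x = nmul m u].
Proof.
case: q => // q _ b_gt0 xl bx.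
have xb : x +m nmul b x = nmul q.+1 u +m nmul b x.
  by rewrite {1}bx cm_mulA xl addnC nmulDn -cm_mulA -bx.
have step j : nmul (j + b) x = nmul (j * q.+1) u +m nmul b x.
  elim: j => [|j IHj]; first by rewrite cm_mul1.
  by rewrite addSn nmulS IHj cm_mulCA xb cm_mulA -nmulDn mulSn addnC.
(* This is [step] for j = l b: a part l b u of the free summand joins b x to form b (x + l u), which
   is free. *)
exists (l * b + b)%N, (l * b * q + b * (l + q.+1))%N; split.
- by rewrite addn_gt0 b_gt0 orbT.
- by rewrite addn_gt0 [X in _ || X]muln_gt0 b_gt0 addnS orbT.
have E : nmul (l * b) u +m nmul b x = nmul (b * (l + q.+1)) u.
  by rewrite [(l * b)%N]mulnC nmulM cm_mulC -nmulDr xl nmulM.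
by rewrite step mulnS addnC nmulDn -cm_mulA E -nmulDn.
Qed.

End Multiples.

(** The ratio (1 + 1/N)^m tends to 1. Bernoulli's inequality [bern] gives an explicit N: if m > 0
    and N + 1 = (k + 1) m, then N + 1 - m = k m. *)
Lemma ratio_power_bound k m : exists N : nat, (k * N.+1 ^ m <= k.+1 * N ^ m)%N.
Proof.
have bern (N : nat) : (N.+1 ^ m * (N.+1 - m) <= N ^ m * N.+1)%N.
  elim: m => [|m IHm]; first by rewrite !expn0 subn0.
  have [mN|Nm] := leqP m N; last first.
    by rewrite (_ : (N.+1 - m.+1)%N = 0%N) ?muln0 //; apply/eqP; rewrite subn_eq0 ltnW.
  rewrite expnS -mulnA mulnCA [(N ^ m.+1)%N]expnS -mulnA.
  apply: (@leq_trans (N * (N.+1 ^ m * (N.+1 - m)))); last by rewrite leq_mul2l IHm orbT.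
  rewrite [X in (_ <= X)%N]mulnCA leq_mul2l; apply/orP; right.
  rewrite subSS subSn // mulSn mulnS leq_add2r.
  exact: leq_subr.
case: m bern => [|m] bern; first by exists 0%N; rewrite !expn0 !muln1.
have N_gt0 : (0 < k.+1 * m.+1)%N by [].
exists (k.+1 * m.+1).-1.
have := bern (k.+1 * m.+1).-1; rewrite prednK // mulSn addKn -mulSn.
by rewrite !mulnA leq_mul2r /= [X in (X <= _)%N]mulnC [X in (_ <= X)%N]mulnC.
Qed.

(** * The semiring of classes of projective modules *)

Section ProjectiveClasses.
Variable S : comPzRingType.
Implicit Types (X Y Z : idem S) (I J : finType).

Let E0 : forall X, mfact 1 X X := @mfact_refl S.
Let Es : forall X Y, mfact 1 X Y -> mfact 1 Y X := @mfact_sym S 1.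
Let Et : forall X Y Z, mfact 1 X Y -> mfact 1 Y Z -> mfact 1 X Z := @mfact1_trans S.

Let osumA X Y Z : mfact 1 (osum X (osum Y Z)) (osum (osum X Y) Z).
Proof.
pose u (p : ix X + (ix Y + ix Z)) : ix X + ix Y + ix Z :=
  match p with inl x => inl (inl x) | inr (inl y) => inl (inr y) | inr (inr z) => inr z end.
apply: (@mfact1_reindex S (osum X (osum Y Z)) (osum (osum X Y) Z) u);
  last by move=> [?|[?|?]] [?|[?|?]].
exists (fun p => match p with
  inl (inl x) => inl x | inl (inr y) => inr (inl y) | inr z => inr (inr z) end).
  by move=> [?|[?|?]].
by move=> [[?|?]|?].
Qed.

Let osumC X Y : mfact 1 (osum X Y) (osum Y X).
Proof.
pose u I J (p : I + J) : J + I := match p with inl x => inr x | inr y => inl y end.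
apply: (@mfact1_reindex S (osum X Y) (osum Y X) (u _ _)); last by move=> [?|?] [?|?].
by exists (u _ _) => -[].
Qed.

Let osum0 X : mfact 1 (osum (fr S void) X) X.
Proof.
pose u (p : void + ix X) : ix X := match p with inl x => match x with end | inr y => y end.
apply: (@mfact1_reindex S (osum (fr S void) X) X u); last by move=> [[]|?] [[]|?].
by exists inr => // -[[]|].
Qed.

(* Finitely generated projective S-modules up to isomorphism, presented by idempotents. *)
Definition proj_class : comMonoid :=
  @class_monoid (idem S) (mfact 1) E0 Es Et (@osum S) (fr S void)
    (fun X X' Y Y' => @mfact_osum S 1 X X' Y Y') osumA osumC osum0.
Implicit Types x y z : proj_class.

Definition cl X : proj_class := class_of (mfact 1) X.

Lemma clP X Y : cl X = cl Y <-> mfact 1 X Y.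
Proof. exact: class_ofP. Qed.

Lemma cl_surj x : exists X, x = cl X.
Proof. by exists (class_repr x); rewrite /cl class_reprK. Qed.

Lemma clD X Y : cl X +m cl Y = cl (osum X Y).
Proof. by apply: class_mulE => // X1 X2 Y1 Y2; apply: mfact_osum. Qed.

Lemma cl0 : cm_one proj_class = cl (fr S void).
Proof. by []. Qed.

Definition pmul x y : proj_class := class_mul (E := mfact 1) (@otens S) x y.
Local Notation "x *m y" := (pmul x y) (at level 40, left associativity).

Lemma pmulE X Y : cl X *m cl Y = cl (otens X Y).
Proof.
by apply: class_mulE => // X1 X2 Y1 Y2; rewrite -{3}(mulr1 1); apply: mfact_otens.
Qed.

Lemma pmulDl x y z : (x +m y) *m z = x *m z +m y *m z.
Proof.
have [[[X ->] [Y ->]] [Z ->]] := (cl_surj x, cl_surj y, cl_surj z).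
rewrite !(clD, pmulE); apply/clP.
pose u (p : (ix X + ix Y) * ix Z) : ix X * ix Z + ix Y * ix Z :=
  match p with (inl i, k) => inl (i, k) | (inr j, k) => inr (j, k) end.
apply: (@mfact1_reindex S (otens (osum X Y) Z) (osum (otens X Z) (otens Y Z)) u).
  exists (fun p => match p with inl q => (inl q.1, q.2) | inr q => (inr q.1, q.2) end).
    by move=> [[?|?] ?].
  by move=> [[? ?]|[? ?]].
by move=> [[?|?] ?] [[?|?] ?] //=; rewrite /kr /= /mzero ?mul0r.
Qed.

Lemma pmulDr x y z : x *m (y +m z) = x *m y +m x *m z.
Proof.
have [[[X ->] [Y ->]] [Z ->]] := (cl_surj x, cl_surj y, cl_surj z).
rewrite !(clD, pmulE); apply/clP.
pose u (p : ix X * (ix Y + ix Z)) : ix X * ix Y + ix X * ix Z :=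
  match p with (i, inl j) => inl (i, j) | (i, inr k) => inr (i, k) end.
apply: (@mfact1_reindex S (otens X (osum Y Z)) (osum (otens X Y) (otens X Z)) u).
  exists (fun p => match p with inl q => (q.1, inl q.2) | inr q => (q.1, inr q.2) end).
    by move=> [? [?|?]].
  by move=> [[? ?]|[? ?]].
by move=> [? [?|?]] [? [?|?]] //=; rewrite /kr /= /mzero ?mulr0.
Qed.

Definition pone : proj_class := cl (fr S unit).

Lemma pmul1 x : x *m pone = x.
Proof.
have [X ->] := cl_surj x; rewrite pmulE; apply/clP.
apply: (@mfact1_reindex S (otens X (fr S unit)) X fst);
  first by exists (fun i => (i, tt)) => // -[i []].
by move=> [i []] [j []]; rewrite /= /kr /= /idm mulr1.
Qed.

Lemma pmul1l x : pone *m x = x.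
Proof.
have [X ->] := cl_surj x; rewrite pmulE; apply/clP.
apply: (@mfact1_reindex S (otens (fr S unit) X) X snd);
  first by exists (fun i => (tt, i)) => // -[[] i].
by move=> [[] i] [[] j]; rewrite /= /kr /= /idm mul1r.
Qed.

Lemma pmul0l x : 0m *m x = 0m.
Proof.
have [X ->] := cl_surj x; rewrite cl0 pmulE; apply/clP.
apply: (@mfact1_reindex S (otens (fr S void) X) (fr S void) fst); last by case=> -[].
by exists (@of_void _) => [[[]]|[]].
Qed.

Lemma pmul0r x : x *m 0m = 0m.
Proof.
have [X ->] := cl_surj x; rewrite cl0 pmulE; apply/clP.
apply: (@mfact1_reindex S (otens X (fr S void)) (fr S void) snd); last by case=> ? [].
by exists (@of_void _) => [[? []]|[]].
Qed.

Lemma pmul_natl n x y : nmul n x *m y = nmul n (x *m y).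
Proof. by apply: (nmul_additive (F := pmul^~ y)) => [|a b]; rewrite ?pmul0l ?pmulDl. Qed.
Lemma pmul_natr n x y : x *m nmul n y = nmul n (x *m y).
Proof. by apply: (nmul_additive (F := pmul x)) => [|a b]; rewrite ?pmul0r ?pmulDr. Qed.

Lemma cl_fr I : cl (fr S I) = nmul #|I| pone.
Proof.
transitivity (cl (fr S 'I_#|I|)).
  apply/clP; apply: (@mfact1_reindex S (fr S I) (fr S 'I_#|I|) enum_rank).
    exact: enum_rank_bij.
  by move=> i j /=; rewrite /idm (inj_eq enum_rank_inj).
elim: #|I| => [|n IHn].
  rewrite [nmul 0 _]cl0; apply/clP.
  have v0 (i : 'I_0) : void by case: i.
  apply: (@mfact1_reindex S (fr S 'I_0) (fr S void) v0); last by case.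
  by exists (@of_void _) => [[]|[]].
rewrite nmulS -IHn clD; apply/clP.
pose u (i : 'I_n.+1) : unit + 'I_n :=
  match unlift ord0 i with Some j => inr j | None => inl tt end.
have ub : bijective u.
  exists (fun p => match p with inl _ => ord0 | inr j => lift ord0 j end) => [i|[[]|j]].
  - by rewrite /u; case: unliftP => [j ->|->].
  - by rewrite /u unlift_none.
  - by rewrite /u liftK.
apply: (@mfact1_reindex S (fr S 'I_n.+1) (osum (fr S unit) (fr S 'I_n)) u) => // i j /=.
rewrite blk_idm /idm; congr (nat_of_bool _)%:R.
by apply/esym; apply: (inj_eq (bij_inj ub)).
Qed.

Definition pfact (f : S) x y : Prop :=
  exists X Y, [/\ x = cl X, y = cl Y & mfact f X Y].

(** Changing representatives composes with isomorphisms, whose scalar is 1. *)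
Lemma pfactE f X Y : pfact f (cl X) (cl Y) <-> mfact f X Y.
Proof.
split=> [[X' [Y' [/clP XX' /clP YY' h]]]|h]; last by exists X, Y.
have := mfact_comp (mfact_comp XX' h) (mfact_sym YY').
by rewrite mul1r mulr1.
Qed.

Lemma pfact_sym f x y : pfact f x y -> pfact f y x.
Proof. by move=> [X [Y [-> -> h]]]; apply/pfactE/mfact_sym. Qed.

Lemma pfact_comp f g x y z : pfact f x y -> pfact g y z -> pfact (f * g) x z.
Proof.
have [[[X ->] [Y ->]] [Z ->]] := (cl_surj x, cl_surj y, cl_surj z).
move=> /pfactE h /pfactE h'; apply/pfactE; exact: mfact_comp h h'.
Qed.

Lemma pfact_scale g f x y : pfact f x y -> pfact (g * f) x y.
Proof. by move=> [X [Y [-> -> h]]]; apply/pfactE/mfact_scale. Qed.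

Lemma pfact_scaler g f x y : pfact f x y -> pfact (f * g) x y.
Proof. by rewrite mulrC; apply: pfact_scale. Qed.

Lemma pfact0 x y : pfact 0 x y.
Proof.
by have [[X ->] [Y ->]] := (cl_surj x, cl_surj y); apply/pfactE/mfact0.
Qed.

Lemma pfactD f x x' y y' : pfact f x x' -> pfact f y y' -> pfact f (x +m y) (x' +m y').
Proof.
move=> [X [X' [-> -> h]]] [Y [Y' [-> -> h']]]; rewrite !clD; apply/pfactE.
exact: mfact_osum.
Qed.

Lemma pfact_refl f x : pfact f x x.
Proof.
have [X ->] := cl_surj x; rewrite -(mulr1 f); apply/pfactE/mfact_scale.
exact: mfact_refl.
Qed.

Lemma pfact_nmul f n x y : pfact f x y -> pfact f (nmul n x) (nmul n y).
Proof.
by move=> h; elim: n => [|n IHn]; [exact: pfact_refl | rewrite !nmulS; apply: pfactD].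
Qed.

Lemma pfact_pmull f x y z : pfact f x y -> pfact f (x *m z) (y *m z).
Proof.
move=> [X [Y [-> -> h]]]; have [Z ->] := cl_surj z; rewrite !pmulE; apply/pfactE.
by rewrite -(mulr1 f); apply: mfact_otens h (mfact_refl Z).
Qed.

Lemma pfact_tensor f g x y z t : pfact f x y -> pfact g z t ->
  pfact (f + g) (x *m z +m y *m t) (x *m t +m y *m z).
Proof.
move=> [X [Y [-> -> h]]] [Z [T [-> -> h']]]; rewrite !pmulE !clD; apply/pfactE.
exact: mfact_tensor.
Qed.

Lemma pfact_nat_neq f m n : pfact f (nmul m pone) (nmul n pone) -> m <> n ->
  exists k, f ^+ k = 0.
Proof.
rewrite -{1}(card_ord m) -{1}(card_ord n) -!cl_fr => /pfactE h.
exact: mfact_fr_neq h.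
Qed.

Lemma locally_free_class x : exists (I : finType) (f : I -> S) (k : I -> nat),
  \sum_i f i = 1 /\ forall i, pfact (f i) x (nmul (k i) pone).
Proof.
have [X ->] := cl_surj x; have [I [f [k [f1 fX]]]] := locally_free X.
exists I, f, k; split=> // i.
by rewrite -(card_ord (k i)) -cl_fr; apply/pfactE.
Qed.

(** The matrix [im X] is both a map from X to a free module and a retraction of it. *)
Lemma class_complement x : exists y n, x +m y = nmul n pone.
Proof.
have [X ->] := cl_surj x.
have mX : @ismor S X (fr S (ix X)) (im X) by split; [exact: (imP X) | exact: mm1r].
have mX' : @ismor S (fr S (ix X)) X (im X) by split; [exact: mm1l | exact: (imP X)].
have [W /clP] := split_off mX mX' (imP X).
by rewrite cl_fr -clD => XW; exists (cl W), #|ix X|.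
Qed.

End ProjectiveClasses.

(** * Free multiples of faithful projective modules *)

Section Bass.
Variable S : comPzRingType.
Local Notation V := (proj_class S).
Local Notation "x *m y" := (pmul x y) (at level 40, left associativity).
Local Notation one := (pone S).
Implicit Types x y z p : V.

(* The number of free summands per copy of z tends to K as N grows. *)
Lemma free_summands z K (I : finType) (f : I -> S) : \sum_i f i = 1 ->
    (forall i, (exists m, f i ^+ m = 0) \/
       exists2 k, (K <= k)%N & pfact (f i) z (nmul k one)) ->
  exists m, forall N, exists w,
    nmul (N.+1 ^ m.+1) z = nmul (K * N ^ m.+1) one +m w.
Proof.
move=> f1 h; have [Z zE] := cl_surj z; rewrite {}zE in h *.
exists (size [seq f i | i <- enum I]) => N.
(* The additional scalar 0, split by the zero matrix, gives the exponent the form m + 1. *)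
have [|A [B [T [cA cB TZ Ts]]]] := @amplify S 'I_K Z (0 :: [seq f i | i <- enum I]) N.
  move=> r; rewrite inE => /orP[/eqP->|/mapP[i _ ->]].
    exists (mzero S _ _); first exact: mm0l.
    by exists 1%N; apply: splits0.
  have [[m fm]|[k Kk]] := h i.
    exists (mzero S _ _); first exact: mm0l.
    by exists m; rewrite fm; apply: splits0.
  rewrite -{1}(card_ord k) -cl_fr => /pfactE[a [b [[a1 a2] [b1 b2] ab ba]]].
  pose io : mat S 'I_K 'I_k := fun i j => (j == widen_ord Kk i)%:R.
  exists (mm io b); first by rewrite -mmA b2.
  exists 1%N; exists (mm a (fun j i => io i j)).
  rewrite -mmA (mmA b) ba mmZl mm1l mmZr expr1; congr mscale.
  by apply: matP => i' j'; rewrite /mm sum_eq_eq.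
have [n] := splits_sum Ts.
rewrite big_cons add0r big_map big_enum /= f1 expr1n => T1.
have [W /clP] := split_off_free TZ T1.
rewrite -pmulE cl_fr pmul_natr pmul1 -clD cl_fr card_prod card_ord cA cB /= => ->.
by exists (cl W).
Qed.

(* The two sides are the even and the odd part of the formal product \prod_q (q.2 - p). *)
Lemma stable_inverse p (s : seq (S * nat)) :
    (forall q, q \in s -> pfact q.1 (nmul q.2 one) p) ->
  exists e o, pfact (\sum_(q <- s) q.1)
    (nmul (\prod_(q <- s) q.2) one +m e *m p) (o *m p).
Proof.
elim: s => [|q s IHs] h.
  by exists 0m, 0m; rewrite !big_nil; apply: pfact0.
have [|e [o eo]] := IHs; first by move=> r rs; apply: h; rewrite inE rs orbT.
have := pfact_tensor eo (h q (mem_head q s)).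
set c := \prod_(_ <- _) _; set u := nmul c _ +m _.
rewrite !pmul_natr !pmul1 nmulDr -nmulM -pmul_natl -[in nmul q.2 (o *m p)]pmul_natl.
rewrite -cm_mulA -pmulDl -[in X in pfact _ _ X]pmulDl => {}eo.
by exists (nmul q.2 e +m o *m p), (u +m nmul q.2 o); rewrite !big_cons addrC.
Qed.

(** The hypothesis is faithfulness of p. First a class z with z p = n0 + d p is found, then d is
    subtracted from z after passing to a multiple, which yields a stably free x = w p, and finally a
    multiple of x is free. *)
Lemma free_multiple p :
    (forall f : S, pfact f p 0m -> f = 0) ->
  exists w n, (0 < n)%N /\ w *m p = nmul n one.
Proof.
move=> faith; have [I [f [k [f1 fp]]]] := locally_free_class p.
(* Where the rank is 0, faithfulness gives f i = 0. Dropping these indices preserves the sum 1 and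
   makes the product n0 of the ranks positive. *)
pose s := [seq (f i, k i) | i <- enum I & (k i != 0)%N].
have f0 i : k i = 0%N -> f i = 0 by move=> k0; apply: faith; have := fp i; rewrite k0.
have [|e [o]] := @stable_inverse p s.
  by move=> q /mapP[i _ ->]; apply: pfact_sym; apply: fp.
have -> : \sum_(q <- s) q.1 = 1.
  rewrite /s big_map big_filter big_enum_cond /= big_mkcond -f1 /=.
  apply: eq_bigr => i _; case: eqP => //= /f0.
  by [].
have n0_gt0 : (0 < \prod_(q <- s) q.2)%N.
  rewrite big_seq; apply: prodn_cond_gt0 => q /mapP[i].
  by rewrite mem_filter => /andP[ki _] ->; rewrite lt0n.
set n0 := \prod_(q <- s) q.2 in n0_gt0 *.
move=> [X [Y [eX eY /clP XY]]]; have {eX eY XY X Y} eo :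
  nmul n0 one +m e *m p = o *m p by rewrite eX eY.
have [e' [d ed]] := class_complement e.
(* Adding e' p to both sides replaces e by the integer d, so that formally p (z - d) = n0. *)
pose z := o +m e'.
have zp : z *m p = nmul n0 one +m nmul d p.
  by rewrite pmulDl -eo -cm_mulA -pmulDl ed pmul_natl pmul1l.
have [J [g [l [g1 gz]]]] := locally_free_class z.
have [||m zm] := @free_summands z d.+1 (I * J)%type (fun q => f q.1 * g q.2).
- rewrite -(pair_bigA _ (fun i j => f i * g j)) /=.
  under eq_bigr => i _ do rewrite -mulr_sumr g1 mulr1.
  exact: f1.
- move=> [i j] /=; set r := f i * g j.
  have rp : pfact r p (nmul (k i) one) by apply: pfact_scaler.
  have rz : pfact r z (nmul (l j) one) by apply: pfact_scale.
  (* For ranks k of p and l of z the equation requires l k = n0 + d k, hence l > d. If l <= d, the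
     two ranks of z p differ and r is nilpotent. *)
  have [lt|le] := ltnP d (l j); first by right; exists (l j).
  left.
  have h1 := pfact_pmull p rz; rewrite pmul_natl pmul1l in h1.
  have {h1} h1 := pfact_comp h1 (pfact_nmul (l j) rp); rewrite -nmulM in h1.
  have h2 : pfact r (z *m p) (nmul (n0 + d * k i) one).
    by rewrite zp nmulDn nmulM; apply: pfactD; [apply: pfact_refl | apply: pfact_nmul].
  have [|t] := pfact_nat_neq (pfact_comp (pfact_sym h1) h2).
    move=> lk; have : (l j * k i <= d * k i)%N by rewrite leq_mul2r le orbT.
    by rewrite lk -{2}[(d * k i)%N]add0n leq_add2r leqNgt n0_gt0.
  rewrite (_ : r * r * r = r ^+ 3); last by rewrite !exprS expr0 mulr1 mulrA.
  by rewrite -exprM => rt; exists (3 * t)%N.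
(* N is chosen so that the (d + 1) N^(m+1) free summands of b z, with b = (N + 1)^(m+1), number at
   least d b. *)
have [N dN] := ratio_power_bound d m.+1.
have [w0 zw0] := zm N; set b := (N.+1 ^ m.+1)%N in dN zw0.
have b_gt0 : (0 < b)%N by rewrite expn_gt0.
have [w zw] : exists w, nmul b z = nmul (d * b) one +m w.
  exists (nmul (d.+1 * N ^ m.+1 - d * b) one +m w0).
  by rewrite zw0 cm_mulA -nmulDn subnKC.
have [p' [n pn]] := class_complement p.
(* Multiplying b z = d b + w by p gives x + d b p = b n0 + d b p. Completing d b p to a free module
   shows that x is stably free of rank q. *)
pose x := w *m p; pose q := (b * n0)%N; pose l0 := (d * b * n)%N.
have xl : x +m nmul l0 one = nmul (l0 + q) one.
  have xp : x +m nmul (d * b) p = nmul q one +m nmul (d * b) p.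
    transitivity (nmul b z *m p); first by rewrite zw pmulDl pmul_natl pmul1l cm_mulC.
    by rewrite pmul_natl zp nmulDr -!nmulM [(d * b)%N]mulnC.
  by rewrite /l0 nmulM -pn nmulDr cm_mulA xp -cm_mulA -nmulDr pn -nmulM -nmulDn addnC.
have q_gt0 : (0 < q)%N by rewrite muln_gt0 b_gt0.
(* Since q > 0, rank 0 occurs in x only with nilpotent scalars, so K = 1 is allowed. Taking N = l0
   yields the l0 free summands needed to absorb the stable part. *)
have [J' [g' [k' [g'1 g'x]]]] := locally_free_class x.
have [|m' xm] := free_summands (K := 1) g'1 (z := x).
  move=> i; case: (posnP (k' i)) => [k0|k_gt0]; last by right; exists (k' i).
  left; have := pfactD (g'x i) (pfact_refl (g' i) (nmul l0 one)).
  rewrite xl -nmulDn => /pfact_nat_neq; apply.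
  by rewrite k0 addnC => /eqP; rewrite eqn_add2r => /eqP q0; rewrite q0 in q_gt0.
have [w1 xw1] := xm l0; set b' := (l0.+1 ^ m'.+1)%N in xw1.
have b'_gt0 : (0 < b')%N by rewrite expn_gt0.
have l0_le : (l0 <= 1 * l0 ^ m'.+1)%N.
  rewrite mul1n; case: (posnP l0) => [->|l_gt0] //.
  by rewrite expnS leq_pmulr // expn_gt0 l_gt0.
have xw : nmul b' x = nmul l0 one +m (nmul (1 * l0 ^ m'.+1 - l0) one +m w1).
  by rewrite xw1 cm_mulA -nmulDn subnKC.
have [n1 [m1 [_ m1_gt0 xn]]] := stably_free_multiple q_gt0 b'_gt0 xl xw.
by exists (nmul n1 w), m1; rewrite pmul_natl.
Qed.

End Bass.

(* A faithful finitely generated projective module P tensored with a suitable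
   projective module is free; A acts on the free module through its action on P = A. *)
Lemma azumaya_mx_embedding (S : comPzRingType) (A : pzAlg S) : is_azumaya A ->
  exists (n : nat) (h : A -> mx_alg S n), (0 < n)%N /\ alg_hom h.
Proof.
move=> azA; have [_ _ faithA _] := azA.
have [I [a [f [_ [_ [fl dual _ _ _]]]]]] := azumaya_data_nec azA.
have fs i : scalar (f i) by move=> k x y; rewrite fl.
(* Left multiplication in the dual basis. As (a, f) need not be a basis, [rho 1] is an idempotent
   presenting A rather than the identity. *)
pose rho (x : A) : mat S I I := fun i j => f i (x * a j).
have rhoM x y : mm (rho x) (rho y) = rho (x * y).
  apply: matP => i k; rewrite /rho /mm -mulrA {2}(dual (y * a k)) mulr_sumr.
  rewrite (scalar_fun_sum (fs i)); apply: eq_bigr => j _.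
  by rewrite -palgAr (scalar_funZ (fs i)) mulrC.
have rho1 : mm (rho 1) (rho 1) = rho 1 by rewrite rhoM mulr1.
pose P := Idem rho1.
(* A scalar whose multiplication on A factors through 0 annihilates A, hence is 0. *)
have [r [X [Y [PX Y0 XY]]]|w [n [n_gt0 wn]]] := @free_multiple S (cl P).
  have /pfactE[c [d [_ _ cd _]]] : pfact r (cl P) (cl (fr S void)) by exists X, Y.
  apply: faithA => x; rewrite (dual x) scaler_sumr big1 // => j _.
  rewrite scalerA mulrC -scalerA (_ : r *: a j = 0) ?scaler0 //.
  rewrite [a j]dual scaler_sumr big1 // => i _.
  have := congr1 (fun m => m i j) cd; rewrite /mm big1; last by case.
  by rewrite /mscale /= /rho mul1r scalerA => <-; rewrite scale0r.
have [W wE] := cl_surj w; move: wn; rewrite wE pmulE -{1}(card_ord n) -cl_fr => /clP.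
move=> [c [d [[c1 c2] [d1 d2]]]]; rewrite !mscale1 => cd dc.
(* The action 1 (x) x on W (x) A, carried to the free module by the isomorphisms [c] and [d]. *)
pose h0 x : mat S 'I_n 'I_n := mm d (mm (kr (im W) (rho x)) c).
have h0M x y : mm (h0 x) (h0 y) = h0 (x * y).
  rewrite /h0 -!mmA; congr (mm d _); rewrite (mmA c) cd !mmA !mm_kr !imP.
  by rewrite /= !rhoM mulr1.
exists n, (fun x => \matrix_(i, j) h0 x i j); split=> //; split=> [k x y|].
  apply/matrixP => i j; rewrite !mxE /h0 /mm mulr_sumr -big_split.
  apply: eq_bigr => l _ /=; rewrite mulrCA -mulrDr; congr (_ * _).
  rewrite mulr_sumr -big_split /=; apply: eq_bigr => t _.
  rewrite /kr /rho mulrDl -palgAl fl mulrDr mulrDl; congr (_ + _).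
  by rewrite mulrCA !mulrA.
split=> [|x y]; apply/matrixP => i j; rewrite !mxE.
  by rewrite /h0 c1 dc /= /idm.
by rewrite -h0M; apply: eq_bigr => l _; rewrite !mxE.
Qed.

(** The inverse is the centralizer of A in a matrix algebra; being a tensor factor of it, the
    centralizer is Azumaya. *)
Lemma azumaya_inverse (S : comPzRingType) (A : pzAlg S) : is_azumaya A ->
  exists (B : pzAlg S) (n : nat),
    [/\ is_azumaya B, (0 < n)%N & alg_iso (tensor_alg A B) (mx_alg S n)].
Proof.
move=> azA; have [n [h [n_gt0 hh]]] := azumaya_mx_embedding azA.
have iso := double_centralizer hh azA.
exists (centralizer h), n; split=> //.
exact: azumaya_factor_mx n_gt0 (alg_iso_trans (alg_iso_tensorC _ _) iso).
Qed.

(** * Brauer classes as stable isomorphism classes *)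

Section QuotientClasses.
Variables (M : comMonoid) (N : submonoid M).

Lemma quot_classP (x y : M) : quot_class N x = quot_class N y <-> quot_rel N x y.
Proof.
by apply: class_ofP; [exact: quot_rel_refl | exact: quot_rel_sym | exact: quot_rel_trans].
Qed.

Lemma quot_classM (x y : M) :
  cm_mul (quot_class N x) (quot_class N y) = quot_class N (cm_mul x y).
Proof.
by apply: class_mulE; [exact: quot_rel_refl | exact: quot_rel_sym
  | exact: quot_rel_trans | exact: quot_rel_mul].
Qed.

Lemma quot_class_surj (c : quot_monoid N) : exists x, c = quot_class N x.
Proof. by exists (class_repr c); rewrite /quot_class class_reprK. Qed.

End QuotientClasses.

Section BrauerClasses.
Variable S : comPzRingType.
Implicit Types A B : azumaya S.

Lemma MA_classP A B : MA_class A = MA_class B <-> alg_iso A B.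
Proof.
apply: class_ofP; [exact: (fun A => alg_iso_refl A) | exact: (fun A B => @alg_iso_sym S A B)
  | exact: (fun A B C => @alg_iso_trans S A B C)].
Qed.

Lemma MA_classM A B : cm_mul (MA_class A) (MA_class B) = MA_class (az_tensor A B).
Proof.
apply: class_mulE; [exact: (fun A => alg_iso_refl A)
  | exact: (fun A B => @alg_iso_sym S A B)
  | exact: (fun A B C => @alg_iso_trans S A B C)
  | exact: (fun A A' B B' => @alg_iso_tensor S A A' B B')].
Qed.

Lemma BM_classP A B : BM_class A = BM_class B <->
  exists n m, [/\ (0 < n)%N, (0 < m)%N &
    alg_iso (tensor_alg A (mx_alg S n)) (tensor_alg B (mx_alg S m))].
Proof.
split=> [/quot_classP[x [y [[n [n0 ->]] [m [m0 ->]]]]]|[n [m [n0 m0 iso]]]].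
  by rewrite !MA_classM => /MA_classP iso; exists n, m.
apply/quot_classP; exists (MA_class (az_mx S n0)), (MA_class (az_mx S m0)).
split; [by exists n, n0 | by exists m, m0 |].
by rewrite !MA_classM; apply/MA_classP.
Qed.

Lemma BM_classM A B : cm_mul (BM_class A) (BM_class B) = BM_class (az_tensor A B).
Proof. by rewrite [LHS]quot_classM MA_classM. Qed.

Lemma BM_class_surj (x : BM S) : exists A, x = BM_class A.
Proof.
have [c ->] := quot_class_surj x.
by exists (class_repr c); rewrite /BM_class /MA_class class_reprK.
Qed.

End BrauerClasses.

Section DiffBrauerClasses.
Variables (R : comPzRingType) (D : derivation R).
Implicit Types A B : diffAzumaya D.

Lemma MAdiff_classP A B : MAdiff_class A = MAdiff_class B <-> diff_iso A B.
Proof.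
apply: class_ofP; [exact: (fun A => diff_iso_refl A)
  | exact: (fun A B => @diff_iso_sym R D A B)
  | exact: (fun A B C => @diff_iso_trans R D A B C)].
Qed.

Lemma MAdiff_classM A B :
  cm_mul (MAdiff_class A) (MAdiff_class B) = MAdiff_class (daz_tensor A B).
Proof.
apply: class_mulE; [exact: (fun A => diff_iso_refl A)
  | exact: (fun A B => @diff_iso_sym R D A B)
  | exact: (fun A B C => @diff_iso_trans R D A B C)
  | exact: (fun A A' B B' => @diff_iso_tensor R D A A' B B')].
Qed.

Lemma BMdiff_classP A B : BMdiff_class A = BMdiff_class B <->
  exists n m, [/\ (0 < n)%N, (0 < m)%N &
    diff_iso (tensor_diff A (mx_diff D n)) (tensor_diff B (mx_diff D m))].
Proof.
split=> [/quot_classP[x [y [[n [n0 ->]] [m [m0 ->]]]]]|[n [m [n0 m0 iso]]]].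
  by rewrite !MAdiff_classM => /MAdiff_classP iso; exists n, m.
apply/quot_classP; exists (MAdiff_class (daz_mx D n0)), (MAdiff_class (daz_mx D m0)).
split; [by exists n, n0 | by exists m, m0 |].
by rewrite !MAdiff_classM; apply/MAdiff_classP.
Qed.

Lemma BMdiff_classM A B :
  cm_mul (BMdiff_class A) (BMdiff_class B) = BMdiff_class (daz_tensor A B).
Proof. by rewrite [LHS]quot_classM MAdiff_classM. Qed.

Lemma BMdiff_class_surj (x : BMdiff D) : exists A, x = BMdiff_class A.
Proof.
have [c ->] := quot_class_surj x.
by exists (class_repr c); rewrite /BMdiff_class /MAdiff_class class_reprK.
Qed.

End DiffBrauerClasses.

(** * Base change on Brauer classes *)

Section BaseChangeClasses.
Variables (R : comPzRingType) (D : derivation R).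
Notation S := (constants D).
Implicit Types A B : azumaya S.

Lemma bc_tensor_mx A n :
  const_form (tensor_alg A (mx_alg S n)) (tensor_diff (daz_bc A) (mx_diff D n)).
Proof.
apply: const_form_tensor (const_form_mx D n).
exact: const_form_base_change (az_azumaya A).
Qed.

(** A (x) M_n(S) is a form of the base change of A tensored with M_n(R). Uniqueness of forms gives
    one direction, and a form determining its differential algebra gives the other. *)
Lemma bc_class_eq A B :
  BMdiff_class (daz_bc A) = BMdiff_class (daz_bc B) <-> BM_class A = BM_class B.
Proof.
split=> [/BMdiff_classP|/BM_classP] [n [m [n0 m0 iso]]].
  apply/BM_classP; exists n, m; split=> //.
  exact: const_form_unique (const_form_isor iso (bc_tensor_mx A n)) (bc_tensor_mx B m).
apply/BMdiff_classP; exists n, m; split=> //.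
have /const_form_bc/diff_iso_sym isoA := bc_tensor_mx A n.
have /const_form_bc isoB := const_form_isol iso (bc_tensor_mx B m).
exact: diff_iso_trans isoA isoB.
Qed.

Lemma bc_class_mul A B : BMdiff_class (daz_bc (az_tensor A B)) =
  cm_mul (BMdiff_class (daz_bc A)) (BMdiff_class (daz_bc B)).
Proof.
rewrite BMdiff_classM; congr (quot_class _ _); apply/MAdiff_classP.
by apply/const_form_bc/const_form_tensor;
  apply: const_form_base_change; apply: az_azumaya.
Qed.

Lemma bc_class_one : BMdiff_class (daz_bc (az_base S)) = cm_one (BMdiff D).
Proof.
congr (quot_class _ _); apply/MAdiff_classP.
have isoS := const_form_isol (alg_iso_mx1 S) (const_form_mx D 1).
exact: diff_iso_trans (const_form_bc isoS) (diff_iso_sym (diff_iso_mx1 D)).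
Qed.

Lemma BM_inverse A : exists B, cm_mul (BM_class A) (BM_class B) = cm_one (BM S).
Proof.
have [B [n [azB n0 iso]]] := azumaya_inverse (az_azumaya A).
exists (Azumaya azB); rewrite BM_classM -[RHS]/(BM_class (az_base S)).
apply/BM_classP; exists 1%N, n; split=> //.
have isoA : alg_iso (tensor_alg (tensor_alg A B) (mx_alg S 1)) (tensor_alg A B).
  apply: alg_iso_trans (alg_iso_tensorC _ _) _.
  apply: alg_iso_trans _ (alg_iso_tensor1 _).
  by apply: alg_iso_tensor; [apply: alg_iso_sym; apply: alg_iso_mx1 | apply: alg_iso_refl].
apply: alg_iso_trans isoA (alg_iso_trans iso _).
exact: alg_iso_sym (alg_iso_tensor1 _).
Qed.

Lemma bc_class_unit A :
  exists v, cm_mul (BMdiff_class (daz_bc A)) v = cm_one (BMdiff D).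
Proof.
have [B AB] := BM_inverse A; exists (BMdiff_class (daz_bc B)).
rewrite -bc_class_mul -bc_class_one; apply/bc_class_eq.
by rewrite -BM_classM.
Qed.

(** Invertibility makes A a differential tensor factor of M_m(R), the other factor being B (x)
    M_n(R). Hence A is the base change of its constants. *)
Lemma unit_bc_class (A : diffAzumaya D) v :
    cm_mul (BMdiff_class A) v = cm_one (BMdiff D) ->
  exists A0, BMdiff_class (daz_bc A0) = BMdiff_class A.
Proof.
have [B ->] := BMdiff_class_surj v; rewrite BMdiff_classM -[cm_one _]/(BMdiff_class (daz_base D)).
move=> /BMdiff_classP[n [m [n0 m0 iso]]].
have isoM : diff_iso (tensor_diff A (tensor_diff B (mx_diff D n))) (mx_diff D m).
  apply: diff_iso_trans (diff_iso_tensorA _ _ _) _.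
  exact: diff_iso_trans iso (diff_iso_tensor1 _).
have [az0 form0] := const_alg_azumaya m0 isoM.
exists (Azumaya az0); congr (quot_class _ _); apply/MAdiff_classP.
exact: const_form_bc form0.
Qed.

End BaseChangeClasses.

Theorem theorem3 (R : comPzRingType) (D : derivation R) :
  exists2 f : BM (constants D) -> unit_group (BMdiff D),
    forall A0 : azumaya (constants D),
      unit_val (f (BM_class A0)) = BMdiff_class (daz_bc A0)
    & monoid_iso f.
Proof.
(* The map is defined on chosen representatives; [fE] shows that the choice does not affect the
   class. *)
have [rep repE] := choice (@BM_class_surj (constants D)).
pose f x : unit_group (BMdiff D) := UnitElt (bc_class_unit (rep x)).
have fE A0 : unit_val (f (BM_class A0)) = BMdiff_class (daz_bc A0).
  by apply/bc_class_eq; rewrite -repE.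
exists f => //; split.
- by apply: unit_val_inj; rewrite (fE (az_base _)) bc_class_one.
- move=> x y; apply: unit_val_inj; rewrite (repE x) (repE y) BM_classM fE bc_class_mul.
  by rewrite -!fE.
- have f_inj : injective f.
    by move=> x y /(congr1 (@unit_val (BMdiff D)))/bc_class_eq; rewrite -!repE.
  have f_surj y : exists x, f x = y.
    case: y => y [v yv]; have [A yA] := BMdiff_class_surj y.
    have [|A0 A0E] := @unit_bc_class _ _ A v; first by rewrite -yA.
    by exists (BM_class A0); apply: unit_val_inj; rewrite fE A0E /= -yA.
  have [g gE] := choice f_surj.
  by exists g => [x|y] //; apply: f_inj.
Qed.
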